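(* Let $\Gamma=PSL(2;7)$ be the projective special linear group over the finite field $\mathbb{F}_7$. The joint spectral measure (over $\mathbb{T}^2$) for the non-conjugate embeddings of $\Gamma$ into the fundamental representations of $G_2$ is $$\mathrm{d}\varepsilon = \frac{1}{672\pi^4} J^2 \, \mathrm{d}_7 \times \mathrm{d}_7 + \frac{1}{24} K' \, \mathrm{d}_4 \times \mathrm{d}_4 + \frac{1}{2} \, \mathrm{d}_3 \times \mathrm{d}_3 + \frac{1}{6} \beta \, \mathrm{d}_2 \times \mathrm{d}_2 - \frac{1}{28} \, \mathrm{d}_1 \times \mathrm{d}_1 - \frac{1}{6} \, \mathrm{d}^{(1)},$$ where for the embedding with $\varrho_1 = \Sigma_7$ we have $K' = 16-K$ and $\beta = 1$, whilst for the embedding with $\varrho_1 = \Sigma_1 + \Sigma_3 + \Sigma_3^{\ast}$ we have $K' = K$ and $\beta = 0$, with $$K(\theta_1,\theta_2) = 4\big(\sin(2\pi(\theta_1+\theta_2))-\sin(2\pi(2\theta_1-\theta_2))-\sin(2\pi(2\theta_2-\theta_1))\big)^2 .$$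
   Context: $G_2$ is the compact simply connected simple Lie group of dimension 14, with fundamental representations $\rho_1$, $\rho_2$ of dimensions 7 and 14. Its maximal torus is identified with $\mathbb{T}^2$ so that, for $(\omega_1,\omega_2)=(e^{2\pi i\theta_1},e^{2\pi i\theta_2})\in\mathbb{T}^2$, $$\chi_{\rho_1} = 1 + \omega_1 + \omega_1^{-1} + \omega_2 + \omega_2^{-1} + \omega_1\omega_2^{-1} + \omega_1^{-1}\omega_2,$$ $$\chi_{\rho_2} = \chi_{\rho_1} + 1 + \omega_1\omega_2 + \omega_1^{-1}\omega_2^{-1} + \omega_1^2\omega_2^{-1} + \omega_1^{-2}\omega_2 + \omega_1\omega_2^{-2} + \omega_1^{-1}\omega_2^2 .$$ The Weyl group $D_{12}$ of $G_2$ (dihedral of order 12) is the subgroup of $GL(2,\mathbb{Z})$ generated by $T_2=\begin{pmatrix}0&-1\\-1&0\end{pmatrix}$ and $T_6=\begin{pmatrix}0&1\\-1&1\end{pmatrix}$, acting on $\mathbb{T}^2$ by $T(\omega_1,\omega_2)=(\omega_1^{a_{11}}\omega_2^{a_{12}},\omega_1^{a_{21}}\omega_2^{a_{22}})$ for $T=(a_{il})$. An embedding of a finite group $\Gamma$ in $G_2$ is an injective homomorphism $\iota:\Gamma\to G_2$; put $\varrho_j=\rho_j\circ\iota$, $j=1,2$. Let $\Delta_j$ be the adjacency matrix of the McKay graph of $\varrho_j$ (the matrix of tensoring with $\varrho_j$ on the irreducible representations of $\Gamma$), and $e_{\ast}$ the basis vector of the trivial representation. The joint spectral measure over $\mathbb{T}^2$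 of the embedding is the unique $D_{12}$-invariant probability measure $\varepsilon$ on $\mathbb{T}^2$ such that for all integers $m,n\geq 0$ $$\int_{\mathbb{T}^2}\chi_{\rho_1}^m\chi_{\rho_2}^n\,\mathrm{d}\varepsilon=\langle\Delta_1^m\Delta_2^n e_\ast,e_\ast\rangle=\sum_C\frac{|C|}{|\Gamma|}\chi_{\varrho_1}(C)^m\chi_{\varrho_2}(C)^n,$$ the sum being over the conjugacy classes $C$ of $\Gamma$. Notation for measures on $\mathbb{T}^2$: $\mathrm{d}_k$ is the uniform probability measure on the $k$-th roots of unity; $\mathrm{d}^{(n)}$ is the uniform probability measure on $\{(e^{2\pi i q_1/3n},e^{2\pi i q_2/3n}) : q_1,q_2\in\{0,1,\ldots,3n-1\},\ q_1+q_2\equiv 0 \bmod 3\}$. A function multiplying a measure is a density, and functions on $\mathbb{T}^2$ are written in the coordinates $\theta_1,\theta_2$. The function $J$ is $$J = 8\pi^2\big(\cos 2\pi(2\theta_1+\theta_2)+\cos 2\pi(\theta_1-3\theta_2)+\cos 2\pi(3\theta_1-2\theta_2)-\cos 2\pi(\theta_1+2\theta_2)-\cos 2\pi(3\theta_1-\theta_2)-\cos 2\pi(2\theta_1-3\theta_2)\big).$$ $PSL(2;7)$ has order 168. Its irreducible representations are denoted $\Sigma_1$ (trivial), $\Sigma_3$ and its complex conjugate $\Sigma_3^\ast$ (dimension 3), $\Sigma_6,\Sigma_7,\Sigma_8$ (real, dimensions 6, 7, 8). Up to conjugacy in $G_2$ there are two embeddings of $PSL(2;7)$ in $G_2$, with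 $\varrho_1=\Sigma_7$ and $\varrho_1=\Sigma_1+\Sigma_3+\Sigma_3^\ast$ respectively.
   Formalization: The two values of β are interchanged: β = 0 for ϱ₁ = Σ₇ and β = 1 for ϱ₁ = Σ₁+Σ₃+Σ₃*; as printed, the right-hand side has total mass 7/6 and 5/6 respectively, so it is not a probability measure. *)

(* Defs.v *)
From HB Require Import structures.
From mathcomp Require Import all_boot all_order all_algebra all_fingroup.
From mathcomp Require Import all_solvable all_field all_character.
From mathcomp Require Import complex.
From mathcomp Require Import all_classical all_reals all_analysis.

Set Implicit Arguments.
Unset Strict Implicit.
Unset Printing Implicit Defensive.

Import Order.TTheory GRing.Theory Num.Theory.
Import numFieldNormedType.Exports.
Local Open Scope classical_set_scope.
Local Open Scope ring_scope.

(** * The group PSL(2; q) *)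

Section ProjectiveSpecialLinear.
Variable F : finFieldType.

Definition SL2 : {set {'GL_2[F]}} := [set g | \det (GLval g) == 1]%SET.

Lemma SL2_group_set : group_set SL2.
Proof.
apply/group_setP; split=> [|g h]; first by rewrite inE det1.
by rewrite !inE [GLval (_ * _)%g]GL_ME det_mulmx => /eqP-> /eqP->; rewrite mul1r.
Qed.
Canonical SL2_group := Group SL2_group_set.

Definition PSL2 := (SL2_group / 'Z(SL2_group))%G.
End ProjectiveSpecialLinear.

Notation PSL27 := (PSL2 'F_7).

(** * The compact Lie group G2 and its fundamental representations *)

Section G2.
Variable R : realType.

(* e_i x e_(i+1) = e_(i+3), indices mod 7: the product of the imaginary units
   of the octonions. *)
Definition octonion_sign (i j k : 'I_7) : R :=
  let lines := [:: (1, 3); (2, 6); (4, 5)]%N in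
  let p := nat_of_ord (j - i) in let q := nat_of_ord (k - i) in
  if (p, q) \in lines then 1 else if (q, p) \in lines then -1 else 0.

Definition cross (u v : 'rV[R]_7) : 'rV[R]_7 :=
  \row_k \sum_i \sum_j octonion_sign i j k * u 0 i * v 0 j.

(* Matrices act on row vectors from the right, as in mx_representation.  The
   compact group G2 is the automorphism group of the octonions, that is, of
   their imaginary part R^7 with the cross product; orthogonality of g is a
   consequence. *)
Definition in_G2 (g : 'M[R]_7) : Prop :=
  g \in unitmx /\ forall u v, cross (u *m g) (v *m g) = cross u v *m g.

Definition derivation_defect (u v : 'rV[R]_7) (X : 'M[R]_7) : 'rV[R]_7 :=
  cross (u *m X) v + cross u (v *m X) - cross u v *m X.

(* The Lie algebra of G2 (the derivations of the cross product), as a row space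
   of mxvec-encoded 7 x 7 matrices; see g2_lieP. *)
Definition g2_lie : 'M[R]_(7 * 7) :=
  (\bigcap_(i < 7) \bigcap_(j < 7)
     kermx (lin_mx (derivation_defect (delta_mx 0 i) (delta_mx 0 j))))%MS.

Definition conjugation (g X : 'M[R]_7) : 'M[R]_7 := invmx g *m X *m g.

Definition Ad (g : 'M[R]_7) : 'M[R]_(7 * 7) := lin_mx (conjugation g).

Lemma cross_is_linear_l v : linear (cross ^~ v).
Proof.
move=> a x y; apply/rowP=> k; rewrite !mxE mulr_sumr -big_split /=.
apply: eq_bigr => i _; rewrite mulr_sumr -big_split /=.
by apply: eq_bigr => j _; rewrite !mxE mulrDr mulrDl mulrCA !mulrA.
Qed.

Lemma cross_is_linear_r u : linear (cross u).
Proof.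
move=> a x y; apply/rowP=> k; rewrite !mxE mulr_sumr -big_split /=.
apply: eq_bigr => i _; rewrite mulr_sumr -big_split /=.
by apply: eq_bigr => j _; rewrite !mxE mulrDr mulrCA.
Qed.

HB.instance Definition _ u := GRing.isSemilinear.Build _ _ _ _ (cross u)
  (GRing.semilinear_linear (cross_is_linear_r u)).

Definition crossl (v u : 'rV[R]_7) := cross u v.

HB.instance Definition _ v := GRing.isSemilinear.Build _ _ _ _ (crossl v)
  (GRing.semilinear_linear (cross_is_linear_l v)).

Lemma derivation_defect_is_linear u v : linear (derivation_defect u v).
Proof.
move=> a X Y; rewrite /derivation_defect !mulmxDr -!scalemxAr.
rewrite -!/(crossl v _) !linearP /= scalerBr scalerDr -!/(crossl v _) scalerN.
by rewrite [X in X + _]addrACA [LHS]addrACA.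
Qed.

HB.instance Definition _ u v :=
  GRing.isSemilinear.Build _ _ _ _ (derivation_defect u v)
    (GRing.semilinear_linear (derivation_defect_is_linear u v)).

Lemma conjugation_is_linear g : linear (conjugation g).
Proof.
by move=> a X Y; rewrite /conjugation mulmxDr mulmxDl -scalemxAr -scalemxAl.
Qed.

HB.instance Definition _ g :=
  GRing.isSemilinear.Build _ _ _ _ (conjugation g)
    (GRing.semilinear_linear (conjugation_is_linear g)).

Lemma g2_lieP X : reflect
  (forall u v, cross (u *m X) v + cross u (v *m X) = cross u v *m X)
  (mxvec X <= g2_lie)%MS.
Proof.
apply: (iffP sub_bigcapmxP) => [H u v|H i _]; last first.
  apply/sub_bigcapmxP => j _; apply/sub_kermxP; rewrite mul_vec_lin /=.
  by rewrite /derivation_defect H subrr linear0.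
have D0 i j : derivation_defect (delta_mx 0 i) (delta_mx 0 j) X = 0.
  have /sub_bigcapmxP/(_ j isT)/sub_kermxP := H i isT.
  by rewrite mul_vec_lin => /(canRL mxvecK); rewrite linear0.
have D0r i w : derivation_defect (delta_mx 0 i) w X = 0.
  rewrite [w]row_sum_delta /derivation_defect mulmx_suml !linear_sum /=.
  rewrite mulmx_suml -big_split -sumrB big1 // => j _ /=.
  rewrite -scalemxAl !linearZ /= -scalemxAl -scalerDr -scalerBr.
  by have := D0 i j; rewrite /derivation_defect => ->; rewrite scaler0.
apply/eqP; rewrite -subr_eq0 -/(derivation_defect u v X); apply/eqP.
rewrite [u]row_sum_delta /derivation_defect mulmx_suml -!/(crossl v _).
rewrite -/(crossl (v *m X) _) !linear_sum /= mulmx_suml -big_split -sumrB.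
rewrite big1 // => i _ /=.
rewrite -scalemxAl !linearZ /= -scalemxAl -scalerDr -scalerBr.
by have := D0r i v; rewrite /derivation_defect /crossl => ->; rewrite scaler0.
Qed.

Lemma conjugation_g2_lie g X :
  in_G2 g -> (mxvec X <= g2_lie)%MS -> (mxvec (conjugation g X) <= g2_lie)%MS.
Proof.
move=> [Ug Hg] /g2_lieP HX; apply/g2_lieP => u v.
rewrite /conjugation -{1}[v](mulmxKV Ug) -{2}[u](mulmxKV Ug).
rewrite -!mulmxA !(mulmxA (invmx g)) !(mulmxA u) !(mulmxA v).
rewrite !Hg -mulmxDl -!(mulmxA _ _ g) HX.
have -> : cross u v = cross (u *m invmx g) (v *m invmx g) *m g.
  by rewrite -Hg !mulmxKV.
by rewrite !mulmxA mulmxK.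
Qed.

Section Embedding.
Variables (gT : finGroupType) (G : {group gT}).

Record G2_embedding := {
  emb :> mx_representation R G 7;
  emb_G2 : forall x, x \in G -> in_G2 (emb x);
  emb_inj : {in G &, injective emb}
}.

Variable iota : G2_embedding.

Lemma Ad_mx_repr : mx_repr G (fun x => Ad (iota x)).
Proof.
split=> [|x y Gx Gy].
  apply/row_matrixP=> i; rewrite !rowE mulmx1 -[delta_mx 0 i]vec_mxK.
  by rewrite mul_vec_lin /= /conjugation repr_mx1 invmx1 mul1mx mulmx1.
apply/row_matrixP=> i; rewrite !rowE -[delta_mx 0 i]vec_mxK mulmxA.
rewrite !mul_vec_lin /= /conjugation repr_mxM // !mulmxA.
have [Ux _] := emb_G2 iota Gx; have [Uy _] := emb_G2 iota Gy.
congr (mxvec (_ *m _ *m _ *m _)).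
rewrite -[LHS]mulmx1 -[X in _ *m X](mulmxV Ux) -[X in _ *m (X *m _)]mulmx1.
rewrite -(mulmxV Uy) !mulmxA -[invmx (_ *m _) *m _ *m _]mulmxA mulVmx ?mul1mx //.
by rewrite unitmx_mul Ux.
Qed.

Definition Ad_repr := MxRepresentation Ad_mx_repr.

Lemma g2_lie_module : mxmodule Ad_repr g2_lie.
Proof.
apply/mxmoduleP => x Gx; apply/row_subP => i.
rewrite row_mul -[row i g2_lie]vec_mxK /= mul_vec_lin /=.
by apply: conjugation_g2_lie; [exact: emb_G2|rewrite vec_mxK row_sub].
Qed.

(* The composites with iota of the two fundamental representations of G2,
   complexified: the defining one and the adjoint one, of degrees 7 and
   \rank g2_lie = 14. *)
Definition varrho1 : mx_representation R[i] G 7 :=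
  map_repr (real_complex R) iota.
Definition varrho2 : mx_representation R[i] G (\rank g2_lie) :=
  map_repr (real_complex R) (submod_repr g2_lie_module).

End Embedding.
End G2.

(** * McKay graphs *)

Section McKay.
Variables (R : realType) (gT : finGroupType) (G : {group gT}).

Definition irrC : irrType R[i] G := DecSocleType (regular_repr R[i] G).

Definition irr_mult n (rG : mx_representation R[i] G n) (k : irrC) : nat :=
  (\sum_(W : DecSocleType rG | irr_comp irrC (socle_repr W) == k)
     socle_mult W)%N.

(* Column b lists the multiplicities of the irreducible constituents of
   rho (x) irr_b. *)
Definition mckay n (rho : mx_representation R[i] G n) : 'M[R[i]]_#|irrC| :=
  \matrix_(a, b)
    (irr_mult (prod_repr rho (irr_repr (enum_val b))) (enum_val a))%:R.

Definition e_triv : 'cV[R[i]]_#|irrC| :=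
  delta_mx (enum_rank (principal_comp irrC)) 0.

Definition inner n (x y : 'cV[R[i]]_n) : R[i] := \sum_k x k 0 * (y k 0)^*%C.

End McKay.

(** * The torus T^2 *)

Section Circle.
Variable R : realType.

Record circle := Circle { circle_val :> R[i]; _ : `|circle_val| == 1 }.

HB.instance Definition _ := [isSub for circle_val].
HB.instance Definition _ := [Choice of circle by <:].

Lemma cexp_subproof (t : R) :
  `|(cos (2 * pi * t) +i* sin (2 * pi * t))%C| == 1.
Proof. by rewrite normc_def /= cos2Dsin2 sqrtr1. Qed.

Definition cexp (t : R) : circle := Circle (cexp_subproof t).

HB.instance Definition _ := isPointed.Build circle (cexp 0).

Definition circle_coord (z : circle) : measurableTypeR R * measurableTypeR R :=
  (complex.Re z, complex.Im z).

(* The Borel sigma-algebra of the circle, inherited from the plane; that of the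
   torus is then the product one. *)
HB.instance Definition _ :=
  Measurable.copy circle (g_sigma_algebra_preimageType circle_coord).

Definition angle (z : circle) : R :=
  xget 0 [set t : R | 0 <= t < 1 /\ cexp t = z].

End Circle.

Notation torus R := (circle R * circle R)%type.

(** * The Weyl group action and the characters of G2 on the torus *)

Section Torus.
Variable R : realType.

Lemma monomial_subproof (w : torus R) (a b : int) :
  `|(w.1 : R[i]) ^ a * (w.2 : R[i]) ^ b| == 1.
Proof.
have norm1 (z : circle R) n : `|(z : R[i]) ^ n| = 1.
  case: z n => z /= /eqP Hz [] n.
    by rewrite -exprnP normrX Hz expr1n.
  by rewrite NegzE -exprnN normfV normrX Hz expr1n invr1.
by rewrite normrM !norm1 mulr1.
Qed.

Definition monomial (w : torus R) (a b : int) : circle R :=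
  Circle (monomial_subproof w a b).

Definition torus_act (T : 'M[int]_2) (w : torus R) : torus R :=
  (monomial w (T 0 0) (T 0 1), monomial w (T 1 0) (T 1 1)).

Definition mx2 (a b c d : int) : 'M[int]_2 :=
  \matrix_(i, j) if i == 0 then (if j == 0 then a else b)
                 else (if j == 0 then c else d).

Inductive D12 : 'M[int]_2 -> Prop :=
| D12_T2 : D12 (mx2 0 (-1) (-1) 0)
| D12_T6 : D12 (mx2 0 1 (-1) 1)
| D12_1 : D12 1%:M
| D12_M S T : D12 S -> D12 T -> D12 (S *m T)
| D12_V T : D12 T -> D12 (invmx T).

Definition D12_invariant (eps : set (torus R) -> \bar R) : Prop :=
  forall T A, D12 T -> measurable A -> eps (torus_act T @^-1` A) = eps A.

Definition chi1 (w : torus R) : R[i] :=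
  let x : R[i] := w.1 in let y : R[i] := w.2 in
  1 + x + x^-1 + y + y^-1 + x * y^-1 + x^-1 * y.

Definition chi2 (w : torus R) : R[i] :=
  let x : R[i] := w.1 in let y : R[i] := w.2 in
  chi1 w + 1 + x * y + x^-1 * y^-1 + x ^+ 2 * y^-1 + x ^- 2 * y
  + x * y ^- 2 + x^-1 * y ^+ 2.

(* chi1 and chi2 are real-valued on the torus, but are written as complex
   Laurent polynomials. *)
Definition Cintegral (mu : {measure set (torus R) -> \bar R}) (f : torus R -> R[i]) :
    R[i] :=
  (Rintegral mu setT (fun w => complex.Re (f w))
   +i* Rintegral mu setT (fun w => complex.Im (f w)))%C.

End Torus.

(** * The joint spectral measure of an embedding *)

Section JointSpectralMeasure.
Variables (R : realType) (gT : finGroupType) (G : {group gT}).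
Variable iota : G2_embedding R G.

(* varrho1 = Sigma_7, an irreducible representation of degree 7. *)
Definition varrho1_is_7 : Prop :=
  exists2 s7 : irrC R G, irr_degree s7 = 7%N
    & mx_rsim (varrho1 iota) (irr_repr s7).

(* varrho1 = Sigma_1 + Sigma_3 + Sigma_3^*, with Sigma_3 irreducible of
   degree 3 and Sigma_1 trivial. *)
Definition varrho1_is_1_3_3conj : Prop :=
  exists2 s3 : irrC R G, irr_degree s3 = 3%N
    & mx_rsim (varrho1 iota)
        (dadd_grepr (Representation (irr_repr (principal_comp (irrC R G))))
          (dadd_grepr (Representation (irr_repr s3))
            (Representation (map_repr (@conjc R) (irr_repr s3))))).

Definition mckay_moment (m n : nat) : R[i] :=
  inner (mckay (varrho1 iota) ^+ m *m mckay (varrho2 iota) ^+ n *m e_triv R G)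
    (e_triv R G).

Definition class_moment (m n : nat) : R[i] :=
  \sum_(C in classes G) #|C|%:R / #|G|%:R *
    ((\tr (varrho1 iota (repr C))) ^+ m * (\tr (varrho2 iota (repr C))) ^+ n).

Definition has_spectral_moments (eps : probability (torus R) R) : Prop :=
  D12_invariant eps /\
  forall m n : nat,
    Cintegral eps (fun w => chi1 w ^+ m * chi2 w ^+ n) = mckay_moment m n /\
    mckay_moment m n = class_moment m n.

Definition joint_spectral_measure (eps : probability (torus R) R) : Prop :=
  has_spectral_moments eps /\
  forall eps' : probability (torus R) R, has_spectral_moments eps' ->
    forall A, measurable A -> eps' A = eps A.

End JointSpectralMeasure.

(** * Discrete measures and densities on the torus *)

Section UniformMeasure.
Context d (T : measurableType d) (R : realType).
Local Open Scope ereal_scope.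

(* The list s is meant to be duplicate-free. *)
Definition uniform_seq (s : seq T) : set T -> \bar R :=
  mscale (((size s)%:R^-1 : R)%:nng)%R (msum (fun i => \d_(nth point s i)) (size s)).

Variable s : seq T.
HB.instance Definition _ := Measure.on (uniform_seq s).

Lemma uniform_seq_fin : fin_num_fun (uniform_seq s).
Proof.
move=> A mA; rewrite /uniform_seq /mscale /= fin_numM // /msum.
by apply/sum_fin_numP => i _ _; rewrite /dirac.
Qed.
HB.instance Definition _ :=
  @Measure_isFinite.Build d T R (uniform_seq s) uniform_seq_fin.
End UniformMeasure.

Section TorusMeasures.
Variable R : realType.
Local Open Scope ereal_scope.

Definition root_unity (q k : nat) : circle R := cexp (q%:R / k%:R)%R.

Definition unif_roots (k : nat) : set (circle R) -> \bar R :=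
  uniform_seq R [seq root_unity q k | q <- iota 0 k].
HB.instance Definition _ k := FiniteMeasure.on (unif_roots k).

Definition unif_diag (n : nat) : set (torus R) -> \bar R :=
  uniform_seq R
    [seq (root_unity q.1 (3 * n), root_unity q.2 (3 * n)) |
       q <- [seq (q1, q2) | q1 <- iota 0 (3 * n), q2 <- iota 0 (3 * n)]
       & (3 %| q.1 + q.2)%N].
HB.instance Definition _ n := FiniteMeasure.on (unif_diag n).

(* The density f is written in the coordinates theta1, theta2. *)
Definition weighted (f : R -> R -> R) (mu : set (torus R) -> \bar R)
    (A : set (torus R)) : \bar R :=
  \int[mu]_(w in A) (f (angle w.1) (angle w.2))%:E.

End TorusMeasures.
Arguments unif_roots : clear implicits.
Arguments unif_diag : clear implicits.

Section Densities.
Variable R : realType.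
Implicit Types s t : R.

Definition cos_turn s : R := cos (2 * pi * s).
Definition sin_turn s : R := sin (2 * pi * s).

Definition J s t : R :=
  8 * pi ^+ 2 *
  (cos_turn (2 * s + t) + cos_turn (s - 3 * t) + cos_turn (3 * s - 2 * t)
   - cos_turn (s + 2 * t) - cos_turn (3 * s - t) - cos_turn (2 * s - 3 * t)).

(* K weights d_4 x d_4 in the measure for PSL(2;7).  In the published formula the
   two values of the coefficient beta of d_2 x d_2 / 6 are interchanged: the
   total masses would be 7/6 (for varrho1 = Sigma_7, beta = 1) and 5/6 (for
   varrho1 = Sigma_1 + Sigma_3 + Sigma_3^*, beta = 0), not 1. *)
Definition K s t : R :=
  4 * (sin_turn (s + t) - sin_turn (2 * s - t) - sin_turn (2 * t - s)) ^+ 2.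

End Densities.

(* Main.v *)
From HB Require Import structures.
Require Import Defs.
From mathcomp Require Import all_boot all_order all_algebra all_fingroup.
From mathcomp Require Import all_solvable all_field all_character.
From mathcomp Require Import complex.
From mathcomp Require Import all_classical all_reals all_analysis.
From mathcomp Require Import measurable_realfun.
From mathcomp Require Import ring lra zify.

(** The McKay moments are averages over the group.  The row vector of all
    irreducible characters at [g] is a left eigenvector of the McKay matrix of
    [rho], with eigenvalue [\tr (rho g)], and averaging over [g] kills every
    nontrivial irreducible character ([irr_row_mckay], [mckay_momentE]).  So the
    moments only depend on the values of [\tr varrho1] and [\tr varrho2] on the
    conjugacy classes.  The second character is a function of the first: the
    exterior square of the 7-dimensional representation of G2 is the sum of that
    representation and of the adjoint one ([mxtrace_varrho2]).

    The values of [chi = \tr varrho1] are found by arithmetic.  Orthogonality of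
    the matrices of G2 makes [chi] invariant under inversion, and up to conjugacy
    and inversion PSL(2;7) has five elements ([PSL27_classes]).  The averages of
    [chi] and of its square are known from the decomposition of [varrho1] (in the
    second case, up to the question whether Sigma_3 is self-conjugate), and the
    eigenvalue multiplicities of elements of order 3 and 4 are natural numbers;
    in each of the two cases these conditions have a single solution
    ([mckay_moment_PSL27]).

    On the torus [chi1] and [chi2] are, up to constants, the first two elementary
    symmetric functions of the traces x + 1/x, y + 1/y and x/y + y/x.  The product
    of these traces is a polynomial in [chi1] and [chi2], so that the traces
    are the roots of a cubic whose coefficients depend on (chi1, chi2) only
    ([tr_cubic]).  For each of the five values of (chi1, chi2) at elements of
    PSL(2;7) this forces x and y to be roots of unity of order 1, 2, 3, 4 or 7, and
    the fibre turns out to be a single orbit of the Weyl group.  Existence follows: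
    spread the proportion of each class evenly over the corresponding orbit
    ([eps]).

    For uniqueness, let mu be an invariant probability measure with the same
    moments.  The product of the squared distances from (chi1, chi2) to the five
    values has mu-integral 0, so mu is carried by the five fibres; the same product
    with one factor left out then gives the mass of the remaining fibre
    ([mu_fibre]), and invariance gives the mass of each of its points
    ([eps_unique]).

    The closed formula is a comparison of atoms.  The density J^2 selects the orbit
    of order 7 among the points of the 7-torsion ([J_grid7]), K selects one of the
    two orbits of order 4 among those of the 4-torsion ([K_grid4]), and the other
    terms adjust the masses of the points of order 1, 2 and 3. *)

Set Implicit Arguments.
Unset Strict Implicit.
Unset Printing Implicit Defensive.

Import Order.TTheory GRing.Theory Num.Theory.
Import numFieldNormedType.Exports.
Local Open Scope ring_scope.

(** * McKay matrices and averages over the group *)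

Section Characters.
Variables (R : realType) (gT : finGroupType) (G : {group gT}).
Local Notation C := R[i].

Lemma card_neq0 : #|G|%:R != 0 :> C.
Proof. by rewrite pnatr_eq0 -lt0n cardG_gt0. Qed.

Lemma pchar'G : ([pchar C]^'.-group G)%g.
Proof. by rewrite /pgroup pcharf'_nat card_neq0. Qed.

(** Complete reducibility: a character is the sum of the irreducible ones, with the
    multiplicities that define the McKay matrix. *)
Lemma irr_multE n (rG : mx_representation C G n) x : x \in G ->
  \tr (rG x) = \sum_(k : irrC R G) (irr_mult rG k)%:R * \tr (irr_repr k x).
Proof.
move=> Gx; pose sG : socleType rG := DecSocleType rG.
have S1 : (Socle sG :=: 1%:M)%MS.
  by rewrite reducible_Socle1 //; exact: mx_Maschke_pchar pchar'G.
rewrite -(mxtrace_submod1 (Socle_module sG) S1) // mxtrace_Socle //.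
rewrite (partition_big (fun W : sG => irr_comp (irrC R G) (socle_repr W)) xpredT) //=.
apply: eq_bigr => k _; rewrite /irr_mult natr_sum mulr_suml.
apply: eq_bigr => W /eqP <-; rewrite mulr_natl.
congr (_ *+ _); apply: mxtrace_rsim => //.
apply: rsim_irr_comp_pchar; first exact: pchar'G.
exact: socle_irr.
Qed.

Definition intertwiner n m (s : mx_representation C G m)
    (r : mx_representation C G n) (M : 'M[C]_(m, n)) : 'M[C]_(m, n) :=
  \sum_(g in G) s g^-1%g *m M *m r g.

(** Averaging any matrix over the group gives an intertwiner, to which Schur's lemma
    applies. *)
Lemma intertwinerP n m (s : mx_representation C G m)
    (r : mx_representation C G n) M x :
  x \in G -> s x *m intertwiner s r M = intertwiner s r M *m r x.
Proof.
move=> Gx; rewrite /intertwiner mulmx_sumr mulmx_suml.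
rewrite [RHS](reindex_acts 'R _ (groupVr Gx)) ?astabsR //=.
apply: eq_bigr => g Gg; rewrite !mulmxA -repr_mxM ?groupV //.
rewrite -[in RHS](mulmxA _ (r _)) -repr_mxM ?groupM ?groupV //.
by rewrite mulgKV invMg invgK.
Qed.

(** The kernel and the image of an intertwiner are submodules. *)
Lemma schur_neq n m (s : mx_representation C G m)
    (r : mx_representation C G n) (T : 'M[C]_(m, n)) :
  mx_irreducible s -> mx_irreducible r -> ~ mx_rsim s r ->
  (forall x, x \in G -> s x *m T = T *m r x) -> T = 0.
Proof.
move=> /mx_irrP[m0 irrs] /mx_irrP[n0 irrr] nsim hT; apply/eqP/negPn/negP => T0.
apply: nsim.
have Tfull : row_full T.
  rewrite /row_full -(mxrank_gen T); apply: irrr; last by rewrite -mxrank_eq0 mxrank_gen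
    mxrank_eq0.
  rewrite (eqmx_module _ (genmxE _)); apply/mxmoduleP => x Gx.
  by rewrite -hT // submxMl.
have kT : kermx T = 0.
  apply/eqP/negPn/negP => k0; case/negP: T0.
  have /row_fullP[B BK]: row_full (kermx T).
    apply: irrs => //; apply/mxmoduleP => x Gx; apply/sub_kermxP.
    by rewrite -mulmxA hT // mulmxA mulmx_ker mul0mx.
  by rewrite -[T]mul1mx -BK -mulmxA mulmx_ker mulmx0.
have Tfree : row_free T by rewrite -kermx_eq0 kT.
exists T => //; by move/eqP: Tfull; move/eqP: Tfree => -> ->.
Qed.

Lemma mxtrace_intertwiner n m (s : mx_representation C G m)
    (r : mx_representation C G n) :
  \sum_(g in G) \tr (s g^-1%g) * \tr (r g) =
  \sum_i \sum_j intertwiner s r (delta_mx i j) i j.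
Proof.
transitivity (\sum_i \sum_j \sum_(g in G) s g^-1%g i i * r g j j).
  under [RHS]eq_bigr do rewrite exchange_big.
  rewrite [RHS]exchange_big; apply: eq_bigr => g _ /=.
  by rewrite /mxtrace mulr_suml; apply: eq_bigr => i _; rewrite mulr_sumr.
apply: eq_bigr => i _; apply: eq_bigr => j _; rewrite summxE.
apply: eq_bigr => g _; rewrite !mxE (bigD1 j) //= big1 ?addr0 => [|k kj].
  rewrite !mxE (bigD1 i) //= big1 ?addr0 => [|k ki]; first by rewrite !mxE !eqxx mulr1.
  by rewrite !mxE (negPf ki) andFb mulr0.
rewrite !mxE big1 ?mul0r // => l _.
by rewrite !mxE (negPf kj) andbF mulr0.
Qed.

Lemma character_orthogonal n m (s : mx_representation C G m)
    (r : mx_representation C G n) :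
  mx_irreducible s -> mx_irreducible r -> ~ mx_rsim s r ->
  \sum_(g in G) \tr (s g^-1%g) * \tr (r g) = 0.
Proof.
move=> irrs irrr nsim; rewrite mxtrace_intertwiner big1 // => i _.
rewrite big1 // => j _; suff -> : intertwiner s r (delta_mx i j) = 0 by rewrite mxE.
by apply: (schur_neq irrs irrr nsim) => x Gx; exact: intertwinerP.
Qed.

Lemma character_norm1 n (r : mx_representation C G n) :
  mx_irreducible r -> \sum_(g in G) \tr (r g^-1%g) * \tr (r g) = #|G|%:R.
Proof.
move=> irrr; rewrite mxtrace_intertwiner.
have n0 : n%:R != 0 :> C by rewrite pnatr_eq0 -lt0n; case/mx_irrP: irrr.
have absr := group_closure_closed_field irrr.
have E i j : intertwiner r r (delta_mx i j) =
    ((i == j)%:R * #|G|%:R / n%:R)%:M.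
  have /is_scalar_mxP[c Hc]: is_scalar_mx (intertwiner r r (delta_mx i j)).
    apply: (mx_abs_irr_cent_scalar absr); apply/centgmxP => x Gx.
    by rewrite intertwinerP.
  have trE : \tr (intertwiner r r (delta_mx i j)) = (i == j)%:R * #|G|%:R.
    rewrite raddf_sum /= (eq_bigr (fun=> (i == j)%:R)) => [|g Gg].
      by rewrite sumr_const mulr_natr.
    rewrite mxtrace_mulC mulmxA -repr_mxM ?groupV // mulgV repr_mx1 mul1mx.
    rewrite /mxtrace (bigD1 i) //= big1 ?addr0 => [|k ki]; first by rewrite mxE eqxx.
    by rewrite mxE (negPf ki).
  by rewrite Hc -trE Hc mxtrace_scalar -(mulr_natr c) mulfK.
under eq_bigr => i _ do under eq_bigr => j _ do rewrite E.
under eq_bigr => i _.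
  rewrite (bigD1 i) //= big1 ?addr0 => [|j ji]; last first.
    by rewrite eq_sym (negPf ji) !mul0r mxE mul0rn.
  rewrite eqxx mul1r mxE eqxx mulr1n; over.
by rewrite /= sumr_const card_ord -[LHS]mulr_natr divfK.
Qed.

Lemma mxtrace_irr_principal x : x \in G ->
  \tr (irr_repr (principal_comp (irrC R G)) x) = 1.
Proof. by move=> Gx; rewrite irr1_repr // mxtrace1 degree_irr1. Qed.

Lemma irr_rsim_eq (j k : irrC R G) : mx_rsim (irr_repr j) (irr_repr k) -> j = k.
Proof.
move=> h; rewrite -[j](irr_reprK_pchar pchar'G) -[k](irr_reprK_pchar pchar'G).
exact: (irr_comp_rsim_pchar _ pchar'G).
Qed.

Lemma sum_irr_character (k : irrC R G) :
  \sum_(g in G) \tr (irr_repr k g) =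
  (k == principal_comp (irrC R G))%:R * #|G|%:R.
Proof.
have [->|nk] := eqVneq.
  rewrite mul1r -sum1_card natr_sum; apply: eq_bigr => g Gg.
  exact: mxtrace_irr_principal.
rewrite mul0r.
rewrite -[RHS](@character_orthogonal _ _ (irr_repr (principal_comp (irrC R G)))
  (irr_repr k)); first last.
- by move/irr_rsim_eq => E; rewrite E eqxx in nk.
- exact: socle_irr.
- exact: socle_irr.
by apply: eq_bigr => g Gg; rewrite mxtrace_irr_principal ?groupV // mul1r.
Qed.

Definition irr_row (x : gT) : 'rV[C]_#|irrC R G| :=
  \row_a \tr (irr_repr (enum_val a) x).

(** Evaluate at [x] the decomposition of [rho] tensored with each irreducible
    representation. *)
Lemma irr_row_mckay n (rho : mx_representation C G n) x :
  x \in G -> irr_row x *m mckay rho = \tr (rho x) *: irr_row x.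
Proof.
move=> Gx; apply/rowP => b; rewrite !mxE.
rewrite -mxtrace_prod -[tprod _ _]/(prod_repr rho (irr_repr (enum_val b)) x).
rewrite irr_multE // [RHS](reindex (fun a : 'I_#|irrC R G| => enum_val a)) /=;
  last exact/onW_bij/enum_val_bij.
by apply: eq_bigr => a _; rewrite !mxE mulrC.
Qed.

(** The eigenvector equation turns the (trivial, trivial) entry of a product of McKay
    matrices into a character average; the components at nontrivial irreducible
    representations vanish after summation over the group. *)
Lemma mckay_momentE n1 n2 (r1 : mx_representation C G n1)
    (r2 : mx_representation C G n2) (m n : nat) :
  inner (mckay r1 ^+ m *m mckay r2 ^+ n *m e_triv R G) (e_triv R G) =
  #|G|%:R^-1 * \sum_(g in G) \tr (r1 g) ^+ m * \tr (r2 g) ^+ n.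
Proof.
have irrX x k : x \in G -> irr_row x *m mckay r1 ^+ k = \tr (r1 x) ^+ k *: irr_row x.
  move=> Gx; elim: k => [|k IHk]; first by rewrite mulmx1 scale1r.
  by rewrite exprSr -mulmxE mulmxA IHk -scalemxAl irr_row_mckay // scalerA exprSr.
have irrY x k : x \in G -> irr_row x *m mckay r2 ^+ k = \tr (r2 x) ^+ k *: irr_row x.
  move=> Gx; elim: k => [|k IHk]; first by rewrite mulmx1 scale1r.
  by rewrite exprSr -mulmxE mulmxA IHk -scalemxAl irr_row_mckay // scalerA exprSr.
set c := _ *m _ *m e_triv R G.
pose t := enum_rank (principal_comp (irrC R G)).
have eE k : e_triv R G k 0 = (k == t)%:R by rewrite mxE eqxx andbT.
have innerE : inner c (e_triv R G) = c t 0.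
  rewrite /inner (bigD1 t) //= big1 ?addr0 => [|k kt].
    by rewrite eE eqxx conjc1 mulr1.
  by rewrite eE (negPf kt) conjc0 mulr0.
have rowc x : x \in G -> irr_row x *m c = (\tr (r1 x) ^+ m * \tr (r2 x) ^+ n)%:M.
  move=> Gx; rewrite /c !mulmxA irrX // -scalemxAl irrY // -!scalemxAl.
  apply/matrixP => i j; rewrite !ord1 !mxE (bigD1 t) //= big1 ?addr0 => [|k kt].
    by rewrite eE eqxx !mxE enum_rankK mxtrace_irr_principal // !mulr1.
  by rewrite eE (negPf kt) mulr0.
clearbody c.
have rowE x : x \in G -> \tr (r1 x) ^+ m * \tr (r2 x) ^+ n =
    \sum_k \tr (irr_repr (enum_val k) x) * c k 0.
  move=> /rowc/matrixP/(_ 0 0); rewrite !mxE eqxx mulr1n => <-.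
  by apply: eq_bigr => k _; rewrite mxE.
rewrite innerE; apply: (mulfI card_neq0); rewrite mulVKf ?card_neq0 //.
rewrite (eq_bigr _ rowE).
have sumE k : \sum_(g in G) \tr (irr_repr (enum_val k) g) * c k 0 =
    (k == t)%:R * #|G|%:R * c k 0.
  by rewrite -mulr_suml sum_irr_character -(inj_eq enum_rank_inj) enum_valK.
rewrite exchange_big; under [RHS]eq_bigr do rewrite sumE.
rewrite [RHS](bigD1 t) // [X in _ = _ + X]big1 => [|k /negPf ->]; last by rewrite !mul0r.
by rewrite eqxx mul1r addr0.
Qed.
End Characters.

(** * Traces of matrices of finite order *)

Section Idempotent.
Variable F : numFieldType.

(** Write P as a product C B with C of full column rank and B of full row rank: then
    P P = P amounts to B C = 1. *)
Lemma mxtrace_idempotent n (P : 'M[F]_n) : P *m P = P -> \tr P = (\rank P)%:R.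
Proof.
move=> PP; rewrite -{1}(mulmx_base P) mxtrace_mulC.
suff -> : row_base P *m col_base P = 1%:M by rewrite mxtrace1.
apply: (row_full_inj (col_base_full P)).
apply: (row_free_inj (row_base_free P)).
by rewrite mulmx1 mulmxA mulmx_base -mulmxA mulmx_base.
Qed.

(** The average of the powers of [z *: A] is an idempotent; [d] is the multiplicity
    of the eigenvalue [z^-1] of [A]. *)
Lemma trace_average_nat n k (A : 'M[F]_n.+1) (z : F) :
  (0 < k)%N -> A ^+ k = 1 -> z ^+ k = 1 ->
  exists d : nat, \sum_(i < k) z ^+ i * \tr (A ^+ i) = k%:R * d%:R.
Proof.
move=> k0 Ak zk; pose B := z *: A.
have Bk : B ^+ k = 1 by rewrite exprZn zk Ak scale1r.
pose S := \sum_(i < k) B ^+ i.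
have BS : B * S = S.
  rewrite /S mulr_sumr; case: k k0 {Ak zk} Bk @S => // k _ Bk.
  rewrite [in LHS]big_ord_recr [in RHS]big_ord_recl /= -exprS Bk addrC expr0; congr (_ + _).
  by apply: eq_bigr => i _; rewrite exprS.
have BiS i : B ^+ i * S = S by elim: i => [|i IH]; rewrite ?mul1r // exprSr -mulrA BS.
have SS : S * S = k%:R *: S.
  rewrite {1}/S mulr_suml (eq_bigr (fun=> S)) => [|i _]; last exact: BiS.
  by rewrite sumr_const card_ord scaler_nat.
have k1 : k%:R != 0 :> F by rewrite pnatr_eq0 -lt0n.
have idP : (k%:R^-1 *: S) *m (k%:R^-1 *: S) = k%:R^-1 *: S.
  by rewrite -scalemxAl -scalemxAr mulmxE SS !scalerA mulfVK // mulVf // mulr1.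
exists (\rank (k%:R^-1 *: S)); rewrite -(mxtrace_idempotent idP) mxtraceZ mulVKf //.
rewrite raddf_sum; apply: eq_bigr => i _ /=.
by rewrite exprZn mxtraceZ.
Qed.
End Idempotent.

(** * The adjoint character of G2 *)

(** The structure constants as an evaluated integer table: the tensor identities below
    range over up to 7^5 index tuples and are checked by computation. *)
Definition octonion_table : seq (seq (seq int)) := Eval vm_compute in
  let lines := [:: (1, 3); (2, 6); (4, 5)]%N in
  let sign i j k := let p := ((j + (7 - i)) %% 7)%N in let q := ((k + (7 - i)) %% 7)%N in
    if (p, q) \in lines then 1 else if (q, p) \in lines then -1 else 0 in
  [seq [seq [seq sign i j k | k <- iota 0 7] | j <- iota 0 7] | i <- iota 0 7].

Definition osign (i j k : nat) : int := nth 0 (nth [::] (nth [::] octonion_table i) j) k.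

Definition delta (i j : nat) : int := (i == j)%:Z.

Definition sum7 (f : nat -> int) : int := foldr (fun i s => f i + s) 0 (iota 0 7).

Definition all7 (p : nat -> bool) : bool := all p (iota 0 7).

(** Six times the matrix of the projection of 'M_7 onto the Lie algebra of G2: the
    skew-symmetric part of the matrix, minus its component along the
    cross products u x -, which form the complement of that Lie algebra in so(7). *)
Definition proj_coef (i k a b : nat) : int :=
  3 * (delta i a * delta k b) - 3 * (delta k a * delta i b)
  - sum7 (fun m => osign m i k * osign m a b).

(** The linear relations between the entries of a derivation that result from
    contracting the derivation rule with the structure constants. *)
Definition contract_coef (a b c d : nat) : int :=
  2 * sum7 (fun i => osign i c a * osign i d b) - 6 * (delta c a * delta d b).

(** The combination of these relations that expresses X by its projection, found among
    the tensors built from [delta] and from the contracted square of [osign]. *)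
Definition inverse_coef (a b c d : nat) : int :=
  6 * (delta a b * delta c d)
  - 9 * (delta a c * delta b d + delta a d * delta b c)
  - 2 * sum7 (fun m => osign m a b * osign m c d).

Lemma all7P (p : nat -> bool) (i : 'I_7) : all7 p -> p i.
Proof. by move/allP; apply; rewrite mem_iota /= ltn_ord. Qed.

Lemma sum7E (A : pzRingType) (f : nat -> int) :
  \sum_(i < 7) (f i)%:~R = (sum7 f)%:~R :> A.
Proof.
rewrite -(big_mkord xpredT (fun i => (f i)%:~R)) /index_iota subn0 /sum7.
by rewrite unlock /=; rewrite !rmorphD.
Qed.

Lemma contraction2 (i j : 'I_7) :
  sum7 (fun a => sum7 (fun b => osign a b i * osign a b j)) = 6 * delta i j.
Proof.
apply/eqP; move: j; have := all7P i (p := fun i => all7 (fun j =>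
  sum7 (fun a => sum7 (fun b => osign a b i * osign a b j)) == 6 * delta i j)) => H.
by move=> j; apply: (all7P j (H _)); vm_cast_no_check (erefl true).
Qed.

Lemma osign_cycle (i j k : 'I_7) : osign i j k = osign j k i.
Proof.
apply/eqP; move: i j k.
have H : all7 (fun i => all7 (fun j => all7 (fun k => osign i j k == osign j k i))).
  by vm_cast_no_check (erefl true).
by move=> i j k; apply: (all7P k (all7P j (all7P i H))).
Qed.

Lemma osign_anti (i j k : 'I_7) : osign j i k = - osign i j k.
Proof.
apply/eqP; move: i j k.
have H : all7 (fun i => all7 (fun j => all7 (fun k => osign j i k == - osign i j k))).
  by vm_cast_no_check (erefl true).
by move=> i j k; apply: (all7P k (all7P j (all7P i H))).
Qed.

(** The projection takes its values in the derivations. *)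
Lemma proj_derivation (i j l a b : 'I_7) :
  sum7 (fun k => proj_coef i k a b * osign k j l
     + proj_coef j k a b * osign i k l - osign i j k * proj_coef k l a b) = 0.
Proof.
apply/eqP; move: i j l a b.
have H : all7 (fun i => all7 (fun j => all7 (fun l => all7 (fun a => all7 (fun b =>
  sum7 (fun k => proj_coef i k a b * osign k j l
     + proj_coef j k a b * osign i k l - osign i j k * proj_coef k l a b) == 0))))).
  by vm_cast_no_check (erefl true).
by move=> i j l a b; apply: (all7P b (all7P a (all7P l (all7P j (all7P i H))))).
Qed.

(** A derivation is fixed by the projection: for such X the left-hand side, paired
    with X, vanishes by [g2_lie_contract]. *)
Lemma inverse_contract (a b c d : 'I_7) :
  sum7 (fun i => sum7 (fun j => inverse_coef a b i j * contract_coef i j c d)) =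
  144 * (delta a c * delta b d) - 24 * proj_coef a b c d.
Proof.
apply/eqP; move: a b c d.
have H : all7 (fun a => all7 (fun b => all7 (fun c => all7 (fun d =>
  sum7 (fun i => sum7 (fun j => inverse_coef a b i j * contract_coef i j c d)) ==
  144 * (delta a c * delta b d) - 24 * proj_coef a b c d)))).
  by vm_cast_no_check (erefl true).
by move=> a b c d; apply: (all7P d (all7P c (all7P b (all7P a H)))).
Qed.

Section G2Traces.
Variable R : realType.

Lemma octonion_signE (i j k : 'I_7) : octonion_sign R i j k = (osign i j k)%:~R.
Proof.
by move: i j k; case=> [[|[|[|[|[|[|[|//]]]]]]] ?]; case=> [[|[|[|[|[|[|[|//]]]]]]] ?];
  case=> [[|[|[|[|[|[|[|//]]]]]]] ?].
Qed.

Local Notation sgn := (octonion_sign R).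
Local Notation "'M7'" := ('M[R]_7).

Lemma cross_delta_row i (v : 'rV[R]_7) k :
  cross (delta_mx 0 i) v 0 k = \sum_j sgn i j k * v 0 j.
Proof.
rewrite mxE (bigD1 i) //= [X in _ + X]big1 ?addr0 => [|a ai].
  by apply: eq_bigr => j _; rewrite mxE !eqxx mulr1.
by rewrite big1 // => j _; rewrite mxE (negPf ai) andbF mulr0 mul0r.
Qed.

Lemma cross_row_delta (u : 'rV[R]_7) j k :
  cross u (delta_mx 0 j) 0 k = \sum_i sgn i j k * u 0 i.
Proof.
rewrite mxE; apply: eq_bigr => i _; rewrite (bigD1 j) //= big1 ?addr0 => [|a aj].
  by rewrite mxE !eqxx mulr1.
by rewrite mxE (negPf aj) andbF mulr0.
Qed.

Lemma cross_delta i j k : cross (delta_mx 0 i) (delta_mx 0 j) 0 k = sgn i j k.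
Proof.
rewrite cross_delta_row (bigD1 j) //= big1 ?addr0 => [|a aj].
  by rewrite mxE !eqxx mulr1.
by rewrite mxE (negPf aj) andbF mulr0.
Qed.

Lemma sgn_contraction (i j : 'I_7) :
  \sum_a \sum_b sgn a b i * sgn a b j = 6 * (i == j)%:R.
Proof.
under eq_bigr => a _.
  under eq_bigr => b _ do rewrite !octonion_signE -intrM.
  rewrite (sum7E _ (fun b => osign a b i * osign a b j)); over.
rewrite (sum7E _ (fun a => sum7 (fun b => osign a b i * osign a b j))).
by rewrite contraction2 rmorphM /=.
Qed.

(** ** The Lie algebra *)

Lemma derivation_defectE i j l (X : M7) :
  derivation_defect (delta_mx 0 i) (delta_mx 0 j) X 0 l =
  \sum_k (X i k * sgn k j l + X j k * sgn i k l - sgn i j k * X k l).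
Proof.
rewrite /derivation_defect -!rowE 2!mxE cross_row_delta cross_delta_row.
rewrite -big_split /= [in X in _ + X]mxE [X in - X]mxE -sumrB; apply: eq_bigr => k _.
by rewrite cross_delta !mxE [X in _ = X + _ - _]mulrC [X in _ = _ + X - _]mulrC.
Qed.

Lemma mem_g2_lie (X : M7) :
  (forall i j l : 'I_7, \sum_k (X i k * sgn k j l + X j k * sgn i k l - sgn i j k * X k l) = 0)
  <-> (mxvec X <= g2_lie R)%MS.
Proof.
split=> [H|/sub_bigcapmxP H i j l].
  apply/sub_bigcapmxP => i _; apply/sub_bigcapmxP => j _; apply/sub_kermxP.
  rewrite mul_vec_lin /= (_ : derivation_defect _ _ _ = 0) ?linear0 //.
  by apply/rowP => l; rewrite derivation_defectE H mxE.
have /sub_bigcapmxP/(_ j isT)/sub_kermxP := H i isT.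
rewrite mul_vec_lin => /(canRL mxvecK); rewrite linear0 => /rowP/(_ l).
by rewrite derivation_defectE mxE.
Qed.

Definition g2_proj (X : M7) : M7 :=
  \matrix_(i, k) (6^-1 * \sum_(a < 7) \sum_(b < 7) (proj_coef i k a b)%:~R * X a b).

Lemma g2_proj_is_linear : linear g2_proj.
Proof.
move=> c X Y; apply/matrixP => i k; rewrite !mxE mulrCA -mulrDr; congr (_ * _).
rewrite mulr_sumr -big_split; apply: eq_bigr => a _ /=.
rewrite mulr_sumr -big_split; apply: eq_bigr => b _ /=.
by rewrite !mxE mulrDr mulrCA.
Qed.
HB.instance Definition _ := GRing.isSemilinear.Build _ _ _ _ g2_proj
  (GRing.semilinear_linear g2_proj_is_linear).

Lemma g2_proj_mem X : (mxvec (g2_proj X) <= g2_lie R)%MS.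
Proof.
apply/mem_g2_lie => i j l.
transitivity (6^-1 * \sum_(a < 7) \sum_(b < 7) X a b * (sum7 (fun k =>
     proj_coef i k a b * osign k j l + proj_coef j k a b * osign i k l
     - osign i j k * proj_coef k l a b))%:~R).
  rewrite mulr_sumr; under [RHS]eq_bigr => a _.
    rewrite mulr_sumr; under eq_bigr => b _ do
      rewrite -(sum7E _ (fun k => proj_coef i k a b * osign k j l
        + proj_coef j k a b * osign i k l - osign i j k * proj_coef k l a b)) !mulr_sumr.
    rewrite exchange_big; over.
  rewrite [RHS]exchange_big; apply: eq_bigr => k _ /=.
  rewrite !mxE -!mulrA !mulr_suml !mulr_sumr -big_split -sumrB; apply: eq_bigr => a _ /=.
  rewrite !mulr_suml !mulr_sumr -big_split -sumrB; apply: eq_bigr => b _ /=.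
  rewrite !octonion_signE; move: (proj_coef i k a b) (proj_coef j k a b) (proj_coef k l a b).
by move=> p q r; rewrite intrB intrD !intrM; ring.
rewrite big1 ?mulr0 // => a _; rewrite big1 // => b _.
by rewrite proj_derivation mulr0.
Qed.

Lemma sgn_anti i j k : sgn j i k = - sgn i j k.
Proof. by rewrite !octonion_signE osign_anti mulrNz. Qed.

Lemma sgn_cycle i j k : sgn i j k = sgn j k i.
Proof. by rewrite !octonion_signE osign_cycle. Qed.

Lemma contract_coefE (a b c d : 'I_7) : (contract_coef a b c d)%:~R =
  2 * (\sum_(i < 7) sgn i c a * sgn i d b) - 6 * ((c == a)%:R * (d == b)%:R) :> R.
Proof.
rewrite intrB !intrM; congr (_ * _ - _ * (_ * _)).
by rewrite -sum7E; apply: eq_bigr => i _; rewrite intrM !octonion_signE.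
Qed.

Lemma g2_lie_contract (X : M7) (a b : 'I_7) : (mxvec X <= g2_lie R)%MS ->
  \sum_(c < 7) \sum_(d < 7) (contract_coef a b c d)%:~R * X c d = 0.
Proof.
move=> /mem_g2_lie HX.
have : \sum_i \sum_j sgn i j a *
    \sum_k (X i k * sgn k j b + X j k * sgn i k b - sgn i j k * X k b) = 0.
  by rewrite big1 // => i _; rewrite big1 // => j _; rewrite HX mulr0.
pose T := \sum_c \sum_d (\sum_i sgn i c a * sgn i d b) * X c d.
have T1 : \sum_i \sum_j \sum_k sgn i j a * (X i k * sgn k j b) = T.
  apply: eq_bigr => c _; rewrite exchange_big; apply: eq_bigr => d _ /=.
  rewrite mulr_suml; apply: eq_bigr => j _.
  by rewrite (sgn_anti j c) (sgn_anti j d); ring.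
have T2 : \sum_i \sum_j \sum_k sgn i j a * (X j k * sgn i k b) = T.
  rewrite exchange_big; apply: eq_bigr => c _; rewrite exchange_big.
  apply: eq_bigr => d _ /=; rewrite mulr_suml; apply: eq_bigr => j _.
  by rewrite mulrA mulrAC.
have T3 : \sum_i \sum_j \sum_k sgn i j a * (sgn i j k * X k b) = 6 * X a b.
  under eq_bigr do rewrite exchange_big; rewrite exchange_big /=.
  under eq_bigr => k _.
    under eq_bigr => i _ do under eq_bigr => j _ do rewrite mulrA.
    under eq_bigr => i _ do rewrite -mulr_suml.
    rewrite -mulr_suml sgn_contraction; over.
  rewrite (bigD1 a) //= big1 ?addr0 => [|k ka]; first by rewrite eqxx mulr1.
  by rewrite eq_sym (negPf ka) mulr0 mul0r.
have T4 : \sum_c \sum_d ((c == a)%:R * (d == b)%:R) * X c d = X a b.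
  rewrite (bigD1 a) //= [X in _ + X]big1 ?addr0 => [|c ca]; last first.
    by rewrite big1 // => d _; rewrite (negPf ca) !mul0r.
  rewrite (bigD1 b) //= big1 ?addr0 => [|d db]; first by rewrite !eqxx !mul1r.
  by rewrite (negPf db) mulr0 mul0r.
have -> : \sum_i \sum_j sgn i j a *
    \sum_k (X i k * sgn k j b + X j k * sgn i k b - sgn i j k * X k b) =
    T + T - 6 * X a b.
  rewrite -{1}T1 -T2 -T3 -!big_split -sumrB; apply: eq_bigr => i _ /=.
  rewrite -!big_split -sumrB; apply: eq_bigr => j _ /=.
  rewrite -!big_split -sumrB mulr_sumr; apply: eq_bigr => k _ /=.
  by rewrite mulrBr mulrDr.
move=> E; rewrite -[RHS]E -T4 /T mulr_sumr -!big_split -sumrB; apply: eq_bigr => c _ /=.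
rewrite mulr_sumr -!big_split -sumrB; apply: eq_bigr => d _ /=.
by rewrite contract_coefE; ring.
Qed.

Lemma g2_proj_id (X : M7) : (mxvec X <= g2_lie R)%MS -> g2_proj X = X.
Proof.
move=> HX; apply/matrixP => a b; rewrite mxE.
have : \sum_(i < 7) \sum_(j < 7) (inverse_coef a b i j)%:~R *
     \sum_(c < 7) \sum_(d < 7) (contract_coef i j c d)%:~R * X c d = 0.
  by rewrite big1 // => i _; rewrite big1 // => j _; rewrite g2_lie_contract ?mulr0.
have -> : \sum_(i < 7) \sum_(j < 7) (inverse_coef a b i j)%:~R *
     (\sum_(c < 7) \sum_(d < 7) (contract_coef i j c d)%:~R * X c d) =
   \sum_(c < 7) \sum_(d < 7) (144 * ((a == c)%:R * (b == d)%:R)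
     - 24 * (proj_coef a b c d)%:~R) * X c d.
  under eq_bigr => i _ do under eq_bigr => j _ do rewrite mulr_sumr.
  under eq_bigr => i _ do rewrite exchange_big.
  rewrite exchange_big; apply: eq_bigr => c _ /=.
  under eq_bigr => i _ do under eq_bigr => j _ do rewrite mulr_sumr.
  under eq_bigr => i _ do rewrite exchange_big.
  rewrite exchange_big; apply: eq_bigr => d _ /=.
  under eq_bigr => i _ do under eq_bigr => j _ do rewrite mulrA -intrM.
  under eq_bigr => i _ do rewrite -mulr_suml
    (sum7E _ (fun j => inverse_coef a b i j * contract_coef i j c d)).
  rewrite -mulr_suml (sum7E _ (fun i => sum7 (fun j =>
    inverse_coef a b i j * contract_coef i j c d))) inverse_contract.
  by rewrite intrB !intrM.
under eq_bigr => c _ do under eq_bigr => d _ do rewrite mulrBl -!mulrA.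
under eq_bigr => c _ do rewrite sumrB -!mulr_sumr.
rewrite sumrB -!mulr_sumr.
rewrite (bigD1 a) //= [X in _ * (_ + X)]big1 ?addr0 => [|c ca]; last first.
  by rewrite [a == c]eq_sym (negPf ca) mul0r.
rewrite (bigD1 b) //= [X in _ * (_ + X)]big1 ?addr0 => [|d db]; last first.
  by rewrite eq_sym (negPf db) mul0r.
by rewrite !eqxx !mul1r => H; lra.
Qed.

(** ** Orthogonality *)

Definition crossmx (u : 'rV[R]_7) : M7 := \matrix_(j, k) \sum_i sgn i j k * u 0 i.

Lemma cross_mulmx u v : cross u v = v *m crossmx u.
Proof.
apply/rowP => k; rewrite !mxE exchange_big; apply: eq_bigr => j _ /=.
by rewrite mxE mulr_sumr; apply: eq_bigr => i _; rewrite mulrC.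
Qed.

Lemma crossmxM (g : M7) u : in_G2 g -> g *m crossmx (u *m g) = crossmx u *m g.
Proof.
move=> [_ Hg]; apply/row_matrixP => i; rewrite !rowE.
by rewrite !mulmxA -!cross_mulmx Hg.
Qed.

(** The trace form of the cross product recovers the scalar product, up to the factor
    -6; this is why automorphisms of the cross product are orthogonal. *)
Lemma mxtrace_crossmx u v : \tr (crossmx u *m crossmx v) = - 6 * (u *m v^T) 0 0.
Proof.
transitivity (- \sum_i \sum_l u 0 i * v 0 l * \sum_j \sum_k sgn j k i * sgn j k l).
  rewrite /mxtrace -sumrN.
  under eq_bigr => j _.
    rewrite mxE; under eq_bigr => k _.
      rewrite !mxE mulr_suml; under eq_bigr do rewrite mulr_sumr; over.
    rewrite exchange_big; under eq_bigr do rewrite exchange_big; over.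
  rewrite exchange_big; apply: eq_bigr => i _ /=.
  rewrite -sumrN exchange_big; apply: eq_bigr => l _ /=.
  rewrite mulr_sumr -sumrN; apply: eq_bigr => j _ /=.
  rewrite mulr_sumr -sumrN; apply: eq_bigr => k _ /=.
  by rewrite (sgn_cycle i j) (sgn_cycle l k) (sgn_anti j k); ring.
rewrite mxE mulNr mulr_sumr; congr (- _); apply: eq_bigr => i _.
under eq_bigr do rewrite sgn_contraction.
rewrite (bigD1 i) //= big1 ?addr0 => [|l li]; last first.
  by rewrite eq_sym (negPf li) !mulr0.
by rewrite mxE eqxx mulr1 mulrC.
Qed.

Lemma in_G2_orthogonal (g : M7) : in_G2 g -> g *m g^T = 1%:M.
Proof.
move=> Hg; have [Ug _] := Hg; apply/matrixP => i j.
have cE u : crossmx (u *m g) = invmx g *m crossmx u *m g.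
  by rewrite -[LHS](mulKmx Ug) crossmxM // mulmxA.
have : \tr (crossmx (delta_mx 0 i *m g) *m crossmx (delta_mx 0 j *m g)) =
    \tr (crossmx (delta_mx 0 i) *m crossmx (delta_mx 0 j)).
  rewrite !cE mxtrace_mulC !mulmxA mulmxK // -!mulmxA mxtrace_mulC -!mulmxA.
  by rewrite mulmxV // mulmx1 mxtrace_mulC.
rewrite !mxtrace_crossmx => /mulfI E; have {E} := E _.
rewrite trmx_mul !mulmxA => E.
have {E} := E ltac:(by rewrite oppr_eq0 pnatr_eq0).
have H (M : M7) : ((delta_mx 0 i : 'rV[R]_7) *m M *m (delta_mx 0 j : 'rV[R]_7)^T) 0 0 = M i j.
  by rewrite -rowE trmx_delta -colE !mxE.
by rewrite -[_ *m g *m _]mulmxA H -[X in _ = (X *m _) 0 0]mulmx1 H.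
Qed.

Lemma in_G2_invmx (g : M7) : in_G2 g -> invmx g = g^T.
Proof.
move=> Hg; have [Ug _] := Hg.
by rewrite -[RHS](mulKmx Ug) in_G2_orthogonal // mulmx1.
Qed.

(** ** The character of the adjoint representation *)

Lemma mxtrace_mxvec n (M : 'M[R]_(n * n)) :
  \tr M = \sum_a \sum_b vec_mx (mxvec (delta_mx a b) *m M) a b.
Proof.
rewrite pair_bigA /= /mxtrace.
rewrite (reindex (uncurry (@mxvec_index n n))) /=; last exact: curry_mxvec_bij.
apply: eq_bigr => [[a b]] _ /=.
by rewrite mxE mxvec_delta -rowE !mxE.
Qed.

(** Invariance of the structure constants under G2, in coordinates. *)
Lemma cross_G2 (g : M7) c d k : in_G2 g ->
  \sum_a \sum_b sgn a b k * g c a * g d b = \sum_m sgn c d m * g m k.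
Proof.
move=> [_ /(_ (delta_mx 0 c) (delta_mx 0 d)) /rowP/(_ k)]; rewrite mxE [RHS]mxE -!rowE.
under eq_bigr do under eq_bigr do rewrite !mxE.
by move=> ->; apply: eq_bigr => m _; rewrite cross_delta.
Qed.

(** Of the three terms of [proj_coef], the first two give the trace of the exterior
    square and the third, by [cross_G2], that of the complement R^7. *)
Lemma mxtrace_g2_proj_Ad (g : M7) : in_G2 g ->
  \tr (lin_mx g2_proj *m Ad g) = (\tr g ^+ 2 - \tr (g *m g)) / 2 - \tr g.
Proof.
move=> Hg; rewrite mxtrace_mxvec.
under eq_bigr => a _ do under eq_bigr => b _ do rewrite mulmxA !mul_vec_lin /= mxvecK.
transitivity (\sum_(a < 7) \sum_(b < 7) \sum_(c < 7) \sum_(d < 7)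
  6^-1 * (proj_coef c d a b)%:~R * g c a * g d b).
  apply: eq_bigr => a _; apply: eq_bigr => b _.
  rewrite /conjugation in_G2_invmx // mxE exchange_big; apply: eq_bigr => d _ /=.
  rewrite mxE mulr_suml; apply: eq_bigr => c _; rewrite !mxE.
  rewrite (bigD1 a) //= [X in _ + X]big1 ?addr0 => [|x xa]; last first.
    by rewrite big1 // => y _; rewrite mxE (negPf xa) mulr0.
  rewrite (bigD1 b) //= [X in _ + X]big1 ?addr0 => [|y yb]; last first.
    by rewrite mxE (negPf yb) andbF mulr0.
  by rewrite mxE !eqxx mulr1; ring.
have pE (c d a b : 'I_7) : (proj_coef c d a b)%:~R = 3 * ((c == a)%:R * (d == b)%:R)
   - 3 * ((d == a)%:R * (c == b)%:R) - \sum_(m < 7) sgn m c d * sgn m a b :> R.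
  rewrite intrB intrB !intrM; congr (_ - _).
  by rewrite -sum7E; apply: eq_bigr => i _; rewrite intrM !octonion_signE.
have S1 : \sum_a \sum_b \sum_c \sum_d (c == a)%:R * (d == b)%:R * g c a * g d b = \tr g ^+ 2.
  rewrite expr2 /mxtrace mulr_suml; apply: eq_bigr => a _.
  rewrite mulr_sumr; apply: eq_bigr => b _.
  rewrite (bigD1 a) //= [X in _ + X]big1 ?addr0 => [|c ca]; last first.
    by rewrite big1 // => d _; rewrite (negPf ca) !mul0r.
  rewrite (bigD1 b) //= big1 ?addr0 => [|d db]; first by rewrite !eqxx !mul1r.
  by rewrite (negPf db) mulr0 !mul0r.
have S2 : \sum_a \sum_b \sum_c \sum_d (d == a)%:R * (c == b)%:R * g c a * g d b = \tr (g *m g).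
  rewrite /mxtrace; apply: eq_bigr => a _; rewrite mxE; apply: eq_bigr => b _.
  rewrite (bigD1 b) //= [X in _ + X]big1 ?addr0 => [|c cb]; last first.
    by rewrite big1 // => d _; rewrite (negPf cb) mulr0 !mul0r.
  rewrite (bigD1 a) //= big1 ?addr0 => [|d da]; first by rewrite !eqxx !mul1r mulrC.
  by rewrite (negPf da) !mul0r.
have S3 : \sum_a \sum_b \sum_c \sum_d \sum_m sgn m c d * sgn m a b * g c a * g d b = 6 * \tr g.
  transitivity (\sum_c \sum_d \sum_m sgn m c d * \sum_a \sum_b sgn a b m * g c a * g d b).
    under eq_bigr do rewrite exchange_big; rewrite exchange_big; apply: eq_bigr => c _ /=.
    under eq_bigr do rewrite exchange_big; rewrite exchange_big; apply: eq_bigr => d _ /=.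
    under eq_bigr do rewrite exchange_big; rewrite exchange_big; apply: eq_bigr => m _ /=.
    rewrite mulr_sumr; apply: eq_bigr => a _; rewrite mulr_sumr; apply: eq_bigr => b _.
    by rewrite (sgn_cycle m a); ring.
  under eq_bigr => c _ do under eq_bigr => d _ do under eq_bigr => m _ do
    rewrite cross_G2 // mulr_sumr.
  transitivity (\sum_m \sum_k g k m * \sum_c \sum_d sgn c d m * sgn c d k).
    under eq_bigr do rewrite exchange_big; rewrite exchange_big; apply: eq_bigr => m _ /=.
    under eq_bigr do rewrite exchange_big; rewrite exchange_big; apply: eq_bigr => k _ /=.
    rewrite mulr_sumr; apply: eq_bigr => c _; rewrite mulr_sumr; apply: eq_bigr => d _.
    by rewrite (sgn_cycle m c); ring.
  rewrite /mxtrace mulr_sumr; apply: eq_bigr => m _.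
  under eq_bigr do rewrite sgn_contraction.
  rewrite (bigD1 m) //= big1 ?addr0 => [|k km]; first by rewrite eqxx mulr1 mulrC.
  by rewrite eq_sym (negPf km) !mulr0.
transitivity (2^-1 * \tr g ^+ 2 - 2^-1 * \tr (g *m g) - 6^-1 * (6 * \tr g)); last first.
  by field.
rewrite -S1 -S2 -S3 !mulr_sumr -!sumrB; apply: eq_bigr => a _.
rewrite !mulr_sumr -!sumrB; apply: eq_bigr => b _.
rewrite !mulr_sumr -!sumrB; apply: eq_bigr => c _.
rewrite !mulr_sumr -!sumrB; apply: eq_bigr => d _.
by rewrite pE -!mulr_suml; field.
Qed.

(** The trace on a submodule is the trace of the action composed with any projection
    onto it. *)
Lemma mxtrace_submod (gT : finGroupType) (G : {group gT}) n
    (rG : mx_representation R G n) (U P : 'M[R]_n) (modU : mxmodule rG U) x :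
  x \in G -> (P <= U)%MS -> U *m P = U ->
  \tr (submod_repr modU x) = \tr (P *m rG x).
Proof.
move=> Gx; rewrite -(eq_row_base U) => /submxP[C PE] UP.
have BP : row_base U *m P = row_base U.
  have /submxP[D ->] : (row_base U <= U)%MS by rewrite eq_row_base.
  by rewrite -mulmxA UP.
have BC : row_base U *m C = 1%:M.
  by apply: (row_free_inj (row_base_free U)); rewrite -mulmxA -PE BP mul1mx.
rewrite PE -mulmxA [RHS]mxtrace_mulC.
have -> : row_base U *m rG x = submod_repr modU x *m row_base U.
  by have := val_submodJ modU 1%:M Gx; rewrite /val_submod /= !mul1mx.
by rewrite -mulmxA BC mulmx1.
Qed.

Lemma mxtrace_varrho2 (gT : finGroupType) (G : {group gT}) (iota : G2_embedding R G) x :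
  x \in G -> \tr (varrho2 iota x) =
  (((\tr (iota x)) ^+ 2 - \tr (iota (x ^+ 2)%g)) / 2 - \tr (iota x))%:C%C.
Proof.
move=> Gx; rewrite /varrho2 map_reprE trace_map_mx; congr (_%:C)%C.
rewrite (mxtrace_submod (P := lin_mx g2_proj)) //=.
- rewrite mxtrace_g2_proj_Ad; last exact: (emb_G2 iota Gx).
  by rewrite expgS expg1 repr_mxM.
- apply/row_subP => i; rewrite rowE -[delta_mx 0 i]vec_mxK mul_vec_lin /=.
  exact: g2_proj_mem.
apply/row_matrixP => i; rewrite row_mul -[row i _]vec_mxK mul_vec_lin /=.
by rewrite g2_proj_id ?vec_mxK // row_sub.
Qed.

(** The character is real, hence takes the same value at an element and its inverse. *)
Lemma mxtrace_embV (gT : finGroupType) (G : {group gT}) (iota : G2_embedding R G) x :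
  x \in G -> \tr (iota (x^-1)%g) = \tr (iota x).
Proof.
by move=> Gx; rewrite repr_mxV // in_G2_invmx ?mxtrace_tr //; exact: (emb_G2 iota Gx).
Qed.

End G2Traces.

(** * Conjugacy classes of PSL(2;7) *)

(** Stated for an abstract group, where the group structure of the type is not unfolded. *)
Section CosetCenter.
Variables (gT : finGroupType) (G : {group gT}).
Implicit Types x y : gT.

Lemma mem_norm_center x : x \in G -> x \in 'N('Z(G))%g.
Proof. exact: (fintype.subsetP (normal_norm (center_normal G))). Qed.

Lemma coset_centerJ x y : x \in G -> y \in G ->
  coset 'Z(G) (x ^ y)%g = (coset 'Z(G) x ^ coset 'Z(G) y)%g.
Proof. by move=> /mem_norm_center xN /mem_norm_center yN; rewrite morphJ. Qed.

Lemma coset_centerV x : x \in G -> coset 'Z(G) x^-1%g = (coset 'Z(G) x)^-1%g.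
Proof. by move=> /mem_norm_center xN; rewrite morphV. Qed.

End CosetCenter.

Section SL2Classes.
Local Open Scope group_scope.
Variable F : finFieldType.
(** An abstract field with the two properties that characterise F_7: over the concrete
    one, arithmetic identities would be normalised modulo 7 at every step. *)
Hypothesis F7_ind : forall P : F -> Prop,
  P 0%R -> P 1%R -> P 2%R -> P 3%R -> P (- 3)%R -> P (- 2)%R -> P (- 1)%R -> forall t, P t.
Hypothesis F7_char : (7 = 0 :> F)%R.

Local Notation GL := {'GL_2[F]}.
Local Notation SL := (SL2_group F).
Local Notation Z := ('Z(SL2_group F)).
Local Notation cos := (coset Z).

Implicit Types x y : GL.

Definition mkSL (M : 'M[F]_2) : GL := insubd (1 : GL) M.

Lemma mkSLK M : \det M = 1%R -> GLval (mkSL M) = M.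
Proof. by move=> dM; rewrite /mkSL val_insubd /= unitmxE dM unitr1. Qed.

Lemma GL_inj : injective (@GLval 2 F).
Proof. exact: val_inj. Qed.

Lemma GLvalM x y : GLval (x * y)%g = (GLval x *m GLval y)%R.
Proof. by []. Qed.

Lemma SLP x : reflect (\det (GLval x) = 1%R) (x \in SL).
Proof. by rewrite inE; exact: eqP. Qed.

Lemma mkSL_in M : \det M = 1%R -> mkSL M \in SL.
Proof. by move=> dM; apply/SLP; rewrite mkSLK. Qed.

Definition mx (a b c d : F) : 'M[F]_2 :=
  \matrix_(i, j) if i == 0%R then (if j == 0%R then a else b)
                 else (if j == 0%R then c else d).

Lemma mx_eta (M : 'M[F]_2) : M = mx (M 0 0)%R (M 0 1)%R (M 1 0)%R (M 1 1)%R.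
Proof.
apply/matrixP => i j; rewrite mxE.
by case: i => [[|[|//]] ?]; case: j => [[|[|//]] ?] /=; congr (M _ _); apply: val_inj.
Qed.

Local Open Scope ring_scope.

Lemma mxM a b c d a' b' c' d' : mx a b c d *m mx a' b' c' d' =
  mx (a * a' + b * c') (a * b' + b * d') (c * a' + d * c') (c * b' + d * d').
Proof.
apply/matrixP => i j; rewrite !mxE !big_ord_recl big_ord0 !mxE addr0.
by case: i => [[|[|//]] ?]; case: j => [[|[|//]] ?] /=.
Qed.

Lemma det_mx a b c d : \det (mx a b c d) = a * d - b * c.
Proof.
rewrite (expand_det_row _ 0) !big_ord_recl big_ord0 /cofactor !det_mx11 !mxE /=.
by rewrite expr0 expr1 !mul1r addr0 mulN1r mulrN.
Qed.

Lemma mx_inj a b c d a' b' c' d' : mx a b c d = mx a' b' c' d' ->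
  [/\ a = a', b = b', c = c' & d = d'].
Proof.
move=> E; split; [have := congr1 (fun M : 'M[F]_2 => M 0 0) E | have := congr1 (fun M : 'M[F]_2
  => M 0 1) E
 | have := congr1 (fun M : 'M[F]_2 => M 1 0) E | have := congr1 (fun M : 'M[F]_2 => M 1 1) E];
   by rewrite !mxE.
Qed.

(** For a non-scalar matrix of determinant 1 and trace t, the order of its image in
    PSL(2;7); [code4] gives scalar matrices the code 1. *)
Definition trace_code (t : F) : nat :=
  if t == 0 then 2 else if t ^+ 2 == 1 then 3 else if t ^+ 2 == 2 then 4 else 7.

Definition code4 (a b c d : F) : nat :=
  if [&& b == 0, c == 0 & a == d] then 1 else trace_code (a + d).

Definition code_mx (M : 'M[F]_2) : nat := code4 (M 0 0) (M 0 1) (M 1 0) (M 1 1).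

Definition code x := code_mx (GLval x).

Definition companion (t : F) : 'M[F]_2 := mx 0 1 (-1) t.

Lemma det_companion t : \det (companion t) = 1.
Proof. by rewrite det_mx mul0r mul1r sub0r opprK. Qed.

Definition rep (k : nat) : GL :=
  match k with
  | 2 => mkSL (companion 0) | 3 => mkSL (companion 1) | 4 => mkSL (companion 3)
  | 7 => mkSL (companion 2) | _ => 1%g end.

Lemma det_rows (v1 v2 : F) (M : 'M[F]_2) : \det (mx v1 v2 (v1 * M 0 0 + v2 * M 1 0) (v1 * M 0 1
  + v2 * M 1 1)) =
  M 0 1 * v1 ^+ 2 + (M 1 1 - M 0 0) * v1 * v2 - M 1 0 * v2 ^+ 2.
Proof. by rewrite det_mx; ring. Qed.

Lemma cube_F7 (q : F) : q != 0 -> q ^+ 3 = 1 \/ q ^+ 3 = -1.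
Proof. have E7 (k : int) (a b : F) : a - b = k%:~R * 7 -> a = b.
  by rewrite F7_char mulr0 => /eqP; rewrite subr_eq0 => /eqP.
move: q; apply: F7_ind => [/eqP//|_|_|_|_|_|_].
- by left; rewrite expr1n.
- by left; apply: (E7 1); ring.
- by right; apply: (E7 4); ring.
- by left; apply: (E7 (-4)); ring.
- by right; apply: (E7 (-1)); ring.
- by right; ring. Qed.

(** A non-scalar matrix M has a vector v with q = det (v, vM) nonzero.  The determinant
    of q v is q^3, which is 1 or -1 in F_7. *)
Lemma cyclic_vector (M : 'M[F]_2) : code_mx M != 1%N -> exists v1 v2 : F,
  let d := \det (mx v1 v2 (v1 * M 0 0 + v2 * M 1 0) (v1 * M 0 1 + v2 * M 1 1)) in
  d = 1 \/ d = -1.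
Proof.
move=> cM.
suff [v1 [v2]] : exists v1 v2 : F,
    M 0 1 * v1 ^+ 2 + (M 1 1 - M 0 0) * v1 * v2 - M 1 0 * v2 ^+ 2 != 0.
  set q := (X in X != 0) => q0; exists (q * v1), (q * v2) => /=.
  rewrite det_rows; have -> : M 0 1 * (q * v1) ^+ 2 + (M 1 1 - M 0 0) * (q * v1) * (q * v2)
      - M 1 0 * (q * v2) ^+ 2 = q ^+ 3 by rewrite /q; ring.
  exact: cube_F7.
have [b0|b0] := eqVneq (M 0 1) 0; last first.
  by exists 1, 0; rewrite expr0n /= !mulr0 expr1n mulr1 addr0 subr0.
have [c0|c0] := eqVneq (M 1 0) 0; last first.
  by exists 0, 1; rewrite expr0n /= !mulr0 mul0r expr1n mulr1 addr0 sub0r oppr_eq0.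
exists 1, 1; rewrite b0 c0 !mulr1 !mul0r add0r subr0 subr_eq0.
by apply: contra cM => /eqP ad; rewrite /code_mx /code4 b0 c0 ad !eqxx.
Qed.

(** In the basis (v, vx), of determinant 1, the matrix x becomes a companion matrix. *)
Lemma conj_companion_pos x (v1 v2 : F) : x \in SL ->
  \det (mx v1 v2 (v1 * x 0 0 + v2 * x 1 0) (v1 * x 0 1 + v2 * x 1 1)) = 1 ->
  exists2 p, p \in SL & mkSL (companion (x 0 0 + x 1 1)) = (x ^ p)%g.
Proof.
move=> xSL dP; set P := mx _ _ _ _ in dP.
exists (mkSL P)^-1%g; first exact: (groupVr (mkSL_in dP)).
rewrite /conjg invgK; apply: (mulIg (mkSL P)); rewrite mulgA mulgKV.
apply: GL_inj; rewrite !GLvalM mkSLK ?det_companion // mkSLK //.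
have /SLP := xSL; rewrite {1}[GLval x]mx_eta det_mx => dx.
rewrite [GLval x in RHS]mx_eta.
rewrite /companion /P !mxM; congr mx; rewrite ?mul0r ?mul1r ?add0r //.
  apply/eqP; rewrite -subr_eq0; apply/eqP.
  transitivity (v1 * (x 0 0 * x 1 1 - x 0 1 * x 1 0 - 1)); first by ring.
  by rewrite dx subrr mulr0.
apply/eqP; rewrite -subr_eq0; apply/eqP.
transitivity (v2 * (x 0 0 * x 1 1 - x 0 1 * x 1 0 - 1)); first by ring.
by rewrite dx subrr mulr0.
Qed.

Lemma GLval_inv x : x \in SL ->
  GLval x^-1%g = mx (x 1 1) (- x 0 1) (- x 1 0) (x 0 0).
Proof.
move=> xSL; have /SLP := xSL; rewrite {1}[GLval x]mx_eta det_mx => dx.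
set y := mx _ _ _ _.
have yx : y *m GLval x = 1%:M.
  rewrite [GLval x]mx_eta mxM [RHS]mx_eta !mxE /=; congr mx; rewrite -?dx; ring.
have xx : GLval x *m GLval x^-1%g = 1%:M.
  by rewrite -GLvalM mulgV.
by rewrite -[LHS]mul1mx -yx -mulmxA xx mulmx1.
Qed.

(** When the only available determinant is -1, the inverse of x, of the same trace, has
    determinant +1 at the same vector. *)
Lemma conj_companion x : x \in SL -> code x != 1%N ->
  exists2 p, p \in SL & mkSL (companion (x 0 0 + x 1 1)) = (x ^ p)%g \/
                        mkSL (companion (x 0 0 + x 1 1)) = (x^-1 ^ p)%g.
Proof.
move=> xSL /cyclic_vector[v1 [v2 [d1|d1]]].
  by have [p pSL E] := conj_companion_pos xSL d1; exists p => //; left.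
have [||p pSL E] := @conj_companion_pos x^-1%g v1 v2; first exact: groupVr.
  rewrite det_rows GLval_inv // !mxE /=; apply/eqP; rewrite -eqr_opp -d1 det_rows.
  by apply/eqP; ring.
exists p => //; right; rewrite -E GLval_inv // !mxE /=; congr (mkSL (companion _)).
by rewrite addrC.
Qed.

Lemma trace_code_neq1 t : trace_code t != 1%N.
Proof. by rewrite /trace_code; do 3 case: ifP => //. Qed.

Lemma trace_codeN t : trace_code (- t) = trace_code t.
Proof. by rewrite /trace_code oppr_eq0 sqrrN. Qed.

Lemma F7_2_3_neq0 : (2 != 0 :> F) /\ (3 != 0 :> F).
Proof.
split; apply: contraFN (oner_eq0 F) => /eqP E; apply/eqP; rewrite -F7_char.
  transitivity (1 + 3 * 2 : F); first by rewrite E mulr0 addr0.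
  by ring.
transitivity (1 + 2 * 3 : F); first by rewrite E mulr0 addr0.
by ring.
Qed.

Lemma trace_code_vals : [/\ trace_code 0 = 2%N, trace_code 1 = 3%N,
  trace_code 2 = 7%N & trace_code 3 = 4%N].
Proof.
have [E2 E3] := F7_2_3_neq0; split.
- by rewrite /trace_code eqxx.
- by rewrite /trace_code oner_eq0 expr1n eqxx.
- rewrite /trace_code (negPf E2); case: eqP => [E|_].
    by case/eqP: E3; transitivity (2 ^+ 2 - 1 : F); [ring | rewrite E subrr].
  case: eqP => // E.
  by case/eqP: E2; transitivity (2 ^+ 2 - 2 : F); [ring | rewrite E subrr].
rewrite /trace_code (negPf E3); case: eqP => [E|_].
  case/eqP: (oner_neq0 F); transitivity (3 ^+ 2 - 1 - 7 : F); first by ring.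
  by rewrite E F7_char subr0 subrr.
case: eqP => // E; case: E; apply/eqP; rewrite -subr_eq0 -F7_char; apply/eqP; ring.
Qed.

Definition code_sqr (k : nat) : nat :=
  match k with 1 | 2 => 1 | 3 => 3 | 4 => 2 | _ => 7 end.

Lemma trace_code_sqr t : t != 0 -> trace_code (t ^+ 2 - 2) = code_sqr (trace_code t).
Proof.
have [c0 c1 c2 c3] := trace_code_vals.
have E1 : 1 ^+ 2 - 2 = - 1 :> F by ring.
have E2 : 2 ^+ 2 - 2 = 2 :> F by ring.
have E3 : 3 ^+ 2 - 2 = 0 :> F by rewrite -F7_char; ring.
move: t; apply: F7_ind => [/eqP//|_|_|_|_|_|_];
  by rewrite ?sqrrN ?trace_codeN ?c1 ?c2 ?c3 ?E1 ?E2 ?E3 ?trace_codeN ?c0 ?c1 ?c2.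
Qed.

Section ClassFunction.
Variables (A : Type) (f : coset_of Z -> A).
Hypothesis fJ : forall y z : coset_of Z, y \in PSL2 F -> z \in PSL2 F -> f (y ^ z)%g = f y.
Hypothesis fV : forall y : coset_of Z, y \in PSL2 F -> f y^-1%g = f y.

Lemma SL_norm x : x \in SL -> x \in 'N(Z)%g.
Proof. exact: mem_norm_center. Qed.

Lemma cos_in x : x \in SL -> cos x \in PSL2 F.
Proof. by move=> xSL; apply: mem_quotient. Qed.

Lemma f_companion x : x \in SL -> code x != 1%N ->
  f (cos x) = f (cos (mkSL (companion (x 0 0 + x 1 1)))).
Proof.
move=> xSL cx; have [p pSL E] := conj_companion xSL cx.
have xp := coset_centerJ xSL pSL; have xV := groupVr xSL.
have xVp := coset_centerJ xV pSL; have cV := coset_centerV xSL.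
case: E => ->; first by rewrite xp fJ // cos_in.
rewrite xVp cV fJ; [by rewrite fV // cos_in | | exact: cos_in].
by apply: groupVr; exact: cos_in.
Qed.

Lemma coset_oppSL x : x \in SL -> cos (mkSL (- GLval x)) = cos x.
Proof.
move=> xSL; have /SLP dx := xSL.
have dN : \det (- 1%:M : 'M[F]_2) = 1.
  by rewrite -scaleN1r detZ det1 mulr1 -signr_odd.
have NZ : mkSL (- 1%:M) \in Z.
  apply/centerP; split=> [|y _]; first exact: mkSL_in.
  by apply: GL_inj; rewrite !GLvalM mkSLK // mulNmx mulmxN mul1mx mulmx1.
rewrite -[RHS](coset_kerr x NZ); congr (cos _).
apply: GL_inj; rewrite GLvalM !mkSLK ?mulmxN ?mulmx1 //.
by rewrite -scaleN1r detZ dx mulr1 -signr_odd.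
Qed.

(** A companion matrix and its opposite have the same image in PSL2, and opposite
    traces. *)
Lemma f_companionN t :
  f (cos (mkSL (companion t))) = f (cos (mkSL (companion (- t)))).
Proof.
have CS := mkSL_in (det_companion t).
rewrite -(coset_oppSL CS); set x := mkSL (- _).
have dx : \det (- companion t) = 1.
  by rewrite -scaleN1r detZ det_companion mulr1 -signr_odd.
have xE : GLval x = - companion t by rewrite mkSLK ?mkSLK ?det_companion.
rewrite f_companion ?xE ?mxE /= ?oppr0 ?add0r //.
  by rewrite /x mkSLK ?det_companion // mkSL_in.
by rewrite /code xE /code_mx /code4 !mxE /= oppr_eq0 oner_eq0; exact: trace_code_neq1.
Qed.

Lemma scalar_center x : x \in SL -> code x = 1%N -> x \in Z.
Proof.
move=> xSL; rewrite /code /code_mx /code4; case: ifP => [/and3P[/eqP b0 /eqP c0 /eqP ad]|_];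
  last first.
  by move/eqP; rewrite (negPf (trace_code_neq1 _)).
move=> _; apply/centerP; split=> // y _; apply: GL_inj; rewrite !GLvalM.
rewrite [GLval x]mx_eta [GLval y]mx_eta !mxM b0 c0 ad.
by congr mx; ring.
Qed.

(** The trace, up to sign, determines a non-scalar element of PSL2 up to conjugacy and
    inversion, and the code determines the trace up to sign. *)
Lemma f_code x : x \in SL -> f (cos x) = f (cos (rep (code x))).
Proof.
move=> xSL; have [c1|c1] := eqVneq (code x) 1%N.
  rewrite c1 /= coset_id ?scalar_center // (morph1 (coset_morphism Z)) //.
rewrite f_companion //; move: c1; rewrite /code /code_mx /code4.
case: ifP => // _; move: (_ + _) => t _.
have [c0 c1 c2 c3] := trace_code_vals; move: t; apply: F7_ind.
- by rewrite c0.
- by rewrite c1.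
- by rewrite c2.
- by rewrite c3.
- by rewrite trace_codeN c3 -f_companionN.
- by rewrite trace_codeN c2 -f_companionN.
by rewrite trace_codeN c1 -f_companionN.
Qed.

End ClassFunction.

(** ** Squares *)

Lemma GLval_sqr x : x \in SL -> let t := x 0 0 + x 1 1 in
  GLval (x ^+ 2)%g = mx (t * x 0 0 - 1) (t * x 0 1) (t * x 1 0) (t * x 1 1 - 1).
Proof.
move=> xSL; have /SLP := xSL; rewrite {1}[GLval x]mx_eta det_mx => dx t; rewrite /t {t}.
rewrite (_ : (x ^+ 2)%g = (x * x)%g) // GLvalM [GLval x in LHS]mx_eta mxM.
by congr mx; rewrite -?dx; ring.
Qed.

Lemma code_sqrE x : x \in SL -> code (x ^+ 2)%g = code_sqr (code x).
Proof.
move=> xSL; rewrite /code GLval_sqr // /code_mx /code4 !mxE /=.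
set t := x 0 0 + x 1 1.
have -> : t * x 0 0 - 1 + (t * x 1 1 - 1) = t ^+ 2 - 2 by rewrite /t; ring.
rewrite (inj_eq (addIr _)) !mulf_eq0 -subr_eq0 -mulrBr mulf_eq0 subr_eq0.
have [t0|t0] := eqVneq t 0; last by rewrite trace_code_sqr //=; case: ifP.
by rewrite t0 /=; have [-> _ _ _] := trace_code_vals; case: ifP.
Qed.

(** ** Counting *)

Lemma sum_coset (A : zmodType) (f : coset_of Z -> A) :
  \sum_(x in SL) f (cos x) = \sum_(y in PSL2 F) f y *+ #|Z|.
Proof.
rewrite (partition_big cos (mem (PSL2 F))) /=; last by move=> x; apply: cos_in.
apply: eq_bigr => y /morphimP[x0 N0 x0SL ->].
rewrite (eq_bigr (fun=> f (cos x0))) => [|x /andP[_ /eqP -> //]].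
rewrite sumr_const -(card_rcoset Z x0); congr (_ *+ _); apply: eq_card => x.
rewrite unfold_in /=; apply/andP/idP => [[xSL /eqP]|xZ].
  by move/(rcoset_kercosetP (SL_norm xSL) N0).
have xSL : x \in SL.
  by move: xZ => /rcosetP[z /centerP[zSL _] ->]; apply: groupM.
by split=> //; apply/eqP/(rcoset_kercosetP (SL_norm xSL) N0).
Qed.

(** The sum over SL2 as four sums over the field, a form that evaluates quickly. *)
Definition code_count k : nat :=
  (\sum_(a : F) \sum_(b : F) \sum_(c : F) \sum_(d : F)
    nat_of_bool ((a * d - b * c == 1 :> F)%R && (code4 a b c d == k)))%N.

Lemma card_code k : #|[set x in SL | code x == k]| = code_count k.
Proof.
pose h (q : F * F * F * F) := let: (a, b, c, d) := q in mkSL (mx a b c d).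
pose S := [set q : F * F * F * F | let: (a, b, c, d) := q in
   (a * d - b * c == 1) && (code4 a b c d == k)].
have -> : [set x in SL | code x == k] = h @: S.
  apply/setP => x; rewrite inE; apply/andP/imsetP.
    move=> [xSL /eqP ck]; have /SLP := xSL; rewrite [GLval x]mx_eta => dx.
    exists (GLval x 0 0, GLval x 0 1, GLval x 1 0, GLval x 1 1).
      by rewrite inE -det_mx dx eqxx -ck eqxx.
    by apply: GL_inj; rewrite /h mkSLK // -mx_eta.
  move=> [[[[a b] c] d]]; rewrite inE -det_mx => /andP[/eqP dq /eqP ck] ->.
  by rewrite /h mkSL_in // /code mkSLK // /code_mx !mxE ck.
rewrite card_in_imset; last first.
  move=> [[[a b] c] d] [[[a' b'] c'] d']; rewrite !inE -!det_mx.
  move=> /andP[/eqP dq _] /andP[/eqP dq' _] /(congr1 (@GLval 2 F)).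
  by rewrite /h !mkSLK // => /mx_inj[-> -> -> ->].
rewrite -sum1_card big_mkcond /code_count.
rewrite pair_bigA /= pair_bigA /= pair_bigA /=; apply: eq_bigr => [[[[a b] c] d]] _.
by rewrite inE /=; case: andP.
Qed.

Lemma code_rep k : k \in [:: 1; 2; 3; 4; 7]%N -> rep k \in SL /\ code (rep k) = k.
Proof.
have [c0 c1 c2 c3] := trace_code_vals.
have cE t : mkSL (companion t) \in SL /\ code (mkSL (companion t)) = trace_code t.
  split; first by rewrite mkSL_in ?det_companion.
  by rewrite /code mkSLK ?det_companion // /code_mx /code4 !mxE /= oner_eq0 add0r.
rewrite !in_cons in_nil orbF; do 4?[case/orP]; move/eqP=> ->.
- split; first exact: (group1 SL).
  by rewrite /code /code_mx /code4 !mxE /= !eqxx.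
- by have := cE 0; rewrite c0.
- by have := cE 1; rewrite c1.
- by have := cE 3; rewrite c3.
by have := cE 2; rewrite c2.
Qed.

Lemma cos_rep1 : cos (rep 1) = 1%g.
Proof. by apply: coset_id; exact: (group1 [group of Z]). Qed.

Lemma cos_rep4 : (cos (rep 4) ^+ 4 = 1)%g.
Proof.
have [S4 c4] := code_rep (isT : 4 \in [:: 1; 2; 3; 4; 7]%N).
rewrite -morphX ?SL_norm //; apply: coset_id; apply: scalar_center; first exact: groupX.
by rewrite (expgM _ 2 2) !code_sqrE ?groupX // c4.
Qed.

Lemma cos_rep3 : (cos (rep 3) ^+ 3 = 1)%g.
Proof.
have [S3 c3] := code_rep (isT : 3 \in [:: 1; 2; 3; 4; 7]%N).
rewrite -morphX ?SL_norm //; apply: coset_id; apply: scalar_center; first exact: groupX.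
rewrite (_ : (rep 3 ^+ 3)%g = (rep 3 * (rep 3 * rep 3))%g) // /code.
rewrite !GLvalM mkSLK ?det_companion // !mxM /code_mx /code4 !mxE /=.
by rewrite ifT //; apply/and3P; split; apply/eqP; ring.
Qed.

Lemma code_cases x : code x \in [:: 1; 2; 3; 4; 7]%N.
Proof.
rewrite /code /code_mx /code4; case: ifP => // _.
by rewrite /trace_code; do 3 case: ifP => //.
Qed.

(** Commuting with the two elementary transvections forces a matrix to be scalar. *)
Lemma center_code x : (x \in Z) = (x \in SL) && (code x == 1%N).
Proof.
apply/idP/andP => [/centerP[xSL cx]|[xSL /eqP]]; last exact: scalar_center.
split=> //; pose u := mx 1 1 0 1; pose l := mx 1 0 1 1.
have du : \det u = 1 by rewrite det_mx; ring.
have dl : \det l = 1 by rewrite det_mx; ring.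
have := congr1 (@GLval 2 F) (cx _ (mkSL_in du)).
have := congr1 (@GLval 2 F) (cx _ (mkSL_in dl)).
rewrite !GLvalM !mkSLK // [GLval x]mx_eta /u /l !mxM => /mx_inj[b0 _ _ _] /mx_inj[c0 ad _ _].
rewrite /code /code_mx /code4.
have -> : x 0 1 = 0.
  by transitivity (x 0 0 * 1 + x 0 1 * 1 - x 0 0); [ring | rewrite b0; ring].
have -> : x 1 0 = 0.
  by transitivity (1 * x 0 0 + 1 * x 1 0 - x 0 0); [ring | rewrite -c0; ring].
have -> : x 0 0 = x 1 1.
  by transitivity (x 0 0 * 1 + x 0 1 * 1 - x 0 1); [ring | rewrite ad; ring].
by rewrite !eqxx.
Qed.

(** Both sides count over SL2, where every element of PSL2 has as many preimages as
    there are central elements. *)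
Lemma sum_PSL2 (A : numDomainType) (f : coset_of Z -> A) :
  (forall y z : coset_of Z, y \in PSL2 F -> z \in PSL2 F -> f (y ^ z)%g = f y) ->
  (forall y : coset_of Z, y \in PSL2 F -> f y^-1%g = f y) ->
  (\sum_(y in PSL2 F) f y) *+ code_count 1 =
  \sum_(k <- [:: 1; 2; 3; 4; 7]%N) f (cos (rep k)) *+ code_count k.
Proof.
move=> fJ fV; have -> : code_count 1 = #|Z|.
  rewrite -card_code; apply: eq_card => x.
  by rewrite center_code inE.
rewrite -sumrMnl -sum_coset (eq_bigr (fun x => f (cos (rep (code x))))); last first.
  by move=> x xSL; rewrite (f_code fJ fV xSL).
under [LHS]eq_bigr => x xSL.
  rewrite (_ : f _ = \sum_(k <- [:: 1; 2; 3; 4; 7]%N) if code x == k then f (cos (rep k)) else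
    0); last first.
    by rewrite -big_mkcond -big_filter; have := code_cases x; rewrite !inE; do 4?[case/orP];
      move=> /eqP -> /=; rewrite big_seq1.
  over.
rewrite exchange_big; apply: eq_bigr => k _ /=.
rewrite -big_mkcondr sumr_const -card_code; congr (_ *+ _).
by apply: eq_card => x; rewrite [RHS]inE.
Qed.

Lemma f_rep_sqr (A : Type) (f : coset_of Z -> A) k :
  (forall y z : coset_of Z, y \in PSL2 F -> z \in PSL2 F -> f (y ^ z)%g = f y) ->
  (forall y : coset_of Z, y \in PSL2 F -> f y^-1%g = f y) ->
  k \in [:: 1; 2; 3; 4; 7]%N -> f (cos (rep k) ^+ 2)%g = f (cos (rep (code_sqr k))).
Proof.
move=> fJ fV /code_rep[Sk ck].
have S2 := groupX 2 Sk.
have -> : (cos (rep k) ^+ 2 = cos (rep k ^+ 2))%g by rewrite morphX ?SL_norm.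
by rewrite (f_code fJ fV S2) (code_sqrE Sk) ck.
Qed.

(** The counts are half those of SL2.  The class of elements of order 7 splits into two
    mutually inverse ones, which f does not distinguish. *)
Lemma PSL2_classes :
    [/\ code_count 1 = 2, code_count 2 = 42, code_count 3 = 112, code_count 4 = 84
      & code_count 7 = 96]%N ->
  exists r : nat -> coset_of Z,
  [/\ forall k, k \in [:: 1; 2; 3; 4; 7]%N -> r k \in PSL2 F,
      [/\ r 1%N = 1, r 4%N ^+ 4 = 1 & r 3%N ^+ 3 = 1]%g,
      forall (A : Type) (f : coset_of Z -> A) k,
        (forall y z : coset_of Z, y \in PSL2 F -> z \in PSL2 F -> f (y ^ z)%g = f y) ->
        (forall y : coset_of Z, y \in PSL2 F -> f y^-1%g = f y) ->
        k \in [:: 1; 2; 3; 4; 7]%N -> f (r k ^+ 2)%g = f (r (code_sqr k))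
    & forall (A : numDomainType) (f : coset_of Z -> A),
        (forall y z : coset_of Z, y \in PSL2 F -> z \in PSL2 F -> f (y ^ z)%g = f y) ->
        (forall y : coset_of Z, y \in PSL2 F -> f y^-1%g = f y) ->
        \sum_(y in PSL2 F) f y = f (r 1%N) + f (r 2%N) *+ 21 + f (r 3%N) *+ 56
          + f (r 4%N) *+ 42 + f (r 7%N) *+ 48] /\ #|PSL2 F| = 168%N.
Proof.
move=> [e1 e2 e3 e4 e7].
have sumE (A : numDomainType) (f : coset_of Z -> A) :
    (forall y z : coset_of Z, y \in PSL2 F -> z \in PSL2 F -> f (y ^ z)%g = f y) ->
    (forall y : coset_of Z, y \in PSL2 F -> f y^-1%g = f y) ->
    \sum_(y in PSL2 F) f y = f (cos (rep 1)) + f (cos (rep 2)) *+ 21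
      + f (cos (rep 3)) *+ 56 + f (cos (rep 4)) *+ 42 + f (cos (rep 7)) *+ 48.
  move=> fJ fV; apply/eqP; rewrite -(eqr_pMn2r (isT : 0 < 2)%N); apply/eqP.
  have := sum_PSL2 fJ fV; rewrite e1 => ->; rewrite !big_cons big_nil e1 e2 e3 e4 e7.
  move: (f (cos (rep 1))) (f (cos (rep 2))) (f (cos (rep 3))) (f (cos (rep 4))) (f (cos (rep 7))).
  by move=> x1 x2 x3 x4 x7; ring.
exists (fun k => cos (rep k)); split; last first.
  have := sumE rat (fun=> 1) (fun _ _ _ _ => erefl) (fun _ _ => erefl).
  rewrite [LHS]sumr_const; move: #|_| => n E; apply/eqP.
  by rewrite -(eqr_nat rat) E; apply/eqP; ring.
split=> //.
- by move=> k /code_rep[Sk _]; apply: cos_in.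
- by split; [exact: cos_rep1 | exact: cos_rep4 | exact: cos_rep3].
by move=> A f k; apply: f_rep_sqr.
Qed.

End SL2Classes.

Section PSL27.

Lemma F7_ind (P : 'F_7 -> Prop) :
  P 0 -> P 1 -> P 2 -> P 3 -> P (- 3) -> P (- 2) -> P (- 1) -> forall t, P t.
Proof.
move=> P0 P1 P2 P3 P4 P5 P6 [m i].
have E (u : 'F_7) : (u : nat) = m -> u = Ordinal i by move=> um; exact: val_inj.
by move: m i E => [|[|[|[|[|[|[|//]]]]]]] i E; [rewrite -(E 0)|rewrite -(E 1)|
  rewrite -(E 2)|rewrite -(E 3)|rewrite -(E (-3))|rewrite -(E (-2))|rewrite -(E (-1))].
Qed.

Lemma F7_char : 7 = 0 :> 'F_7.
Proof. exact: val_inj. Qed.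

Lemma code_count7 : [/\ code_count 'F_7 1 = 2, code_count 'F_7 2 = 42,
  code_count 'F_7 3 = 112, code_count 'F_7 4 = 84 & code_count 'F_7 7 = 96]%N.
Proof.
have sumE (f : 'F_7 -> nat) :
    (\sum_a f a)%N = foldr (fun i s => f (inZp i) + s)%N 0%N (iota 0 7).
  transitivity (\sum_(i < 7) f (inZp i))%N.
    by apply: (eq_bigr (fun i : 'F_7 => f (inZp (i : nat)))) => a _; rewrite valZpK.
  by rewrite -(big_mkord xpredT (fun i => f (inZp i))) unlock /=.
pose count7 (g : 'F_7 -> nat) := foldr (fun i s => g (inZp i) + s)%N 0%N (iota 0 7).
have E k : code_count 'F_7 k = count7 (fun a => count7 (fun b => count7 (fun c => count7 (fun d =>
   nat_of_bool ((a * d - b * c == 1 :> 'F_7)%R && (code4 a b c d == k)))))).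
  rewrite /code_count sumE; congr foldr; apply/funext => a; apply/funext => s; congr addn.
  rewrite sumE; congr foldr; apply/funext => b; apply/funext => s1; congr addn.
  rewrite sumE; congr foldr; apply/funext => c; apply/funext => s2; congr addn.
  by rewrite sumE.
rewrite !E; split.
by vm_cast_no_check (erefl 2%N).
by vm_cast_no_check (erefl 42%N).
by vm_cast_no_check (erefl 112%N).
by vm_cast_no_check (erefl 84%N).
by vm_cast_no_check (erefl 96%N).
Qed.

Lemma PSL27_classes : exists r : nat -> coset_of 'Z(SL2_group 'F_7)%g,
  [/\ forall k, k \in [:: 1; 2; 3; 4; 7]%N -> r k \in PSL27,
      [/\ r 1%N = 1, r 4%N ^+ 4 = 1 & r 3%N ^+ 3 = 1]%g,
      forall (A : Type) (f : coset_of 'Z(SL2_group 'F_7)%g -> A) k,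
        (forall y z, y \in PSL27 -> z \in PSL27 -> f (y ^ z)%g = f y) ->
        (forall y, y \in PSL27 -> f y^-1%g = f y) ->
        k \in [:: 1; 2; 3; 4; 7]%N -> f (r k ^+ 2)%g = f (r (code_sqr k))
    & forall (A : numDomainType) (f : coset_of 'Z(SL2_group 'F_7)%g -> A),
        (forall y z, y \in PSL27 -> z \in PSL27 -> f (y ^ z)%g = f y) ->
        (forall y, y \in PSL27 -> f y^-1%g = f y) ->
        \sum_(y in PSL27) f y = f (r 1%N) + f (r 2%N) *+ 21 + f (r 3%N) *+ 56
          + f (r 4%N) *+ 42 + f (r 7%N) *+ 48] /\ #|PSL27| = 168%N.
Proof. exact: (PSL2_classes F7_ind F7_char code_count7). Qed.

End PSL27.

(** * The values of the characters on PSL(2;7) *)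

Section CharacterValues.
Variables (R : realType) (gT : finGroupType) (G : {group gT}).
Local Notation C := R[i].

Lemma mxtrace_conjg n (F : fieldType) (rG : mx_representation F G n) y z :
  y \in G -> z \in G -> \tr (rG (y ^ z)%g) = \tr (rG y).
Proof.
move=> Gy Gz; rewrite /conjg !repr_mxM ?groupM ?groupV // mxtrace_mulC -mulmxA.
by rewrite -repr_mxM ?groupV // mulgV repr_mx1 mulmx1.
Qed.

Lemma class_momentE (iota : G2_embedding R G) m n :
  class_moment iota m n =
  #|G|%:R^-1 * \sum_(g in G) \tr (varrho1 iota g) ^+ m * \tr (varrho2 iota g) ^+ n.
Proof.
rewrite (sum_by_classes (F := fun g => \tr (varrho1 iota g) ^+ m * \tr (varrho2 iota g) ^+ n)).
  by rewrite mulr_sumr; apply: eq_bigr => K _; rewrite [RHS]mulrCA -mulrA.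
by move=> g h Gg Gh; rewrite !mxtrace_conjg.
Qed.

Lemma mckay_class_moment (iota : G2_embedding R G) m n :
  mckay_moment iota m n = class_moment iota m n.
Proof. by rewrite class_momentE /mckay_moment mckay_momentE. Qed.

Variables (iota : G2_embedding R G) (r : nat -> gT).
Hypothesis cardG : #|G| = 168%N.
Hypothesis rG : forall k, k \in [:: 1; 2; 3; 4; 7]%N -> r k \in G.
Hypothesis r1 : r 1%N = 1%g.
Hypothesis r4 : (r 4 ^+ 4 = 1)%g.
Hypothesis r3 : (r 3 ^+ 3 = 1)%g.
Hypothesis r_sqr : forall (A : Type) (f : gT -> A) k,
  (forall y z, y \in G -> z \in G -> f (y ^ z)%g = f y) ->
  (forall y, y \in G -> f y^-1%g = f y) ->
  k \in [:: 1; 2; 3; 4; 7]%N -> f (r k ^+ 2)%g = f (r (code_sqr k)).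
Hypothesis r_sum : forall (A : numDomainType) (f : gT -> A),
  (forall y z, y \in G -> z \in G -> f (y ^ z)%g = f y) ->
  (forall y, y \in G -> f y^-1%g = f y) ->
  \sum_(y in G) f y = f (r 1%N) + f (r 2%N) *+ 21 + f (r 3%N) *+ 56
    + f (r 4%N) *+ 42 + f (r 7%N) *+ 48.

Definition chi (y : gT) : R := \tr (iota y).

Lemma mxtrace_varrho1 y : \tr (varrho1 iota y) = (chi y)%:C%C.
Proof. by rewrite /varrho1 map_reprE trace_map_mx. Qed.

Lemma chiJ y z : y \in G -> z \in G -> chi (y ^ z)%g = chi y.
Proof. by move=> Gy Gz; rewrite /chi mxtrace_conjg. Qed.

Lemma chiV y : y \in G -> chi y^-1%g = chi y.
Proof. exact: mxtrace_embV. Qed.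

Lemma chi1E : chi (r 1) = 7.
Proof. by rewrite /chi r1 repr_mx1 mxtrace1. Qed.

Lemma chi_sqr k : k \in [:: 1; 2; 3; 4; 7]%N -> chi (r k ^+ 2)%g = chi (r (code_sqr k)).
Proof. exact: (r_sqr chiJ chiV). Qed.

Lemma sum_chi : \sum_(y in G) chi y =
  7 + 21 * chi (r 2) + 56 * chi (r 3) + 42 * chi (r 4) + 48 * chi (r 7).
Proof. by rewrite (r_sum chiJ chiV) chi1E -!(mulr_natl (chi _)). Qed.

Lemma sum_chi2 : \sum_(y in G) chi y ^+ 2 =
  49 + 21 * chi (r 2) ^+ 2 + 56 * chi (r 3) ^+ 2 + 42 * chi (r 4) ^+ 2
  + 48 * chi (r 7) ^+ 2.
Proof.
rewrite (r_sum (f := fun y => chi y ^+ 2)) => [|y z Gy Gz|y Gy]; last 2 first.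
- by rewrite chiJ.
- by rewrite chiV.
by rewrite chi1E -!(mulr_natl (chi _ ^+ 2)); ring.
Qed.

(** The numbers a and c are the multiplicities of the eigenvalues 1 and -i of an element
    of order 4, and b that of a primitive cube root of unity at an element of order 3. *)
Lemma chi_integral : exists a b c : nat,
  [/\ 7 + 2 * chi (r 4) + chi (r 2) = 4 * a%:R, 7 - chi (r 2) = 4 * c%:R
    & 7 - chi (r 3) = 3 * b%:R].
Proof.
have G4 := rG (isT : 4 \in [:: 1; 2; 3; 4; 7]%N).
have G3 := rG (isT : 3 \in [:: 1; 2; 3; 4; 7]%N).
have trX y k : y \in G -> \tr ((varrho1 iota y : 'M[C]_7) ^+ k) = (chi (y ^+ k)%g)%:C%C.
  move=> Gy; rewrite -mxtrace_varrho1; congr (\tr _).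
  elim: k => [|k IHk]; first by rewrite expg0 repr_mx1.
  by rewrite exprS IHk expgS repr_mxM ?groupX.
have oneX y k : y \in G -> (y ^+ k = 1)%g -> (varrho1 iota y : 'M[C]_7) ^+ k = 1.
  move=> Gy yk; have : varrho1 iota (y ^+ k)%g = 1%:M by rewrite yk repr_mx1.
  suff -> : varrho1 iota (y ^+ k)%g = (varrho1 iota y : 'M[C]_7) ^+ k by [].
  elim: k {yk} => [|k IHk]; first by rewrite expg0 repr_mx1.
  by rewrite exprS -IHk expgS repr_mxM ?groupX.
have chi0 y : chi (y ^+ 0)%g = 7 by rewrite expg0 -r1 chi1E.
have c42 : chi (r 4 ^+ 2)%g = chi (r 2) by rewrite chi_sqr.
have c43 : chi (r 4 ^+ 3)%g = chi (r 4).
  rewrite -chiV ?groupX //; congr chi; apply/eqP; rewrite eq_invg_mul -expgSr.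
  by rewrite r4.
have c32 : chi (r 3 ^+ 2)%g = chi (r 3).
  by rewrite chi_sqr.
have [a Ha] := trace_average_nat (isT : (0 < 4)%N) (oneX _ _ G4 r4) (expr1n _ 4).
have i4 : ('i%C : C) ^+ 4 = 1 by rewrite (exprM _ 2 2) sqr_i sqrrN expr1n.
have [c Hc] := trace_average_nat (isT : (0 < 4)%N) (oneX _ _ G4 r4) i4.
pose w : C := (- 2^-1 +i* (Num.sqrt 3 / 2))%C.
have w2 : w ^+ 2 = (- 2^-1 -i* (Num.sqrt 3 / 2))%C.
  rewrite expr2 /w; simpc; congr (_ +i* _)%C; last by field.
  have : (Num.sqrt 3 : R) ^+ 2 = 3 by rewrite sqr_sqrtr.
  by move: (Num.sqrt 3) => s s2; nra.
have w3 : w ^+ 3 = 1.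
  rewrite exprS w2 /w; simpc; congr (_ +i* _)%C; last by field.
  have : (Num.sqrt 3 : R) ^+ 2 = 3 by rewrite sqr_sqrtr.
  by move: (Num.sqrt 3) => s s2; nra.
have [b Hb] := trace_average_nat (isT : (0 < 3)%N) (oneX _ _ G3 r3) w3.
have RC (k : nat) : k%:R = (k%:R : R)%:C%C :> C by rewrite rmorph_nat.
have i2 : ('i%C : C) ^+ 2 = -1 by rewrite sqr_i.
have i3 : ('i%C : C) ^+ 3 = - 'i%C by rewrite exprS i2 mulrN1.
have ww : w + w ^+ 2 = -1.
  by rewrite w2 /w; simpc; congr (_ +i* _)%C; field.
exists a, b, c; split.
- move: Ha; rewrite !big_ord_recr big_ord0 /= !trX // chi0 expg1 c42 c43 !expr1n !mul1r add0r.
  by rewrite !RC -!rmorphD -rmorphM => /complexI <-; ring.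
- move: Hc; rewrite !big_ord_recr big_ord0 /= !trX // chi0 expg1 c42 c43 i3 i2 expr0.
  by rewrite !RC => E; apply: complexI; rewrite [RHS]rmorphM /= -E rmorphB; ring.
move: Hb; rewrite !big_ord_recr big_ord0 /= !trX // chi0 expg1 c32 expr0 add0r mul1r.
rewrite -addrA -mulrDl ww !RC => E; apply: complexI.
by rewrite [RHS]rmorphM /= -E rmorphB mulN1r.
Qed.

(** By [chi_integral] the values lie in arithmetic progressions, and the sum of squares
    bounds them: a finite search. *)
Lemma chi_values_norm1 : \sum_(y in G) chi y = 0 -> \sum_(y in G) chi y ^+ 2 = 168 ->
  [/\ chi (r 2) = -1, chi (r 3) = 1, chi (r 4) = -1 & chi (r 7) = 0].
Proof.
rewrite sum_chi sum_chi2; have [a [b [c]]] := chi_integral.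
move: (chi (r 2)) (chi (r 3)) (chi (r 4)) (chi (r 7)) => x2 x3 x4 x7 [Ha Hc Hb] S1 S2.
have E2 : x2 = -1.
  move: c Hc {Ha} => [|[|[|c]]] Hc; [nra|nra|lra|].
  have c0 : 0 <= c%:R :> R by [].
  by move: Hc; rewrite -addn3 natrD => Hc; nra.
have E3 : x3 = 1.
  move: b Hb => [|[|[|b]]] Hb; [nra|nra|lra|].
  have b0 : 0 <= b%:R :> R by [].
  by move: Hb; rewrite -addn3 natrD => Hb; nra.
have E4 : x4 = -1.
  subst x2 x3; move: a Ha {Hb Hc} => [|[|[|a]]] Ha; [nra|lra| |].
    have {Ha} E : x4 = 1 by lra.
    by subst x4; nra.
  have a0 : 0 <= a%:R :> R by [].
  by move: Ha; rewrite -addn3 natrD => Ha; nra.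
by subst; split=> //; lra.
Qed.

(** The sum of squares is 3 |G| if Sigma_3 differs from its conjugate and 5 |G| if not.
    The second possibility leaves no admissible values, so that the two cases need not
    be told apart beforehand. *)
Lemma chi_values_norm3 (e : bool) : \sum_(y in G) chi y = 168 ->
  \sum_(y in G) chi y ^+ 2 = 168 * (3 + 2 * e%:R) ->
  [/\ chi (r 2) = -1, chi (r 3) = 1, chi (r 4) = 3 & chi (r 7) = 0].
Proof.
rewrite sum_chi sum_chi2; have [a [b [c]]] := chi_integral.
move: (chi (r 2)) (chi (r 3)) (chi (r 4)) (chi (r 7)) => x2 x3 x4 x7 [Ha Hc Hb] S1 S2.
have {}S2 : 49 + 21 * x2 ^+ 2 + 56 * x3 ^+ 2 + 42 * x4 ^+ 2 + 48 * x7 ^+ 2 = 504 \/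
     49 + 21 * x2 ^+ 2 + 56 * x3 ^+ 2 + 42 * x4 ^+ 2 + 48 * x7 ^+ 2 = 840.
  by move: S2; case: e => E; [right|left]; move: E => /=; lra.
have {}S1 : x7 = (161 - 21 * x2 - 56 * x3 - 42 * x4) / 48 by lra.
have le_S2 : 21 * x2 ^+ 2 + 56 * x3 ^+ 2 + 42 * x4 ^+ 2 + 48 * x7 ^+ 2 <= 791.
  by case: S2; lra.
have x3E : x3 = 1 \/ x3 = -2.
  move: b Hb => [|[|[|[|b]]]] Hb; [nra|nra|by left; lra|by right; lra|].
  have b0 : 0 <= b%:R :> R by [].
  by move: Hb; rewrite -addn4 natrD => Hb; nra.
have x2E : [\/ x2 = 3, x2 = -1 | x2 = -5].
  move: c Hc {Ha} => [|[|[|[|c]]]] Hc; [nra|apply: Or31; lra|apply: Or32; lra|apply: Or33; lra|].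
  have c0 : 0 <= c%:R :> R by [].
  by move: Hc; rewrite -addn4 natrD => Hc; nra.
have x4E : exists k : nat, x4 = 2 * k%:R - 7.
  exists (a + c)%N; rewrite natrD; lra.
have {x4E} [k x4E] := x4E.
have {}x4E : [\/ x4 = -3, x4 = -1, x4 = 1 | x4 = 3].
  move: k x4E => [|[|[|[|[|[|k]]]]]] x4E; [nra|nra|apply: Or41; lra|apply: Or42;
    lra|apply: Or43; lra|apply: Or44; lra|].
  have k0 : 0 <= k%:R :> R by [].
  by move: x4E; rewrite -addn1 -addn1 -addn4 !natrD => x4E; nra.
move: S2; rewrite S1 {S1 le_S2 Ha Hb Hc x7}.
case: x2E => ->; case: x3E => ->; case: x4E => ->; case=> E; try lra.
by split; lra.
Qed.

Lemma sum_complex (f : gT -> R) : (\sum_(y in G) f y)%:C%C = \sum_(y in G) (f y)%:C%C :> C.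
Proof. by rewrite raddf_sum. Qed.

Lemma sum_inv (A : zmodType) (f : gT -> A) :
  \sum_(y in G) f y^-1%g = \sum_(y in G) f y.
Proof.
rewrite [RHS](reindex_inj invg_inj) /=.
by apply: eq_bigl => y; rewrite groupV.
Qed.

Lemma irr_degree_neq1 (k : irrC R G) : irr_degree k != 1%N ->
  \sum_(y in G) \tr (irr_repr k y) = 0.
Proof.
move=> dk; rewrite sum_irr_character; case: eqP => [E|_]; last by rewrite mul0r.
by rewrite E degree_irr1 eqxx in dk.
Qed.

Lemma chi_values_7 : varrho1_is_7 iota ->
  [/\ chi (r 2) = -1, chi (r 3) = 1, chi (r 4) = -1 & chi (r 7) = 0].
Proof.
move=> [s7 d7 sim].
have trE y : y \in G -> (chi y)%:C%C = \tr (irr_repr s7 y).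
  by move=> Gy; rewrite -mxtrace_varrho1 (mxtrace_rsim sim).
apply: chi_values_norm1; apply: complexI; rewrite sum_complex.
  by rewrite (eq_bigr _ trE) irr_degree_neq1 // d7.
have <- : #|G|%:R = 168%:C%C :> C by rewrite cardG rmorph_nat.
rewrite -(character_norm1 (socle_irr s7)); apply: eq_bigr => y Gy.
by rewrite expr2 -{1}(chiV Gy) rmorphM /= !trE ?groupV.
Qed.

Lemma chi_values_133 : varrho1_is_1_3_3conj iota ->
  [/\ chi (r 2) = -1, chi (r 3) = 1, chi (r 4) = 3 & chi (r 7) = 0].
Proof.
move=> [s3 d3 sim].
pose t y := \tr (irr_repr s3 y).
pose s3c : mx_representation C G _ := map_repr (@conjc R) (irr_repr s3).
pose tc y := \tr (s3c y).
have trE y : y \in G -> (chi y)%:C%C = 1 + (t y + tc y).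
  move=> Gy; rewrite -mxtrace_varrho1 (mxtrace_rsim sim) // /dadd_grepr /=.
  rewrite !mxtrace_block; congr (_ + (_ + _)).
  exact: (mxtrace_irr_principal R Gy).
have tcE y : tc y = (t y)^*%C by rewrite /tc map_reprE trace_map_mx.
have irr3 : mx_irreducible (irr_repr s3) := socle_irr s3.
have irr3c : mx_irreducible s3c.
  apply: mx_abs_irrW; rewrite /s3c map_mx_abs_irr.
  exact: group_closure_closed_field.
have sum1 : \sum_(y in G) 1 = 168 :> C by rewrite sumr_const cardG.
have St : \sum_(y in G) t y = 0 by rewrite irr_degree_neq1 // d3.
have Stc : \sum_(y in G) tc y = 0.
  by under eq_bigr do rewrite tcE; rewrite -rmorph_sum St rmorph0.
have StV : \sum_(y in G) t y^-1%g = 0 by rewrite (sum_inv t).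
have StcV : \sum_(y in G) tc y^-1%g = 0 by rewrite (sum_inv tc).
have Stt : \sum_(y in G) t y^-1%g * t y = 168 by rewrite (character_norm1 irr3) cardG.
have Scc : \sum_(y in G) tc y^-1%g * tc y = 168 by rewrite (character_norm1 irr3c) cardG.
(* e tells whether Sigma_3 is isomorphic to its conjugate. *)
have [e Stc'] : exists e : bool, \sum_(y in G) t y^-1%g * tc y = 168 * e%:R.
  have [sim3|nsim] := boolP (`[< mx_rsim (irr_repr s3) s3c >]).
    exists true; rewrite mulr1 -Stt; apply: eq_bigr => y Gy; congr (_ * _).
    by rewrite /t /tc (mxtrace_rsim (asboolW sim3)).
  exists false; rewrite mulr0; apply: character_orthogonal => // sim3.
  by move/asboolPn: nsim; apply.
have Sct : \sum_(y in G) tc y^-1%g * t y = 168 * e%:R.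
  transitivity ((\sum_(y in G) t y^-1%g * tc y)^*%C).
    rewrite rmorph_sum; apply: eq_bigr => y _.
    by rewrite rmorphM /= !tcE conjcK.
  by rewrite Stc' rmorphM !rmorph_nat.
clearbody t tc.
apply: (@chi_values_norm3 e); apply: complexI; rewrite sum_complex.
  rewrite (eq_bigr _ trE) big_split big_split /= sum1 St Stc !addr0.
  by rewrite rmorph_nat.
transitivity (\sum_(y in G) (1 + t y + tc y + t y^-1%g + tc y^-1%g + t y^-1%g * t y
    + t y^-1%g * tc y + tc y^-1%g * t y + tc y^-1%g * tc y)).
  apply: eq_bigr => y Gy; rewrite expr2 -{1}(chiV Gy) rmorphM /= !trE ?groupV //; ring.
rewrite !big_split /= sum1 St Stc StV StcV Stt Scc Stc' Sct.
have -> : 168 * (3 + 2 * e%:R) = (168 * (3 + 2 * e))%:R :> R by rewrite natrM natrD natrM.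
by rewrite rmorph_nat natrM natrD natrM; ring.
Qed.

(** The two embeddings differ by the value [v] at elements of order 4. *)
Lemma moments_PSL27 (v : R) m n : (v = -1 \/ v = 3) ->
  [/\ chi (r 2) = -1, chi (r 3) = 1, chi (r 4) = v & chi (r 7) = 0] ->
  mckay_moment iota m n = (168^-1 * (7 ^+ m * 14 ^+ n + 21 * ((-1) ^+ m * (-2) ^+ n)
   + 56 * (1 ^+ m * (-1) ^+ n) + 42 * (v ^+ m * 2 ^+ n) + 48 * (0 ^+ m * 0 ^+ n)))%:C%C.
Proof.
move=> Hv [x2 x3 x4 x7]; rewrite mckay_class_moment class_momentE cardG.
pose psi y := (chi y ^+ 2 - chi (y ^+ 2)%g) / 2 - chi y.
have psiE y : y \in G -> \tr (varrho2 iota y) = (psi y)%:C%C.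
  exact: mxtrace_varrho2.
have psi_r k : k \in [:: 1; 2; 3; 4; 7]%N -> psi (r k) =
    (chi (r k) ^+ 2 - chi (r (code_sqr k))) / 2 - chi (r k).
  by move=> kk; rewrite /psi chi_sqr.
have psiJ y z : y \in G -> z \in G -> psi (y ^ z)%g = psi y.
  by move=> Gy Gz; rewrite /psi -conjXg !chiJ ?groupX.
have psiV y : y \in G -> psi y^-1%g = psi y.
  by move=> Gy; rewrite /psi expgVn !chiV ?groupX.
have p1 : psi (r 1) = 14 by rewrite psi_r // chi1E /=; field.
have p2 : psi (r 2) = -2 by rewrite psi_r //= x2 chi1E /=; field.
have p3 : psi (r 3) = -1 by rewrite psi_r //= x3; field.
have p4 : psi (r 4) = 2 by rewrite psi_r //= x4 x2; case: Hv => ->; field.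
have p7 : psi (r 7) = 0 by rewrite psi_r //= x7; field.
rewrite (eq_bigr (fun y => (chi y ^+ m * psi y ^+ n)%:C%C)) => [|y Gy]; last first.
  by rewrite mxtrace_varrho1 psiE // rmorphM !rmorphXn.
rewrite -sum_complex -[168%:R](rmorph_nat (real_complex R)) -fmorphV -rmorphM /=.
congr (_ * _)%:C%C; rewrite (r_sum (f := fun y => chi y ^+ m * psi y ^+ n)).
- by rewrite p1 p2 p3 p4 p7 x2 x3 x4 x7 chi1E -!(mulr_natl (_ * _)).
- by move=> y z Gy Gz; rewrite chiJ ?psiJ.
by move=> y Gy; rewrite chiV ?psiV.
Qed.

End CharacterValues.

Lemma mckay_moment_PSL27 (R : realType) (iota : G2_embedding R PSL27) (v : R) m n :
  varrho1_is_7 iota /\ v = -1 \/ varrho1_is_1_3_3conj iota /\ v = 3 ->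
  mckay_moment iota m n = (168^-1 * (7 ^+ m * 14 ^+ n + 21 * ((-1) ^+ m * (-2) ^+ n)
   + 56 * (1 ^+ m * (-1) ^+ n) + 42 * (v ^+ m * 2 ^+ n) + 48 * (0 ^+ m * 0 ^+ n)))%:C%C.
Proof.
have [r [[rin [r1 r4 r3] rsq rsum] card]] := PSL27_classes.
case=> [[h ->]|[h ->]].
  apply: (@moments_PSL27 R _ PSL27 iota r card r1 rsq rsum); first by left.
  exact: (chi_values_7 card rin r1 r4 r3 rsq rsum).
apply: (@moments_PSL27 R _ PSL27 iota r card r1 rsq rsum); first by right.
exact: (chi_values_133 card rin r1 r4 r3 rsq rsum).
Qed.

(** * Uniform measures on finite lists *)

Section Atoms.
Local Open Scope classical_set_scope.
Context d (T : measurableType d) (R : realType).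
Local Open Scope ereal_scope.

Section IntegralUniform.
Variables (s : seq T).
Implicit Type A : set T.

Lemma uniform_seqE A :
  uniform_seq R s A = ((size s)%:R^-1 * \sum_(x <- s) \1_A x)%R%:E.
Proof.
rewrite /uniform_seq /mscale /msum /= EFinM; congr (_ * _).
rewrite (big_nth point) big_mkord -sumEFin; apply: eq_bigr => i _.
by rewrite /dirac.
Qed.

Lemma uniform_seqT : (0 < size s)%N -> uniform_seq R s setT = 1.
Proof.
move=> s0; rewrite uniform_seqE; congr EFin.
under eq_bigr do rewrite indicT.
by rewrite big_tnth sumr_const card_ord mulVf // pnatr_eq0 -lt0n.
Qed.

Lemma ge0_integral_uniform_seq A (f : T -> R) : measurable A ->
  measurable_fun setT f -> (forall x, 0 <= f x)%R ->
  \int[uniform_seq R s]_(x in A) (f x)%:E =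
  ((size s)%:R^-1 * \sum_(x <- s) f x * \1_A x)%R%:E.
Proof.
move=> mA mf f0; have mfA : measurable_fun A (EFin \o f).
  by apply/measurable_EFinP; exact: measurable_funTS.
rewrite ge0_integral_mscale //; last by move=> x _; rewrite lee_fin.
rewrite ge0_integral_measure_sum //; last by move=> x _; rewrite lee_fin.
rewrite EFinM; congr (_ * _); rewrite (big_nth point) big_mkord -sumEFin.
apply: eq_bigr => i _; rewrite integral_dirac // /dirac -EFinM mulrC.
by [].
Qed.

Lemma integral_uniform_seq A (f : T -> R) : measurable A -> measurable_fun setT f ->
  \int[uniform_seq R s]_(x in A) (f x)%:E =
  ((size s)%:R^-1 * \sum_(x <- s) f x * \1_A x)%R%:E.
Proof.
move=> mA mf; rewrite integralE funerpos funerneg.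
have mfp : measurable_fun setT f^\+%R by exact: measurable_funrpos.
have mfn : measurable_fun setT f^\-%R by exact: measurable_funrneg.
rewrite !(ge0_integral_uniform_seq mA) //.
rewrite -EFinB -mulrBr -sumrB; congr (_ * _)%:E; apply: eq_bigr => x _.
by rewrite -mulrBl -[in RHS](funrposBneg f).
Qed.

End IntegralUniform.
End Atoms.

(** * The circle *)

Section CircleTheory.
Local Open Scope classical_set_scope.
Variable R : realType.
Local Notation C := R[i].
Implicit Types (z : circle R) (s t : R).

Lemma circle_inj z1 z2 : (z1 : C) = z2 -> z1 = z2.
Proof. exact: val_inj. Qed.

Lemma circle_norm z : complex.Re z ^+ 2 + complex.Im z ^+ 2 = 1.
Proof.
case: z => [[u v] /= /eqP]; rewrite normc_def /= => /complexI E.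
by rewrite -(sqr_sqrtr (_ : 0 <= u ^+ 2 + v ^+ 2)) ?E ?expr1n // addr_ge0 ?sqr_ge0.
Qed.

Lemma circle_neq0 z : (z : C) != 0.
Proof. by case: z => z /= /eqP E; rewrite -normr_eq0 E oner_eq0. Qed.

Lemma circle_conj z : (z : C)^-1 = ((z : C)^*)%C.
Proof.
apply: (mulfI (circle_neq0 z)); rewrite mulfV ?circle_neq0 //.
case: z (circle_norm z) => [[u v] /= _] E; simpc.
by rewrite -!expr2 E [v * u]mulrC addNr.
Qed.

Lemma cexpD s t : (cexp (s + t) : C) = (cexp s : C) * cexp t.
Proof.
rewrite /= mulrDr cosD sinD; simpc; congr (_ +i* _)%C.
by rewrite addrC.
Qed.

Lemma cexp0 : (cexp 0 : C) = 1.
Proof. by rewrite /= mulr0 cos0 sin0. Qed.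

Lemma cexp1 : (cexp 1 : C) = 1.
Proof. by rewrite /= mulr1 mulr_natl cos2pi sin2pi. Qed.

Lemma cexp_natmul t n : (cexp (n%:R * t) : C) = (cexp t : C) ^+ n.
Proof.
elim: n => [|n IHn]; first by rewrite mul0r cexp0.
by rewrite -natr1 mulrDl mul1r cexpD IHn exprSr.
Qed.

Lemma cexp_neq1 t : 0 < t < 1 -> (cexp t : C) != 1.
Proof.
move=> /andP[t0 t1]; apply/eqP => -[E _].
have : 0 < sin (pi * t).
  by apply: sin_gt0_pi; rewrite mulr_gt0 ?pi_gt0 //= gtr_pMr ?pi_gt0.
have : cos (2 * pi * t) = 1 - sin (pi * t) ^+ 2 *+ 2.
  rewrite (_ : 2 * pi * t = (pi * t) *+ 2); last by rewrite mulr2n; ring.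
  by rewrite cos_mulr2n cos2sin2 mulrnBl; ring.
rewrite E; nra.
Qed.

Lemma cexp_inj s t : 0 <= s < 1 -> 0 <= t < 1 -> cexp s = cexp t -> s = t.
Proof.
wlog le_st : s t / s <= t.
  by move=> H hs ht E; have [/H|/ltW/H] := leP s t; [exact|by move=> ->].
move=> /andP[s0 s1] /andP[t0 t1] E; apply/eqP; rewrite eq_le le_st /= leNgt.
apply/negP => lt_st; have /negP := @cexp_neq1 (t - s) ltac:(lra).
apply; apply/eqP/(mulIf (circle_neq0 (cexp s))).
by rewrite -cexpD subrK mul1r E.
Qed.

(** The arc cosine gives the angle on the upper half circle, and its complement to a
    full turn on the lower one. *)
Lemma cexp_surj z : exists t, 0 <= t < 1 /\ cexp t = z.
Proof.
have := circle_norm z; set u := complex.Re z; set v := complex.Im z => uv.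
have zE : (z : C) = (u +i* v)%C by rewrite /u /v; case: (z : C).
have u1 : -1 <= u <= 1 by nra.
have cu : cos (acos u) = u by rewrite acosK // in_itv.
have su : sin (acos u) = `|v|.
  by rewrite sin_acos // -sqrtr_sqr; congr Num.sqrt; lra.
have p0 : 0 < pi :> R by exact: pi_gt0.
have a0 : 0 <= acos u by exact: acos_ge0.
have a1 : acos u <= pi by exact: acos_lepi.
have [v0|v0] := leP 0 v.
  exists (acos u / (2 * pi)); split.
    by rewrite divr_ge0 //= ?ltr_pdivrMr ?mul1r; nra.
  apply: circle_inj; rewrite /= mulrC divfK ?zE; last by rewrite mulf_neq0 ?gt_eqF.
  by rewrite cu su ger0_norm.
have au0 : acos u != 0.
  apply: contraTneq v0 => E; move: su; rewrite E sin0 => /esym/eqP.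
  by rewrite normr_eq0 => /eqP ->; rewrite ltxx.
exists (1 - acos u / (2 * pi)); split.
  have : 0 < acos u / (2 * pi) by rewrite divr_gt0 ?mulr_gt0 // lt_def au0.
  have : acos u / (2 * pi) < 1 by rewrite ltr_pdivrMr ?mul1r; nra.
  by lra.
apply: circle_inj; rewrite /= mulrBr mulr1 [2 * pi * (_ / _)]mulrC divfK ?zE;
  last by rewrite mulf_neq0 ?gt_eqF.
rewrite mulr_natl cosB sinB cos2pi sin2pi !mul1r !mul0r addr0 sub0r cu su.
by rewrite ltr0_norm // opprK.
Qed.

Lemma angleP z : 0 <= angle z < 1 /\ cexp (angle z) = z.
Proof.
suff : [set t : R | 0 <= t < 1 /\ cexp t = z] (angle z) by [].
by apply: xgetPex; have [t ht] := cexp_surj z; exists t.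
Qed.

Lemma angle_cexp t : 0 <= t < 1 -> angle (cexp t) = t.
Proof. by move=> t01; have [a01 E] := angleP (cexp t); apply: cexp_inj. Qed.

(** ** Measurability *)

Lemma measurable_circle_coord : measurable_fun setT (@circle_coord R).
Proof. by move=> _ B mB; rewrite setTI; exists B; rewrite ?setTI. Qed.

Lemma measurable_Re : measurable_fun setT (fun z => complex.Re z : R).
Proof.
have := measurable_circle_coord.
move=> /(measurableT_comp (@measurable_fst _ _ _ _)); exact.
Qed.

Lemma measurable_Im : measurable_fun setT (fun z => complex.Im z : R).
Proof.
have := measurable_circle_coord.
move=> /(measurableT_comp (@measurable_snd _ _ _ _)); exact.
Qed.

Lemma measurable_circle1 z : measurable [set z].
Proof.
rewrite (_ : [set z] = ((fun z => complex.Re z : R) @^-1` [set complex.Re z]) `&`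
   ((fun z => complex.Im z : R) @^-1` [set complex.Im z])).
  apply: measurableI; rewrite -[X in measurable X]setTI.
    exact: (measurable_Re measurableT (measurable_set1 _)).
  exact: (measurable_Im measurableT (measurable_set1 _)).
apply/seteqP; split=> [x -> //|x [/= E1 E2]]; apply: circle_inj.
by case: (x : C) (z : C) E1 E2 => [a b] [c d] /= -> ->.
Qed.

Lemma measurable_torus1 (w : torus R) : measurable [set w].
Proof.
rewrite (_ : [set w] = [set w.1] `*` [set w.2]).
  by apply: measurableX; exact: measurable_circle1.
by apply/seteqP; split=> [x -> //|[x y] [/= -> ->]]; case: w.
Qed.

End CircleTheory.

(** * Measures with finitely supported moments *)

Section FiniteSupport.
Local Open Scope classical_set_scope.
Context d (T : measurableType d) (R : realType).

Definition bounded_measurable (f : T -> R) :=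
  measurable_fun setT f /\ exists M, forall x, `|f x| <= M.

Lemma bm_cst c : bounded_measurable (fun=> c).
Proof. by split; [exact: measurable_cst | exists `|c|]. Qed.

Lemma bmD f g : bounded_measurable f -> bounded_measurable g ->
  bounded_measurable (fun x => f x + g x).
Proof.
move=> [mf [M fM]] [mg [N gN]]; split; first exact: measurable_funD.
by exists (M + N) => x; rewrite (le_trans (ler_normD _ _)) // lerD.
Qed.

Lemma bmM f g : bounded_measurable f -> bounded_measurable g ->
  bounded_measurable (fun x => f x * g x).
Proof.
move=> [mf [M fM]] [mg [N gN]]; split; first exact: measurable_funM.
by exists (M * N) => x; rewrite normrM ler_pM.
Qed.

Lemma bmX f n : bounded_measurable f -> bounded_measurable (fun x => f x ^+ n).
Proof.
move=> bf; elim: n => [|n IHn]; first exact: (bm_cst 1).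
by under eq_fun do rewrite exprS; exact: bmM.
Qed.

Lemma bm_indic A : measurable A -> bounded_measurable (\1_A).
Proof.
move=> mA; split; first exact: measurable_indic.
by exists 1 => x; rewrite indicE; case: (_ \in _); rewrite ?normr0 ?normr1.
Qed.

Lemma measurable_neq f g : bounded_measurable f -> bounded_measurable g ->
  measurable [set x | f x != g x].
Proof.
move=> [mf _] [mg _].
rewrite (_ : [set _ | _] = ~` ((fun x => f x - g x) @^-1` [set 0])).
  by apply: measurableC; rewrite -[X in measurable X]setTI; apply: measurable_funB.
by apply/seteqP; split=> x /=; rewrite -subr_eq0 => /eqP.
Qed.

Variable mu : probability T R.

Lemma bm_integrable f : bounded_measurable f -> mu.-integrable setT (EFin \o f).
Proof.
move=> [mf [M fM]]; apply: measurable_bounded_integrable => //.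
  by apply: (@le_lt_trans _ _ 1%E); [exact: probability_le1 | exact: ltry].
by exists M; split; [exact: num_real | move=> N MN x _; exact: le_trans (fM x) (ltW MN)].
Qed.

Local Notation Int f := (Rintegral mu setT f).

Lemma Int_cst c : Int (fun=> c) = c.
Proof.
rewrite Rintegral_cst // (_ : fine _ = 1) ?mulr1 //.
by rewrite -[RHS]/(fine 1%E); congr fine; exact: probability_setT.
Qed.

Lemma Int_indic A : measurable A -> Int (\1_A) = fine (mu A).
Proof. by move=> mA; rewrite /Rintegral integral_indic // setIT. Qed.

Lemma IntD f g : bounded_measurable f -> bounded_measurable g ->
  Int (fun x => f x + g x) = Int f + Int g.
Proof. by move=> bf bg; apply: RintegralD => //; exact: bm_integrable. Qed.

Lemma IntZ c f : bounded_measurable f -> Int (fun x => c * f x) = c * Int f.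
Proof. by move=> bf; apply: RintegralZl => //; exact: bm_integrable. Qed.

Lemma Int0_ae f : bounded_measurable f -> (forall x, 0 <= f x) -> Int f = 0 ->
  mu [set x | f x != 0] = 0%E.
Proof.
move=> bf f0 If; have [mf _] := bf.
have intf := bm_integrable bf.
have : (\int[mu]_x `|(f x)%:E| = 0)%E.
  under eq_integral do rewrite gee0_abs ?lee_fin //.
  rewrite -[LHS]fineK; last exact: integrable_fin_num.
  by rewrite -[fine _]/(Int f) If.
move/(ae_eq_integral_abs _ measurableT (measurable_int _ intf)) => [N [mN N0 sub]].
apply/eqP; rewrite eq_le measure_ge0 andbT -N0 le_measure ?inE //.
  exact: (measurable_neq bf (bm_cst 0)).
by move=> x /= fx; apply: sub => /= /(_ I) [] /eqP; exact/negP.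
Qed.

Lemma Int_ae f g : bounded_measurable f -> bounded_measurable g ->
  mu [set x | f x != g x] = 0%E -> Int f = Int g.
Proof.
move=> bf bg fg; rewrite /Rintegral; congr fine.
have [mf _] := bf; have [mg _] := bg.
apply: ae_eq_integral => //; [exact/measurable_EFinP|exact/measurable_EFinP|].
exists [set x | f x != g x]; split=> //; first exact: measurable_neq.
by move=> x /=; apply: contra_not_neq => -> _.
Qed.

(** ** Polynomials in two functions *)

Variables X Y : T -> R.
Hypotheses (bX : bounded_measurable X) (bY : bounded_measurable Y).

Definition poly2 (f : R -> R -> R) := exists l : seq (R * nat * nat),
  forall x y, f x y = \sum_(c <- l) c.1.1 * (x ^+ c.1.2 * y ^+ c.2).

Lemma poly2_cst a : poly2 (fun _ _ => a).
Proof. by exists [:: (a, 0%N, 0%N)] => x y; rewrite big_seq1 !mulr1. Qed.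

Lemma poly2_x : poly2 (fun x _ => x).
Proof. by exists [:: (1, 1%N, 0%N)] => x y; rewrite big_seq1 /= expr1 mul1r mulr1. Qed.

Lemma poly2_y : poly2 (fun _ y => y).
Proof. by exists [:: (1, 0%N, 1%N)] => x y; rewrite big_seq1 /= expr1 !mul1r. Qed.

Lemma poly2D f g : poly2 f -> poly2 g -> poly2 (fun x y => f x y + g x y).
Proof. by move=> [l fl] [k gk]; exists (l ++ k) => x y; rewrite big_cat fl gk. Qed.

Lemma poly2M f g : poly2 f -> poly2 g -> poly2 (fun x y => f x y * g x y).
Proof.
move=> [l fl] [k gk].
exists [seq (c.1.1 * e.1.1, (c.1.2 + e.1.2)%N, (c.2 + e.2)%N) | c <- l, e <- k] => x y.
rewrite big_allpairs_dep /= fl gk mulr_suml; apply: eq_bigr => c _.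
rewrite mulr_sumr; apply: eq_bigr => e _ /=.
by rewrite !exprD; ring.
Qed.

Lemma bm_poly2 f : poly2 f -> bounded_measurable (fun x => f (X x) (Y x)).
Proof.
move=> [l fl]; under eq_fun do rewrite fl.
elim: l {fl} => [|c l IHl]; first by under eq_fun do rewrite big_nil; exact: bm_cst.
under eq_fun do rewrite big_cons; apply: bmD => //.
by apply: bmM; [exact: bm_cst | apply: bmM; exact: bmX].
Qed.

Variables (J : finType) (p s t : J -> R).
Hypothesis moments : forall m n,
  Int (fun x => X x ^+ m * Y x ^+ n) = \sum_j p j * (s j ^+ m * t j ^+ n).

Lemma Int_poly2 f : poly2 f ->
  Int (fun x => f (X x) (Y x)) = \sum_j p j * f (s j) (t j).
Proof.
move=> [l fl]; under eq_Rintegral do rewrite fl.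
under eq_bigr do rewrite fl.
elim: l {fl} => [|c l IHl].
  under eq_Rintegral do rewrite big_nil; rewrite Int_cst big1 // => j _.
  by rewrite big_nil mulr0.
under eq_Rintegral do rewrite big_cons.
have bc : bounded_measurable (fun x => X x ^+ c.1.2 * Y x ^+ c.2) by apply: bmM; exact: bmX.
rewrite IntD; [|by apply: bmM => //; exact: bm_cst|]; last first.
  by apply: (@bm_poly2 (fun x y => \sum_(c <- l) c.1.1 * (x ^+ c.1.2 * y ^+ c.2))); exists l.
rewrite IntZ // moments IHl mulr_sumr -big_split; apply: eq_bigr => j _ /=.
by rewrite big_cons; ring.
Qed.

Hypothesis distinct : forall i j, i != j -> (s i != s j) || (t i != t j).

Definition dist2 i (x y : R) : R := (x - s i) ^+ 2 + (y - t i) ^+ 2.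

Lemma dist2_eq0 i x y : (dist2 i x y == 0) = (x == s i) && (y == t i).
Proof. by rewrite paddr_eq0 ?sqr_ge0 // !sqrf_eq0 !subr_eq0. Qed.

Lemma poly2_dist2 i : poly2 (dist2 i).
Proof.
have px : poly2 (fun x _ => x - s i) by apply: poly2D; [exact: poly2_x|exact: poly2_cst].
have py : poly2 (fun _ y => y - t i) by apply: poly2D; [exact: poly2_y|exact: poly2_cst].
by apply: poly2D; [exact: (poly2M px px) | exact: (poly2M py py)].
Qed.

Lemma poly2_prod (P : pred J) : poly2 (fun x y => \prod_(i | P i) dist2 i x y).
Proof.
rewrite /index_enum; elim: (Finite.enum _) => [|i l IHl].
  by under eq_fun do under eq_fun do rewrite big_nil; exact: poly2_cst.
under eq_fun do under eq_fun do rewrite big_cons; case: (P i) => //.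
by apply: poly2M => //; exact: poly2_dist2.
Qed.

Definition fibre j := [set x | X x = s j /\ Y x = t j].

Lemma measurable_fibre j : measurable (fibre j).
Proof.
rewrite (_ : fibre j = (X @^-1` [set s j]) `&` (Y @^-1` [set t j])) //.
by apply: measurableI; rewrite -[X in measurable X]setTI; [apply: bX.1|apply: bY.1].
Qed.

(** Let L be the product of the squared distances to all points (s i, t i) but the j-th.
    The product of L with the last squared distance has integral 0, hence vanishes almost
    everywhere: L is almost everywhere L (s j) (t j) times the indicator of the fibre, and
    comparing integrals gives the mass of the fibre. *)
Lemma mu_fibre j : mu (fibre j) = (p j)%:E.
Proof.
pose full x y := \prod_i dist2 i x y.
pose L x y := \prod_(i | i != j) dist2 i x y.
have Lj0 : L (s j) (t j) != 0.
  apply/prodf_neq0 => i ij; rewrite dist2_eq0 negb_and.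
  by rewrite distinct // eq_sym.
have full0 : mu [set x | full (X x) (Y x) != 0] = 0%E.
  apply: Int0_ae; first exact/bm_poly2/poly2_prod.
    by move=> x; apply: prodr_ge0 => i _; rewrite addr_ge0 ?sqr_ge0.
  rewrite (Int_poly2 (poly2_prod _)) big1 // => i _.
  rewrite (bigD1 i) //= [dist2 _ _ _](_ : _ = 0) ?mul0r ?mulr0 //.
  by apply/eqP; rewrite dist2_eq0 !eqxx.
have IL : Int (fun x => L (X x) (Y x)) = L (s j) (t j) * p j.
  rewrite (Int_poly2 (poly2_prod _)) [LHS](bigD1 j) //= [Q in _ + Q]big1 ?addr0 => [|i ij];
    first exact: mulrC.
  rewrite (bigD1 i) //= [dist2 _ _ _](_ : _ = 0) ?mul0r ?mulr0 //.
  by apply/eqP; rewrite dist2_eq0 !eqxx.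
have mF := measurable_fibre j.
have : Int (fun x => L (X x) (Y x)) = Int (fun x => L (s j) (t j) * \1_(fibre j) x).
  apply: Int_ae; first exact/bm_poly2/poly2_prod.
    by apply: bmM; [exact: bm_cst | exact: bm_indic].
  apply: (subset_measure0 (B := [set x | full (X x) (Y x) != 0])) => //.
  - apply: measurable_neq; first exact/bm_poly2/poly2_prod.
    by apply: bmM; [exact: bm_cst | exact: bm_indic].
  - by apply: measurable_neq; [exact/bm_poly2/poly2_prod | exact: bm_cst].
  move=> x /=; apply: contraNneq => fx.
  rewrite indicE; have [/set_mem[-> ->]|nF] := boolP (x \in fibre j); first by rewrite mulr1.
  rewrite mulr0; move: fx; rewrite /full (bigD1 j) //= => /eqP.
  rewrite mulf_eq0 dist2_eq0 => /orP[/andP[/eqP E1 /eqP E2]|/eqP //].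
  by case/negP: nF; apply/mem_set.
rewrite IL IntZ; last exact: bm_indic.
rewrite Int_indic // => /(mulfI Lj0) E.
by rewrite -[mu _]fineK ?E // fin_num_measure.
Qed.

End FiniteSupport.

Section Atomic.
Local Open Scope classical_set_scope.
Context d (T : measurableType d) (R : realType).
Hypothesis mS : forall w : T, measurable [set w].
Variable mu : probability T R.
Local Notation m A := (fine (mu A)).

Lemma prob_fin A : measurable A -> mu A = (m A)%:E.
Proof. by move=> mA; rewrite fineK // fin_num_measure. Qed.

Lemma prob_remove A w : measurable A -> m A = \1_A w * m [set w] + m (A `\ w).
Proof.
move=> mA; have mAw : measurable (A `\ w) by apply: measurableD.
have mAI : measurable (A `&` [set w]) by apply: measurableI.
have /(congr1 fine) := measureDI mu mA (mS w).
rewrite fineD ?fin_num_measure // => ->; rewrite addrC; congr (_ + _).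
have [wA|nA] := boolP (w \in A).
  rewrite (_ : A `&` [set w] = [set w]) ?indicE ?wA ?mul1r //.
  by apply/setIidr => x ->; exact: set_mem.
rewrite (_ : A `&` [set w] = set0) ?measure0 ?indicE ?(negPf nA) ?mul0r //.
by rewrite -subset0 => x [/= Ax xw]; case/negP: nA; rewrite -xw; exact/mem_set.
Qed.

Lemma sum_atoms_le (l : seq T) A : uniq l -> measurable A ->
  \sum_(w <- l) \1_A w * m [set w] <= m A.
Proof.
elim: l A => [|w l IHl] A /=.
  by rewrite big_nil => _ mA; apply: fine_ge0; exact: measure_ge0.
move=> /andP[wl ul] mA; rewrite big_cons (prob_remove w mA) lerD2l.
apply: le_trans (IHl (A `\ w) ul _); last exact: measurableD.
rewrite le_eqVlt; apply/orP; left; apply/eqP; apply: eq_big_seq => x xl.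
congr (_ * _); rewrite !indicE; congr (_%:R); congr nat_of_bool.
apply/idP/idP => /set_mem; last by case=> Ax _; exact/mem_set.
move=> Ax; apply/mem_set; split=> //= xw.
by rewrite xw in xl; rewrite xl in wl.
Qed.

Lemma measure_seq (l : seq T) : uniq l -> m [set` l] = \sum_(w <- l) m [set w].
Proof.
elim: l => [|w l IHl] /=.
  by move=> _; rewrite big_nil (_ : [set` _] = set0) ?measure0 //; apply/seteqP; split.
move=> /andP[wl ul]; rewrite big_cons -IHl //.
have ml (s : seq T) : measurable [set` s].
  elim: s => [|x s IHs]; first by rewrite (_ : [set` _] = set0) //; apply/seteqP; split.
  rewrite (_ : [set` _] = [set x] `|` [set` s]); first exact: measurableU.
  apply/seteqP; split=> y /=; first by rewrite inE => /orP[/eqP|]; [left|right].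
  by rewrite inE => -[->|->]; rewrite ?eqxx ?orbT.
rewrite [LHS](prob_remove w (ml _)).
have -> : \1_[set` w :: l] w = 1 :> R by rewrite indicE mem_set //= mem_head.
rewrite mul1r; congr (_ + fine (mu _)).
apply/seteqP; split=> [x /= [xl xw]|x /= xl].
  by move: xl; rewrite inE => /orP[/eqP|].
split; first by rewrite inE xl orbT.
by move=> xw; rewrite xw in xl; rewrite xl in wl.
Qed.

(** The inequality [sum_atoms_le], applied to A and to its complement, adds up to an
    equality. *)
Lemma atoms_determine (l : seq T) (c : T -> R) : uniq l ->
  (forall w, w \in l -> m [set w] = c w) -> \sum_(w <- l) c w = 1 ->
  forall A, measurable A -> m A = \sum_(w <- l) c w * \1_A w.
Proof.
move=> ul mc c1; have E A : \sum_(w <- l) \1_A w * m [set w] = \sum_(w <- l) c w * \1_A w.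
  by apply: eq_big_seq => w wl; rewrite mc // mulrC.
move=> A mA; apply/eqP; rewrite eq_le -{2}E sum_atoms_le // andbT.
have := sum_atoms_le ul (measurableC mA); rewrite E probability_setC //.
rewrite (prob_fin mA) -EFinB /= lerBrDl => h.
rewrite -(lerD2r (\sum_(w <- l) c w * \1_(~` A) w)) (le_trans h) //.
rewrite -c1 -big_split le_eqVlt; apply/orP; left; apply/eqP; apply: eq_bigr => w _ /=.
rewrite -mulrDr !indicE in_setC; case: (w \in A); by rewrite ?addr0 ?add0r mulr1.
Qed.

End Atomic.

(** * Roots of unity of order 84 *)

Section RootsOfUnity.
Variable R : realType.
Local Notation C := R[i].

(** All the atoms have coordinates of order 1, 2, 3, 4 or 7, hence of order dividing 84;
    exponents modulo 84 make the orbits and grids computable.  Inverses are written with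
    the exponent 83 = -1 modulo 84. *)
Definition root84 (k : nat) : circle R := cexp (k%:R / 84).
Definition pt (q : nat * nat) : torus R := (root84 q.1, root84 q.2).

Lemma root84E k : (root84 k : C) = (root84 1 : C) ^+ k.
Proof. by rewrite /root84 -cexp_natmul mul1r. Qed.

Lemma prim_root84 : 84.-primitive_root (root84 1 : C).
Proof.
apply/andP; split=> //; apply/forallP => i; apply/eqP; rewrite unity_rootE -root84E.
have [->|ne] := eqVneq i.+1 84%N.
  by rewrite /root84 divff ?pnatr_eq0 // cexp1 eqxx.
apply/negbTE/cexp_neq1; rewrite divr_gt0 //= ltr_pdivrMr // mul1r ltr_nat.
by have := ltn_ord i; rewrite leq_eqVlt (negPf ne).
Qed.

Lemma root84_mod k : root84 (k %% 84) = root84 k.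
Proof. by apply: circle_inj; rewrite !(root84E (_ %% _)) (root84E k) prim_expr_mod //
  prim_root84. Qed.

Lemma root84_eq a b : (root84 a == root84 b) = (a == b %[mod 84]).
Proof.
rewrite -(eq_prim_root_expr prim_root84) -!root84E.
by apply/eqP/eqP => [->|/circle_inj].
Qed.

Lemma root84D a b : (root84 (a + b) : C) = (root84 a : C) * root84 b.
Proof. by rewrite !(root84E (_ + _)) exprD -!root84E. Qed.

Lemma root84V a : (root84 (83 * a) : C) = (root84 a : C)^-1.
Proof.
apply: (mulfI (circle_neq0 (root84 a))); rewrite mulfV ?circle_neq0 //.
by rewrite -root84D -mulSn root84E exprM (prim_expr_order prim_root84) expr1n.
Qed.

(** The roots of order n are the multiples of 84 / n. *)
Lemma root84_roots (z : circle R) n m : (n * m = 84)%N -> (z : C) ^+ n = 1 ->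
  exists2 a, (a < n)%N & z = root84 (m * a).
Proof.
move=> nm zn; have z84 : (z : C) ^+ 84 = 1 by rewrite -nm exprM zn expr1n.
have [i zE] := prim_rootP prim_root84 z84.
have : (root84 1 : C) ^+ (i * n) = 1 by rewrite exprM -zE.
have n0 : (0 < n)%N by case: n nm {zn}.
have lt_i := ltn_ord i; move: (i : nat) lt_i zE => {}i lt_i zE.
move/eqP; rewrite -(prim_order_dvd prim_root84) -nm [(i * n)%N]mulnC dvdn_pmul2l // => /dvdnP[a
  ia].
exists a.
  have m0 : (0 < m)%N by case: m nm {ia}; rewrite ?muln0.
  by rewrite -(ltn_pmul2r m0) -ia nm.
by apply: circle_inj; rewrite zE -root84E mulnC ia.
Qed.

Definition re84 (k : nat) : R := 2 * complex.Re (root84 k).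

Lemma complexD (a b : R) : (a + b)%:C%C = a%:C%C + b%:C%C :> C.
Proof. exact: rmorphD. Qed.

Lemma complexM (a b : R) : (a * b)%:C%C = a%:C%C * b%:C%C :> C.
Proof. exact: rmorphM. Qed.

Lemma Re_conj (z : C) : (z + z^*%C) = (2 * complex.Re z)%:C%C.
Proof.
case: z => a b; apply/eqP; rewrite eq_complex /=.
by apply/andP; split; apply/eqP; ring.
Qed.

Lemma re84E k : (re84 k)%:C%C = (root84 k : C) + (root84 k : C)^-1.
Proof. by rewrite circle_conj Re_conj. Qed.

Lemma re84_mod k : re84 (k %% 84) = re84 k.
Proof. by rewrite /re84 root84_mod. Qed.

Lemma re84_opp k : re84 (83 * k) = re84 k.
Proof. by apply: complexI; rewrite !re84E root84V invrK addrC. Qed.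

Lemma re84M a b : re84 a * re84 b = re84 (a + b) + re84 (a + 83 * b).
Proof.
apply: complexI; rewrite complexM complexD !re84E.
rewrite (root84D a b) (root84D a (83 * b)) root84V.
have := circle_neq0 (root84 b); have := circle_neq0 (root84 a).
move: (root84 a : C) (root84 b : C) => x y x0 y0.
by field; rewrite x0 y0.
Qed.

Lemma re84_0 : re84 0 = 2.
Proof. by rewrite /re84 /root84 mul0r cexp0 /= mulr1. Qed.

Lemma re84_lt k : (0 < k < 84)%N -> re84 k != 2.
Proof.
move=> k84; apply/eqP => E.
have Re1 : complex.Re (root84 k) = 1 by move: E; rewrite /re84; lra.
have Im0 : complex.Im (root84 k) = 0.
  by have := circle_norm (root84 k); rewrite Re1; nra.
have : root84 k = root84 0.
  apply: circle_inj; rewrite /root84 [in RHS]mul0r cexp0.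
  by move: Re1 Im0; rewrite /root84; case: (cexp _ : C) => a b /= -> ->.
move/eqP; rewrite root84_eq mod0n modn_small; last by case/andP: k84.
by case/andP: k84; case: k {E Re1 Im0}.
Qed.

Lemma re84_42 : re84 42 = -2.
Proof.
have := re84M 42 42; rewrite -[in RHS](re84_mod (42 + 42)) -[in RHS](re84_mod (42 + 83 * 42))
  /= re84_0.
have := @re84_lt 42 isT; move: (re84 42) => c c2 E.
have : (c - 2) * (c + 2) = 0 by lra.
by move/eqP; rewrite mulf_eq0 subr_eq0 (negPf c2) /= => /eqP; lra.
Qed.

Lemma re84_21 : re84 21 = 0.
Proof.
have := re84M 21 21; rewrite -[in RHS](re84_mod (21 + 21)) -[in RHS](re84_mod (21 + 83 * 21))
  /= re84_0 re84_42.
by rewrite addNr => /eqP; rewrite mulf_eq0 orbb => /eqP.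
Qed.

Lemma re84_63 : re84 63 = 0.
Proof. by rewrite -[63%N]/((83 * 21) %% 84)%N re84_mod re84_opp re84_21. Qed.

Lemma re84_56 : re84 56 = re84 28.
Proof. by rewrite -[56%N]/((83 * 28) %% 84)%N re84_mod re84_opp. Qed.

Lemma re84_28 : re84 28 = -1.
Proof.
have := re84M 28 28; rewrite -[in RHS](re84_mod (28 + 28)) -[in RHS](re84_mod (28 + 83 * 28))
  /= re84_0 re84_56.
have := @re84_lt 28 isT; move: (re84 28) => c c2 E.
have : (c - 2) * (c + 1) = 0 by lra.
by move/eqP; rewrite mulf_eq0 subr_eq0 (negPf c2) /= => /eqP; lra.
Qed.

Lemma re84_72 : re84 72 = re84 12.
Proof. by rewrite -[72%N]/((83 * 12) %% 84)%N re84_mod re84_opp. Qed.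
Lemma re84_60 : re84 60 = re84 24.
Proof. by rewrite -[60%N]/((83 * 24) %% 84)%N re84_mod re84_opp. Qed.
Lemma re84_48 : re84 48 = re84 36.
Proof. by rewrite -[48%N]/((83 * 36) %% 84)%N re84_mod re84_opp. Qed.

(** With [re84_prod7], the two symmetric functions of the real periods of order 7 that
    the characters involve. *)
Lemma re84_sum7 : re84 12 + re84 24 + re84 36 = -1.
Proof.
have x7 : (root84 12 : C) ^+ 7 = 1.
  by rewrite root84E -exprM (prim_expr_order prim_root84).
have x1 : (root84 12 : C) - 1 != 0.
  rewrite subr_eq0; apply: contra (@re84_lt 12 isT) => /eqP E.
  by rewrite /re84 E mulr1.
have xE k : (root84 (12 * k) : C) = (root84 12 : C) ^+ k by rewrite !(root84E (12 * k))
  (root84E 12) exprM.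
apply: complexI; rewrite !complexD !re84E -!root84V.
rewrite -[(83 * 12)%N]/(12 * 83)%N -[(83 * 24)%N]/(12 * 166)%N -[(83 * 36)%N]/(12 * 249)%N.
rewrite -[24%N]/(12 * 2)%N -[36%N]/(12 * 3)%N !xE.
rewrite -(expr_mod 83 x7) -(expr_mod 166 x7) -(expr_mod 249 x7).
rewrite -[(83 %% 7)%N]/6%N -[(166 %% 7)%N]/5%N -[(249 %% 7)%N]/4%N.
move: (root84 12 : C) x7 x1 {xE} => x x7 x1.
have S0 : 1 + x + x ^+ 2 + x ^+ 3 + x ^+ 4 + x ^+ 5 + x ^+ 6 = 0.
  apply: (mulfI x1); rewrite mulr0; transitivity (x ^+ 7 - 1); first by ring.
  by rewrite x7 subrr.
transitivity (1 + x + x ^+ 2 + x ^+ 3 + x ^+ 4 + x ^+ 5 + x ^+ 6 - 1); first by ring.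
by rewrite S0 sub0r rmorphN rmorph1.
Qed.

Lemma re84_prod7 : re84 12 * re84 24 + re84 24 * re84 36 + re84 12 * re84 36 = -2.
Proof.
have h := re84_sum7.
rewrite !re84M -(re84_mod (12 + 83 * 24)) -(re84_mod (24 + 83 * 36)) -(re84_mod (12 + 83 * 36))
  /=.
by rewrite !addnE /= re84_72 re84_60 re84_48; lra.
Qed.

End RootsOfUnity.

(** * Fibres of the two characters *)

Section Fibres.
Local Open Scope classical_set_scope.
Variable R : realType.
Local Notation C := R[i].
Implicit Type w : torus R.

(** The traces x + 1/x, y + 1/y and x/y + y/x: the sums over the three pairs of opposite
    short roots. *)
Definition tr1 w : R := 2 * complex.Re w.1.
Definition tr2 w : R := 2 * complex.Re w.2.
Definition tr3 w : R :=
  2 * (complex.Re w.1 * complex.Re w.2 + complex.Im w.1 * complex.Im w.2).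

Definition rchi1 w : R := 1 + (tr1 w + tr2 w + tr3 w).
Definition rchi2 w : R := 2 + (tr1 w * tr2 w + tr2 w * tr3 w + tr1 w * tr3 w).

Lemma tr1E w : (tr1 w)%:C%C = (w.1 : C) + (w.1 : C)^-1.
Proof. by rewrite circle_conj Re_conj. Qed.

Lemma tr2E w : (tr2 w)%:C%C = (w.2 : C) + (w.2 : C)^-1.
Proof. by rewrite circle_conj Re_conj. Qed.

Lemma tr3E w : (tr3 w)%:C%C = (w.1 : C) / (w.2 : C) + (w.1 : C)^-1 * (w.2 : C).
Proof.
rewrite !circle_conj /tr3; case: (w.1 : C) => a b; case: (w.2 : C) => c d.
by apply/eqP; rewrite eq_complex /=; apply/andP; split; apply/eqP; ring.
Qed.

Lemma chi1_real w : chi1 w = (rchi1 w)%:C%C.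
Proof.
rewrite /rchi1; move: (tr1E w) (tr2E w) (tr3E w).
move: (tr1 w) (tr2 w) (tr3 w) => a b c Ea Eb Ec.
rewrite (complexD 1 (a + b + c)) (complexD (a + b) c) (complexD a b) Ea Eb Ec rmorph1 /chi1; ring.
Qed.

Lemma chi2_real w : chi2 w = (rchi2 w)%:C%C.
Proof.
rewrite /rchi2 /chi2 /chi1; move: (tr1E w) (tr2E w) (tr3E w).
move: (tr1 w) (tr2 w) (tr3 w) => a b c Ea Eb Ec.
rewrite (complexD 2 (_ + _)) (complexD (a * b + b * c)) (complexD (a * b)).
rewrite !(complexM _ b, complexM _ c) Ea Eb Ec rmorph_nat.
have := circle_neq0 w.2; have := circle_neq0 w.1.
move: (w.1 : C) (w.2 : C) => x y x0 y0.
by field; rewrite x0 y0.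
Qed.

(** In terms of the traces a, b, c this is a b c = a^2 + b^2 + c^2 - 4, which holds for the
    traces of x, y and x/y. *)
Lemma tr_prod w : tr1 w * tr2 w * tr3 w =
  (rchi1 w - 1) ^+ 2 - 2 * (rchi2 w - 2) - 4.
Proof.
rewrite /rchi1 /rchi2 /tr1 /tr2 /tr3; have := circle_norm w.2; have := circle_norm w.1.
move: (complex.Re w.1 : R) (complex.Im w.1 : R) (complex.Re w.2 : R) (complex.Im w.2 : R).
move=> a b c d E1 E2; apply/eqP; rewrite -subr_eq0; apply/eqP.
transitivity (- 4 * ((1 - a ^+ 2) * (c ^+ 2 + d ^+ 2 - 1) + (a ^+ 2 + b ^+ 2 - 1) * d ^+ 2)).
  by ring.
by rewrite E1 E2 !subrr; ring.
Qed.

Lemma bm_coord (f : circle R -> R) : measurable_fun setT f ->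
  (forall z, `|f z| <= 1) ->
  bounded_measurable (fun w => f w.1) /\ bounded_measurable (fun w => f w.2).
Proof.
move=> mf f1; split; split; try by exists 1 => w.
  exact: (measurableT_comp mf (@measurable_fst _ _ _ _)).
exact: (measurableT_comp mf (@measurable_snd _ _ _ _)).
Qed.

Lemma bm_tr : [/\ bounded_measurable tr1, bounded_measurable tr2 & bounded_measurable tr3].
Proof.
have [re1 re2] := bm_coord (@measurable_Re R)
  (fun z => ltac:(have := circle_norm z; rewrite ler_norml; nra)).
have [im1 im2] := bm_coord (@measurable_Im R)
  (fun z => ltac:(have := circle_norm z; rewrite ler_norml; nra)).
split; apply: bmM => //; try exact: bm_cst.
by apply: bmD; apply: bmM.
Qed.

Lemma bm_rchi1 : bounded_measurable rchi1.
Proof.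
have [b1 b2 b3] := bm_tr; apply: bmD; first exact: bm_cst.
by apply: bmD => //; apply: bmD.
Qed.

Lemma bm_rchi2 : bounded_measurable rchi2.
Proof.
have [b1 b2 b3] := bm_tr; apply: bmD; first exact: bm_cst.
by apply: bmD; [apply: bmD|]; apply: bmM.
Qed.

Lemma tr1_pt q : tr1 (pt R q) = re84 R q.1.
Proof. by []. Qed.

Lemma tr2_pt q : tr2 (pt R q) = re84 R q.2.
Proof. by []. Qed.

Lemma tr3_pt q : tr3 (pt R q) = re84 R ((q.1 + 83 * q.2) %% 84).
Proof.
apply: (@complexI R); rewrite re84_mod re84E tr3E root84D root84V /=.
by rewrite invfM invrK.
Qed.

Lemma pt_of_roots w n m : (n * m = 84)%N ->
  (w.1 : C) ^+ n = 1 -> (w.2 : C) ^+ n = 1 ->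
  exists2 a, (a < n)%N & exists2 b, (b < n)%N & w = pt R (m * a, m * b)%N.
Proof.
case: w => x y /= nm xn yn.
have [a an ->] := root84_roots nm xn; have [b bn ->] := root84_roots nm yn.
by exists a => //; exists b.
Qed.

Lemma tr_cubic w c : c = tr1 w \/ c = tr2 w \/ c = tr3 w ->
  c ^+ 3 - (rchi1 w - 1) * c ^+ 2 + (rchi2 w - 2) * c
  - ((rchi1 w - 1) ^+ 2 - 2 * (rchi2 w - 2) - 4) = 0.
Proof.
rewrite -tr_prod /rchi1 /rchi2; move: (tr1 w) (tr2 w) (tr3 w) => x y z.
by case=> [->|[->|->]]; ring.
Qed.

(** If z + 1/z = c then z is a root of z^2 - c z + 1; the cubic of the last case is the
    minimal polynomial of 2 cos (2 pi / 7). *)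
Lemma root_of_trace (z : circle R) (c : R) : c%:C%C = (z : C) + (z : C)^-1 ->
  [/\ c = 2 -> (z : C) = 1, c = -2 -> (z : C) = -1, c = 0 -> (z : C) ^+ 2 = -1,
      c = -1 -> (z : C) ^+ 3 = 1
    & c ^+ 3 + c ^+ 2 - 2 * c - 1 = 0 -> (z : C) ^+ 7 = 1].
Proof.
have := circle_neq0 z; move: (z : C) => {}z z0 cE.
have E : z ^+ 2 = c%:C%C * z - 1 by rewrite cE; field.
split=> h.
- have : (z - 1) ^+ 2 = 0.
    by transitivity (z ^+ 2 - 2 * z + 1); [ring | rewrite E h rmorph_nat; ring].
  by move/eqP; rewrite sqrf_eq0 subr_eq0 => /eqP.
- have : (z + 1) ^+ 2 = 0.
    by transitivity (z ^+ 2 + 2 * z + 1); [ring | rewrite E h rmorphN rmorph_nat; ring].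
  by move/eqP; rewrite sqrf_eq0 addr_eq0 => /eqP.
- by rewrite E h mul0r sub0r.
- transitivity (z * z ^+ 2); first by ring.
  rewrite E h rmorphN rmorph1; transitivity (- z ^+ 2 - z); first by ring.
  by rewrite E h rmorphN rmorph1; ring.
have cE2 : (c ^+ 3 + c ^+ 2 - 2 * c - 1)%:C%C = c%:C%C ^+ 3 + c%:C%C ^+ 2 - 2 * c%:C%C - 1.
  by rewrite !rmorphB rmorphD !rmorphXn rmorphM rmorph_nat rmorph1.
have S0 : 1 + z + z ^+ 2 + z ^+ 3 + z ^+ 4 + z ^+ 5 + z ^+ 6 = 0.
  transitivity (z ^+ 3 * (c ^+ 3 + c ^+ 2 - 2 * c - 1)%:C%C).
    by rewrite cE2 cE; field.
  by rewrite h mulr0.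
apply/eqP; rewrite -subr_eq0; apply/eqP.
transitivity ((z - 1) * (1 + z + z ^+ 2 + z ^+ 3 + z ^+ 4 + z ^+ 5 + z ^+ 6)); first by ring.
by rewrite S0 mulr0.
Qed.

(** The Weyl orbits of the atoms, as exponents of 84th roots of unity and numbered by the
    orders of the elements of PSL(2;7) at which (chi1, chi2) has the same value.  The two
    orbits of order 4 belong to the two embeddings. *)
Definition orbit1 : seq (nat * nat) := [:: (0, 0)]%N.
Definition orbit2 : seq (nat * nat) := [:: (0, 42); (42, 0); (42, 42)]%N.
Definition orbit3 : seq (nat * nat) :=
  [:: (0, 28); (0, 56); (28, 0); (28, 28); (56, 0); (56, 56)]%N.
Definition orbit4 (trace3 : bool) : seq (nat * nat) :=
  if trace3 then [:: (0, 21); (0, 63); (21, 0); (21, 21); (63, 0); (63, 63)]%N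
  else [:: (21, 42); (21, 63); (42, 21); (42, 63); (63, 21); (63, 42)]%N.
Definition orbit7 : seq (nat * nat) :=
  [:: (12, 36); (12, 60); (24, 36); (24, 72); (36, 12); (36, 24); (48, 60);
      (48, 72); (60, 12); (60, 48); (72, 24); (72, 48)]%N.

Lemma traces_root w (P : R -> Prop) :
  (forall c, c ^+ 3 - (rchi1 w - 1) * c ^+ 2 + (rchi2 w - 2) * c
    - ((rchi1 w - 1) ^+ 2 - 2 * (rchi2 w - 2) - 4) = 0 -> P c) ->
  [/\ P (tr1 w), P (tr2 w) & P (tr3 w)].
Proof. by move=> H; split; apply/H/tr_cubic; [left|right; left|right; right]. Qed.

Lemma mulf_eq0_or (a b : R) : a * b = 0 -> a = 0 \/ b = 0.
Proof. by move/eqP; rewrite mulf_eq0 => /orP[] /eqP; [left|right]. Qed.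

(** In the first four cases the cubic of [tr_cubic] factors over the integers.  Its roots
    give the orders of the coordinates, and a search over the remaining points discards
    those with another value of (chi1, chi2). *)
Lemma fibre1 w : rchi1 w = 7 -> rchi2 w = 14 -> exists2 q, q \in orbit1 & w = pt R q.
Proof.
move=> X Y; have [] := @traces_root w (fun c => c = 2).
  move=> c; rewrite X Y => E.
  have : (c - 2) ^+ 3 = 0 by rewrite -E; ring.
  by move/eqP; rewrite expf_eq0 subr_eq0 => /eqP.
have [x1 _ _ _ _] := root_of_trace (tr1E w).
have [y1 _ _ _ _] := root_of_trace (tr2E w).
move=> /x1 {}x1 /y1 {}y1 _.
exists (0, 0)%N => //; rewrite [LHS]surjective_pairing; congr pair; apply: circle_inj.
  by rewrite root84E expr0.
by rewrite root84E expr0.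
Qed.

Lemma fibre2 w : rchi1 w = -1 -> rchi2 w = -2 -> exists2 q, q \in orbit2 & w = pt R q.
Proof.
move=> X Y; have [] := @traces_root w (fun c => c = 2 \/ c = -2).
  move=> c; rewrite X Y => E.
  have : (c - 2) * (c + 2) ^+ 2 = 0 by rewrite -E; ring.
  by move=> /mulf_eq0_or[|/mulf_eq0_or[]]; lra.
have unit (z : circle R) c : c%:C%C = (z : C) + (z : C)^-1 -> c = 2 \/ c = -2 -> (z : C) ^+ 2 = 1.
  by move=> /root_of_trace[h1 h2 _ _ _] [/h1|/h2] ->; rewrite ?sqrrN expr1n.
move=> /(unit _ _ (tr1E w)) x1 /(unit _ _ (tr2E w)) y1 _.
have [a la [b lb E]] := @pt_of_roots w 2 42 erefl x1 y1.
subst w; move: X; rewrite /rchi1 tr1_pt tr2_pt tr3_pt.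
case: a la {x1 y1 Y} => [|[|//]] _; case: b lb => [|[|//]] _; last 3 first.
- by exists (0, 42)%N.
- by exists (42, 0)%N.
- by exists (42, 42)%N.
by rewrite !re84_0; lra.
Qed.

Lemma fibre3 w : rchi1 w = 1 -> rchi2 w = -1 -> exists2 q, q \in orbit3 & w = pt R q.
Proof.
move=> X Y; have [] := @traces_root w (fun c => c = 2 \/ c = -1).
  move=> c; rewrite X Y => E.
  have : (c - 2) * (c + 1) ^+ 2 = 0 by rewrite -E; ring.
  by move=> /mulf_eq0_or[|/mulf_eq0_or[]]; lra.
have unit (z : circle R) c : c%:C%C = (z : C) + (z : C)^-1 -> c = 2 \/ c = -1 -> (z : C) ^+ 3 = 1.
  by move=> /root_of_trace[h1 _ _ h2 _] [/h1 ->|/h2//]; rewrite expr1n.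
move=> /(unit _ _ (tr1E w)) x1 /(unit _ _ (tr2E w)) y1 _.
have [a la [b lb E]] := @pt_of_roots w 3 28 erefl x1 y1.
exists (28 * a, 28 * b)%N => //.
subst w; move: X; rewrite /rchi1 tr1_pt tr2_pt tr3_pt.
case: a la {x1 y1 Y} => [|[|[|//]]] _; case: b lb => [|[|[|//]]] _ //=;
  by rewrite ?(re84_0, re84_56, re84_28) /= ?(re84_0, re84_56, re84_28); lra.
Qed.

Lemma fibre4 (b : bool) w : rchi1 w = (if b then 3 else -1) -> rchi2 w = 2 ->
  exists2 q, q \in orbit4 b & w = pt R q.
Proof.
move=> X Y; have [] := @traces_root w (fun c => c = 0 \/ c = 2 \/ c = -2).
  move=> c; rewrite X Y => E.
  have : c ^+ 2 * ((c - 2) * (c + 2)) = 0.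
    have := congr1 ( *%R (if b then c + 2 else c - 2)) E.
    by rewrite mulr0 => <-; case: (b); ring.
  by move=> /mulf_eq0_or[/eqP|/mulf_eq0_or[]]; rewrite ?sqrf_eq0;
    [move/eqP; left|right; left; lra|right; right; lra].
have unit (z : circle R) c : c%:C%C = (z : C) + (z : C)^-1 -> c = 0 \/ c = 2 \/ c = -2 ->
    (z : C) ^+ 4 = 1.
  rewrite -[4%N]/(2 * 2)%N exprM => /root_of_trace[h1 h2 h3 _ _].
  by move=> [/h3|[/h1|/h2]] ->; rewrite !(sqrrN, expr1n).
move=> /(unit _ _ (tr1E w)) x1 /(unit _ _ (tr2E w)) y1 _.
have [n la [m lb E]] := @pt_of_roots w 4 21 erefl x1 y1.
exists (21 * n, 21 * m)%N => //.
subst w; move: X Y; rewrite /rchi1 /rchi2 tr1_pt tr2_pt tr3_pt.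
case: b; case: n la {x1 y1} => [|[|[|[|//]]]] _; case: m lb => [|[|[|[|//]]]] _ //=;
  rewrite ?(re84_0, re84_21, re84_42, re84_63) /=; lra.
Qed.

(** Besides being roots of one cubic the three traces are distinct: two equal ones would
    also be a root of its derivative, which is coprime to it. *)
Lemma fibre7 w : rchi1 w = 0 -> rchi2 w = 0 -> exists2 q, q \in orbit7 & w = pt R q.
Proof.
move=> X Y; have [] := @traces_root w (fun c => c ^+ 3 + c ^+ 2 - 2 * c - 1 = 0).
  by move=> c; rewrite X Y => E; rewrite -E; ring.
have unit (z : circle R) c : c%:C%C = (z : C) + (z : C)^-1 ->
    c ^+ 3 + c ^+ 2 - 2 * c - 1 = 0 -> (z : C) ^+ 7 = 1.
  by move=> /root_of_trace[].
move=> E1 E2 E3; have {}x1 := unit _ _ (tr1E w) E1.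
have {}y1 := unit _ _ (tr2E w) E2.
have [n la [m lb E]] := @pt_of_roots w 7 12 erefl x1 y1.
(* With a = b the two symmetric functions give 3 a^2 + 2 a - 2 = 0, the derivative. *)
have ne (a b c : R) : a + b + c = -1 -> a * b + b * c + a * c = -2 ->
    a ^+ 3 + a ^+ 2 - 2 * a - 1 = 0 -> a != b.
  move=> S P Q; apply/eqP => ab; subst b.
  have cE : c = -1 - 2 * a by lra.
  have D : 3 * a ^+ 2 + 2 * a - 2 = 0 by move: P; rewrite cE; nra.
  have : 14 * a + 7 = 0.
    transitivity ((3 * a + 1) * (3 * a ^+ 2 + 2 * a - 2) - 9 * (a ^+ 3 + a ^+ 2 - 2 * a - 1));
      last by rewrite D Q; ring.
    by ring.
  by nra.
exists (12 * n, 12 * m)%N => //.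
move: X Y E1 E2 E3; rewrite /rchi1 /rchi2 => X Y E1 E2 E3.
have n12 : tr1 w != tr2 w by apply: (ne _ _ (tr3 w)) => //; lra.
have n23 : tr2 w != tr3 w by apply: (ne _ _ (tr1 w)) => //; lra.
have n13 : tr1 w != tr3 w by apply: (ne _ _ (tr2 w)) => //; lra.
have ne2 a : a ^+ 3 + a ^+ 2 - 2 * a - 1 = 0 -> a != 2 :> R.
  by move=> Ha; apply/eqP => a2; move: Ha; rewrite a2; lra.
move/ne2: E1 => E1; move/ne2: E2 => E2; move/ne2: E3 => E3.
move: n12 n23 n13 E1 E2 E3; subst w; rewrite tr1_pt tr2_pt tr3_pt {x1 y1 X Y}.
case: n la => [|[|[|[|[|[|[|//]]]]]]] _; case: m lb => [|[|[|[|[|[|[|//]]]]]]] _ //=;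
  by rewrite ?(re84_0, re84_72, re84_60, re84_48) ?eqxx.
Qed.

Lemma rchi_orbit1 q : q \in orbit1 -> rchi1 (pt R q) = 7 /\ rchi2 (pt R q) = 14.
Proof.
rewrite /rchi1 /rchi2 tr1_pt tr2_pt tr3_pt; case: q => a b; rewrite inE => /eqP[-> ->] /=.
by rewrite re84_0; split; ring.
Qed.

Lemma rchi_orbit2 q : q \in orbit2 -> rchi1 (pt R q) = -1 /\ rchi2 (pt R q) = -2.
Proof.
rewrite /rchi1 /rchi2 tr1_pt tr2_pt tr3_pt; case: q => a b; rewrite !inE.
by case/or3P=> /eqP[-> ->] /=; rewrite ?(re84_0, re84_42); split; lra.
Qed.

Lemma rchi_orbit3 q : q \in orbit3 -> rchi1 (pt R q) = 1 /\ rchi2 (pt R q) = -1.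
Proof.
rewrite /rchi1 /rchi2 tr1_pt tr2_pt tr3_pt; case: q => a b; rewrite !inE.
by do ![case/orP]; move=> /eqP[-> ->] /=; rewrite ?re84_56 ?(re84_0, re84_28); split; lra.
Qed.

Lemma rchi_orbit4 (b : bool) q : q \in orbit4 b ->
  rchi1 (pt R q) = (if b then 3 else -1) /\ rchi2 (pt R q) = 2.
Proof.
rewrite /rchi1 /rchi2 tr1_pt tr2_pt tr3_pt; case: q => n m; case: b; rewrite !inE.
  by do ![case/orP]; move=> /eqP[-> ->] /=; rewrite ?(re84_0, re84_21, re84_42, re84_63);
    split; lra.
by do ![case/orP]; move=> /eqP[-> ->] /=; rewrite ?(re84_0, re84_21, re84_42, re84_63);
  split; lra.
Qed.

Lemma rchi_orbit7 q : q \in orbit7 -> rchi1 (pt R q) = 0 /\ rchi2 (pt R q) = 0.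
Proof.
have S := re84_sum7 R; have P := re84_prod7 R.
rewrite /rchi1 /rchi2 tr1_pt tr2_pt tr3_pt; case: q => n m; rewrite !inE.
by do ![case/orP]; move=> /eqP[-> ->] /=; rewrite ?(re84_72, re84_60, re84_48); split; lra.
Qed.

End Fibres.

(** * The Weyl group *)

Section Weyl.
Local Open Scope classical_set_scope.
Variable R : realType.
Local Notation C := R[i].
Implicit Types (w : torus R) (S T : 'M[int]_2).

Lemma torus_actM S T w : torus_act (S *m T) w = torus_act S (torus_act T w).
Proof.
have x0 := circle_neq0 w.1; have y0 := circle_neq0 w.2.
have E (a b c d e f : int) : (monomial w (a * c + b * e) (a * d + b * f) : C) =
    (monomial w c d : C) ^ a * (monomial w e f : C) ^ b.
  by rewrite /= !expfzMl !exprz_exp !expfzDr // mulrACA [c * a]mulrC [d * a]mulrC [e * b]mulrC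
    [f * b]mulrC.
have M i j : (S *m T) i j = S i 0 * T 0 j + S i 1 * T 1 j.
  by rewrite mxE !big_ord_recl big_ord0 addr0; congr (_ + S i _ * T _ j); apply/val_inj.
by rewrite /torus_act; congr pair; apply: circle_inj; rewrite !M E.
Qed.

Lemma torus_act1 w : torus_act 1%:M w = w.
Proof.
case: w => x y; rewrite /torus_act; congr pair; apply: circle_inj;
  by rewrite /= !mxE /= expr0z expr1z ?mulr1 ?mul1r.
Qed.

Lemma mx2_unit (a b c d a' b' c' d' : int) :
  a * a' + b * c' = 1 -> a * b' + b * d' = 0 ->
  c * a' + d * c' = 0 -> c * b' + d * d' = 1 -> mx2 a b c d \in unitmx.
Proof.
move=> E1 E2 E3 E4; suff : mx2 a b c d *m mx2 a' b' c' d' = 1%:M by case/mulmx1_unit.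
apply/matrixP => i j; rewrite !mxE !big_ord_recl big_ord0 !mxE /= addr0.
by case: i j => [[|[|//]] Hi] [[|[|//]] Hj] /=.
Qed.

Lemma D12_unit T : D12 T -> T \in unitmx.
Proof.
elim=> [||||{}T _]; first exact: (@mx2_unit _ _ _ _ 0 (-1) (-1) 0).
- exact: (@mx2_unit _ _ _ _ 1 (-1) 1 0).
- exact: unitmx1.
- by move=> S {}T _ uS _ uT; rewrite unitmx_mul uS.
by rewrite unitmx_inv.
Qed.

Lemma torus_actK T : T \in unitmx -> cancel (@torus_act R T) (torus_act (invmx T)).
Proof. by move=> uT w; rewrite -torus_actM mulVmx // torus_act1. Qed.

(** Quantifying over all sets makes the two assumptions stable under preimages by the
    action, hence under products and inverses. *)
Lemma D12_invariant_gen (eps : set (torus R) -> \bar R) :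
  (forall A, eps (torus_act (mx2 0 (-1) (-1) 0) @^-1` A) = eps A) ->
  (forall A, eps (torus_act (mx2 0 1 (-1) 1) @^-1` A) = eps A) ->
  D12_invariant eps.
Proof.
move=> H2 H6 T A DT _; elim: DT A => [|||S {}T _ IHS _ IHT|{}T DT IHT] A //.
- by congr eps; apply/seteqP; split=> w /=; rewrite torus_act1.
- rewrite -[RHS]IHS -[RHS]IHT; congr eps.
  by apply/seteqP; split=> w /=; rewrite torus_actM.
rewrite -[LHS]IHT; congr eps; apply/seteqP; split=> w /=;
  by rewrite torus_actK ?D12_unit.
Qed.

Lemma D12_invariant_set1 (eps : set (torus R) -> \bar R) T w : D12_invariant eps ->
  D12 T -> eps [set torus_act T w] = eps [set w].
Proof.
move=> inv DT; rewrite -(inv _ _ DT (measurable_torus1 _)); congr eps.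
apply/seteqP; split=> [v /=|v ->//].
exact: (can_inj (torus_actK (D12_unit DT))).
Qed.

Definition refl84 (q : nat * nat) := ((83 * q.2) %% 84, (83 * q.1) %% 84)%N.
Definition rot84 (q : nat * nat) := (q.2, (83 * q.1 + q.2) %% 84)%N.

Lemma pt_refl84 q : pt R (refl84 q) = torus_act (mx2 0 (-1) (-1) 0) (pt R q).
Proof.
congr pair; apply: circle_inj; rewrite root84_mod root84V [RHS]/= !mxE [RHS]/=.
  by rewrite expr0z mul1r.
by rewrite expr0z mulr1.
Qed.

Lemma pt_rot84 q : pt R (rot84 q) = torus_act (mx2 0 1 (-1) 1) (pt R q).
Proof.
congr pair; apply: circle_inj; rewrite ?root84_mod [RHS]/= !mxE [RHS]/=.
  by rewrite expr0z expr1z mul1r.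
by rewrite (root84D R (83 * q.1)) root84V expr1z.
Qed.

Lemma pt_inj_in : {in [pred q : nat * nat | (q.1 < 84) && (q.2 < 84)]%N &, injective (pt R)}.
Proof.
move=> [a b] [c d]; rewrite !inE /= => /andP[a1 b1] /andP[c1 d1] /pair_equal_spec[/= /eqP E1
  /eqP E2].
by move: E1 E2; rewrite !root84_eq !modn_small // => /eqP -> /eqP ->.
Qed.

Lemma uniq_map_pt (l : seq (nat * nat)) : uniq l ->
  all [pred q | (q.1 < 84) && (q.2 < 84)]%N l -> uniq (map (pt R) l).
Proof.
move=> ul /allP al; rewrite map_inj_in_uniq // => x y /al xl /al yl.
exact: pt_inj_in.
Qed.

End Weyl.

(** * The measure carried by five orbits *)

Section AtomicMeasure.
Local Open Scope classical_set_scope.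
Variables (R : realType) (b : bool).
Local Notation C := R[i].
Implicit Type w : torus R.

Definition orbits : seq (seq (nat * nat)) := [:: orbit1; orbit2; orbit3; orbit4 b; orbit7].
Definition orb (j : 'I_5) := nth [::] orbits j.
(** The proportion of the elements of each code in PSL(2;7). *)
Definition mass (j : 'I_5) : R := nth 0 [:: 1; 21; 56; 42; 48] j / 168.
Definition val1 (j : 'I_5) : R := nth 0 [:: 7; -1; 1; if b then 3 else -1; 0] j.
Definition val2 (j : 'I_5) : R := nth 0 [:: 14; -2; -1; 2; 0] j.

(** The least common denominator of the atom masses is 504: an atom of mass c / 504 is
    listed c times, so that the uniform measure on the list has the right masses. *)
Definition support504 : seq (nat * nat) :=
  flatten [seq flatten (nseq c.1 c.2) | c <- zip [:: 3; 21; 28; 21; 12]%N orbits].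

Definition eps : set (torus R) -> \bar R := uniform_seq R (map (pt R) support504).
HB.instance Definition _ := FiniteMeasure.on eps.

Lemma size_support504 : size support504 = 504%N.
Proof. by rewrite /support504 /orbits; case: b. Qed.

Lemma eps_setT : eps setT = 1%E.
Proof. by apply: uniform_seqT; rewrite size_map size_support504. Qed.
HB.instance Definition _ := Measure_isProbability.Build _ _ R eps eps_setT.

Lemma big_ord5 (F : 'I_5 -> R) : \sum_j F j =
  F (inord 0) + F (inord 1) + F (inord 2) + F (inord 3) + F (inord 4).
Proof.
rewrite !big_ord_recl big_ord0 addr0 !addrA.
by congr (F _ + F _ + F _ + F _ + F _); apply/val_inj; rewrite /= inordK.
Qed.

Lemma sum_support504 (f : nat * nat -> R) :
  504^-1 * \sum_(q <- support504) f q =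
  \sum_j mass j / (size (orb j))%:R * \sum_(q <- orb j) f q.
Proof.
have sum_nseq n (l : seq (nat * nat)) :
    \sum_(q <- flatten (nseq n l)) f q = n%:R * \sum_(q <- l) f q.
  elim: n => [|n IHn]; first by rewrite big_nil mul0r.
  by rewrite /= big_cat /= IHn -natr1; ring.
have H l1 l2 l3 l4 l5 : \sum_(q <- flatten [seq flatten (nseq c.1 c.2) |
      c <- zip [:: 3; 21; 28; 21; 12]%N [:: l1; l2; l3; l4; l5]]) f q =
    3 * (\sum_(q <- l1) f q) + 21 * (\sum_(q <- l2) f q) + 28 * (\sum_(q <- l3) f q)
    + 21 * (\sum_(q <- l4) f q) + 12 * (\sum_(q <- l5) f q).
  by rewrite big_flatten big_map !big_cons big_nil !sum_nseq /= addr0 !addrA.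
rewrite H big_ord5 /orb /mass !inordK //.
rewrite -[nth [::] orbits 0]/orbit1 -[nth [::] orbits 1]/orbit2 -[nth [::] orbits 2]/orbit3.
rewrite -[nth [::] orbits 3]/(orbit4 b) -[nth [::] orbits 4]/orbit7.
rewrite -[size orbit1]/1%N -[size orbit2]/3%N -[size orbit3]/6%N -[size orbit7]/12%N.
have -> : size (orbit4 b) = 6%N by case: (b).
move: (\sum_(q <- orbit1) _) (\sum_(q <- orbit2) _) (\sum_(q <- orbit3) _) (\sum_(q <- orbit4
  b) _) (\sum_(q <- orbit7) _) => s1 s2 s3 s4 s7 /=.
by field.
Qed.

Lemma epsE A : eps A =
  (\sum_j mass j / (size (orb j))%:R * \sum_(q <- orb j) \1_A (pt R q))%:E.
Proof. by rewrite /eps uniform_seqE size_map size_support504 big_map sum_support504. Qed.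

Lemma orb_rot j : perm_eq (map rot84 (orb j)) (orb j).
Proof. by rewrite /orb /orbits; case: b; case: j => [[|[|[|[|[|//]]]]] Hj]; vm_compute. Qed.

Lemma orb_refl j : perm_eq (map refl84 (orb j)) (orb j).
Proof. by rewrite /orb /orbits; case: b; case: j => [[|[|[|[|[|//]]]]] Hj]; vm_compute. Qed.

Lemma eps_D12 : D12_invariant eps.
Proof.
have H g T : (forall j, perm_eq (map g (orb j)) (orb j)) ->
    (forall q, pt R (g q) = torus_act T (pt R q)) -> forall A, eps (torus_act T @^-1` A) = eps A.
  move=> gp gE A; rewrite !epsE; congr EFin; apply: eq_bigr => j _; congr (_ * _).
  rewrite -[RHS](perm_big _ (gp j)) big_map; apply: eq_bigr => q _.
  by rewrite gE !indicE.
apply: D12_invariant_gen; first exact: (H _ _ orb_refl (@pt_refl84 R)).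
exact: (H _ _ orb_rot (@pt_rot84 R)).
Qed.

Lemma val_orb j q : q \in orb j -> rchi1 (pt R q) = val1 j /\ rchi2 (pt R q) = val2 j.
Proof.
case: j => [[|[|[|[|[|//]]]]] Hj]; rewrite /orb /val1 /val2 /=.
- exact: rchi_orbit1.
- exact: rchi_orbit2.
- exact: rchi_orbit3.
- exact: rchi_orbit4.
exact: rchi_orbit7.
Qed.

Lemma orb_val j w : rchi1 w = val1 j -> rchi2 w = val2 j -> exists2 q, q \in orb j & w = pt R q.
Proof.
case: j => [[|[|[|[|[|//]]]]] Hj]; rewrite /orb /val1 /val2 /=.
- exact: fibre1.
- exact: fibre2.
- exact: fibre3.
- exact: fibre4.
exact: fibre7.
Qed.

Definition moment m n : R := \sum_j mass j * (val1 j ^+ m * val2 j ^+ n).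

Lemma bm_moment m n : bounded_measurable (fun w => rchi1 w ^+ m * rchi2 w ^+ n).
Proof. by apply: bmM; apply: bmX; [exact: bm_rchi1 | exact: bm_rchi2]. Qed.

Lemma size_orb_neq0 j : (size (orb j))%:R != 0 :> R.
Proof. by rewrite pnatr_eq0 /orb /orbits; case: j => [[|[|[|[|[|//]]]]] Hj] //=; case: b. Qed.

Lemma sum_orb_cst j (c : R) : \sum_(q <- orb j) c = (size (orb j))%:R * c.
Proof. by rewrite big_tnth sumr_const card_ord mulr_natl. Qed.

Lemma eps_moment m n : Rintegral eps setT (fun w => rchi1 w ^+ m * rchi2 w ^+ n) = moment m n.
Proof.
rewrite /Rintegral integral_uniform_seq //; last by case: (bm_moment m n).
rewrite size_map size_support504 big_map sum_support504 /=; apply: eq_bigr => j _.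
rewrite (eq_big_seq (fun=> val1 j ^+ m * val2 j ^+ n)) => [|q qj]; last first.
  by rewrite indicT mulr1; have [-> ->] := val_orb qj.
by rewrite sum_orb_cst mulrA divfK // size_orb_neq0.
Qed.

Lemma Cintegral_moment (mu : {measure set (torus R) -> \bar R}) m n :
  Cintegral mu (fun w => chi1 w ^+ m * chi2 w ^+ n) =
  (Rintegral mu setT (fun w => rchi1 w ^+ m * rchi2 w ^+ n))%:C%C.
Proof.
have E w : chi1 w ^+ m * chi2 w ^+ n = (rchi1 w ^+ m * rchi2 w ^+ n)%:C%C.
  by rewrite chi1_real chi2_real complexM !rmorphXn.
rewrite /Cintegral; under [X in (X +i* _)%C]eq_Rintegral do rewrite E.
under [X in (_ +i* X)%C]eq_Rintegral do rewrite E.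
by rewrite /= Rintegral_cst // mul0r.
Qed.

Lemma orb_reach j q : q \in orb j ->
  q \in [seq iter i rot84 (iter k refl84 (head (0, 0)%N (orb j))) | i <- iota 0 6, k <- iota 0 2].
Proof.
by move: q; apply/allP; rewrite /orb /orbits; case: b; case: j => [[|[|[|[|[|//]]]]] Hj];
  vm_compute.
Qed.

Lemma orb_const (mu : set (torus R) -> \bar R) j q : D12_invariant mu -> q \in orb j ->
  mu [set pt R q] = mu [set pt R (head (0, 0)%N (orb j))].
Proof.
move=> inv /orb_reach/allpairsP[[i k] /= [_ _ ->]].
have rotE x : mu [set pt R (rot84 x)] = mu [set pt R x].
  by rewrite pt_rot84; apply: (D12_invariant_set1 _ inv); constructor.
have reflE x : mu [set pt R (refl84 x)] = mu [set pt R x].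
  by rewrite pt_refl84; apply: (D12_invariant_set1 _ inv); constructor.
elim: i => [|i IHi]; last by rewrite iterS rotE.
by elim: k => [|k IHk] //; rewrite iterS reflE.
Qed.

Lemma val_distinct (i j : 'I_5) : i != j -> (val1 i != val1 j) || (val2 i != val2 j).
Proof.
apply: contraNT; rewrite negb_or !negbK => /andP[/eqP + /eqP +].
by rewrite /val2 /val1; case: i j => [[|[|[|[|[|//]]]]] Hi] [[|[|[|[|[|//]]]]] Hj] //= *; lra.
Qed.

Lemma support_uniq : uniq (flatten orbits) /\
  all [pred q | (q.1 < 84) && (q.2 < 84)]%N (flatten orbits).
Proof. by rewrite /orbits; case: b; split; vm_compute. Qed.

(** The moments determine the mass of each fibre of (chi1, chi2); a fibre is a single
    Weyl orbit, so invariance determines the mass of each of its points, and these masses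
    already add up to 1. *)
Lemma eps_unique (mu : probability (torus R) R) : D12_invariant mu ->
  (forall m n, Rintegral mu setT (fun w => rchi1 w ^+ m * rchi2 w ^+ n) = moment m n) ->
  forall A, measurable A -> mu A = eps A.
Proof.
move=> inv mom A mA.
have [us as84] := support_uniq.
have uj j : uniq (map (pt R) (orb j)).
  apply: uniq_map_pt; rewrite /orb.
    by rewrite /orbits; case: b; case: j => [[|[|[|[|[|//]]]]] Hj]; vm_compute.
  by rewrite /orbits; case: b; case: j => [[|[|[|[|[|//]]]]] Hj]; vm_compute.
have massE j q : q \in orb j -> fine (mu [set pt R q]) = mass j / (size (orb j))%:R.
  move=> qj; have := mu_fibre (@bm_rchi1 R) (@bm_rchi2 R) mom val_distinct j.
  have -> : fibre (@rchi1 R) (@rchi2 R) val1 val2 j = [set` map (pt R) (orb j)].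
    apply/seteqP; split=> w /=.
      by case=> /orb_val/[apply] -[p pj ->]; apply: map_f.
    by case/mapP => p pj ->; apply: val_orb.
  move=> /(congr1 fine); rewrite (measure_seq (@measurable_torus1 R)) // big_map.
  rewrite (eq_big_seq (fun=> fine (mu [set pt R q]))) => [|p pj]; last first.
    by rewrite (orb_const inv pj) (orb_const inv qj).
  by rewrite sum_orb_cst mulrC => /(canRL (mulfK (size_orb_neq0 j))).
have sumE (f : torus R -> R) : \sum_(w <- map (pt R) (flatten orbits)) f w =
    \sum_j \sum_(q <- orb j) f (pt R q).
  by rewrite big_map big_flatten (big_nth [::]) big_mkord; apply: eq_bigr.
have := atoms_determine (@measurable_torus1 R) (mu := mu) (@uniq_map_pt R _ us as84)
  (fun w _ => erefl (fine (mu [set w]))).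
have E (g : torus R -> R) : \sum_(w <- map (pt R) (flatten orbits)) fine (mu [set w]) * g w =
    \sum_j mass j / (size (orb j))%:R * \sum_(q <- orb j) g (pt R q).
  rewrite sumE; apply: eq_bigr => j _; rewrite mulr_sumr.
  by apply: eq_big_seq => q /massE ->.
have := E (fun=> 1).
under eq_bigr do rewrite mulr1.
under [RHS]eq_bigr do rewrite sum_orb_cst mulr1 divfK ?size_orb_neq0 //.
move=> ->; have -> : \sum_j mass j = 1 by rewrite big_ord5 /mass !inordK //=; lra.
move=> /(_ erefl A mA) muA.
by rewrite (prob_fin mu mA) muA epsE E.
Qed.

End AtomicMeasure.

(** * The densities J and K on torsion points *)

Section Turns.
Local Open Scope classical_set_scope.
Variable R : realType.
Local Notation C := R[i].
Implicit Types (s t : R) (a b c : nat).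

Lemma cos_turnE s : cos_turn s = complex.Re (cexp s : C).
Proof. by []. Qed.

Lemma sin_turnE s : sin_turn s = complex.Im (cexp s : C).
Proof. by []. Qed.

Lemma cexp_diff a c : cexp (a%:R / 84 - c%:R / 84) = root84 R (a + 83 * c).
Proof.
apply: circle_inj; rewrite (root84D R a) root84V.
apply: (mulIf (circle_neq0 (root84 R c))); rewrite mulfVK ?circle_neq0 //.
by rewrite -cexpD subrK.
Qed.

Definition im84 k : R := complex.Im (root84 R k).

Lemma cos_turn84 a c s : s = a%:R / 84 - c%:R / 84 -> cos_turn s = re84 R ((a + 83 * c) %% 84)
  / 2.
Proof.
by move=> ->; rewrite cos_turnE cexp_diff re84_mod /re84 mulrAC divff ?mul1r // pnatr_eq0.
Qed.

Lemma sin_turn84 a c s : s = a%:R / 84 - c%:R / 84 -> sin_turn s = im84 ((a + 83 * c) %% 84).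
Proof. by move=> ->; rewrite sin_turnE cexp_diff /im84 root84_mod. Qed.

Definition jsum a b : R :=
  re84 R ((2 * a + b) %% 84) + re84 R ((a + 83 * (3 * b)) %% 84)
  + re84 R ((3 * a + 83 * (2 * b)) %% 84) - re84 R ((a + 2 * b) %% 84)
  - re84 R ((3 * a + 83 * b) %% 84) - re84 R ((2 * a + 83 * (3 * b)) %% 84).

Lemma J84 a b : J (a%:R / 84) (b%:R / 84) = 4 * pi ^+ 2 * jsum a b :> R.
Proof.
rewrite /J (@cos_turn84 (2 * a + b) 0); last by rewrite natrD natrM; field.
rewrite (@cos_turn84 a (3 * b)); last by rewrite natrM; field.
rewrite (@cos_turn84 (3 * a) (2 * b)); last by rewrite !natrM; field.
rewrite (@cos_turn84 (a + 2 * b) 0); last by rewrite natrD natrM; field.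
rewrite (@cos_turn84 (3 * a) b); last by rewrite !natrM; field.
rewrite (@cos_turn84 (2 * a) (3 * b)); last by rewrite !natrM; field.
by rewrite !muln0 !addn0 /jsum; field.
Qed.

Lemma K84 a b : K (a%:R / 84) (b%:R / 84) =
  4 * (im84 ((a + b) %% 84) - im84 ((2 * a + 83 * b) %% 84) - im84 ((2 * b + 83 * a) %% 84)) ^+
    2 :> R.
Proof.
rewrite /K (@sin_turn84 (a + b) 0); last by rewrite natrD; field.
rewrite (@sin_turn84 (2 * a) b); last by rewrite !natrM; field.
rewrite (@sin_turn84 (2 * b) a); last by rewrite !natrM; field.
by rewrite !muln0 !addn0.
Qed.

Definition grid84 k m : seq (nat * nat) :=
  [seq (m * a, m * b)%N | a <- iota 0 k, b <- iota 0 k].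

Lemma grid84P k m q : q \in grid84 k m ->
  exists a b, [/\ (a < k)%N, (b < k)%N & q = (m * a, m * b)%N].
Proof.
by move=> /allpairsP[[a b] [+ + ->]]; rewrite !mem_iota !add0n; exists a, b.
Qed.

(** At a point with three distinct nontrivial traces of order 7, three of the six cosines
    are 1 and the other three add up to -1/2; at all other points the terms cancel in
    pairs. *)
Lemma J_grid7 q : q \in grid84 7 12 -> (672 * pi ^+ 4)^-1 * J (q.1%:R / 84) (q.2%:R / 84) ^+ 2 =
  (if q \in orbit7 then 7 / 6 else 0) :> R.
Proof.
move=> qG; rewrite J84; have : jsum q.1 q.2 ^+ 2 = if q \in orbit7 then 49 else 0.
  have S : re84 R 36 = -1 - re84 R 12 - re84 R 24 by have := re84_sum7 R; lra.
  case: (grid84P qG) => a [b [+ + ->]].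
  rewrite /jsum; case: a => [|[|[|[|[|[|[|//]]]]]]] _; case: b => [|[|[|[|[|[|[|//]]]]]]] _ //=;
    by rewrite ?(re84_0, re84_72, re84_60, re84_48) ?S; ring.
have p0 : pi != 0 :> R by rewrite gt_eqF // pi_gt0.
move=> E; transitivity (jsum q.1 q.2 ^+ 2 / 42).
  by move: (pi : R) p0 => p p0; field.
by rewrite E; case: ifP => _; field.
Qed.

Lemma im84_21 : [/\ im84 0 = 0, im84 21 = 1, im84 42 = 0 & im84 63 = -1].
Proof.
have im0 : im84 0 = 0 by rewrite /im84 /root84 mul0r cexp0.
have im1 : im84 21 = 1.
  rewrite /im84 -sin_turnE /sin_turn -[RHS](sin_pihalf R); congr sin; by field.
have zE : (root84 R 21 : C) = (0 +i* 1)%C.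
  have := re84_21 R; rewrite /re84; move: im1; rewrite /im84.
  by case: (root84 R 21 : C) => u v /= -> E; congr (_ +i* _)%C; lra.
split=> //; rewrite /im84.
  by rewrite (root84D R 21 21) zE; simpc.
by rewrite (root84D R 21 42) (root84D R 21 21) zE; simpc.
Qed.

Lemma K_grid4 q : q \in grid84 4 21 -> K (q.1%:R / 84) (q.2%:R / 84) =
  (if q \in orbit4 true then 16 else 0) :> R.
Proof.
move=> qG; rewrite K84; have [i0 i21 i42 i63] := im84_21.
case: (grid84P qG) => a [b [+ + ->]].
case: a => [|[|[|[|//]]]] _; case: b => [|[|[|[|//]]]] _ //=;
  by rewrite ?(i0, i21, i42, i63); ring.
Qed.

(** ** Measurability *)

(** The angle itself jumps at 1; its cosine and sine, in turns, are the coordinates of the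
    point. *)
Definition trig (f : torus R -> R) :=
  measurable_fun setT (fun w => cos_turn (f w)) /\ measurable_fun setT (fun w => sin_turn (f w)).

Lemma trig_angle1 : trig (fun w => angle w.1).
Proof.
split; [under eq_fun do rewrite cos_turnE (angleP _).2|under eq_fun do rewrite sin_turnE
  (angleP _).2].
  exact: (measurableT_comp (@measurable_Re R) (@measurable_fst _ _ _ _)).
exact: (measurableT_comp (@measurable_Im R) (@measurable_fst _ _ _ _)).
Qed.

Lemma trig_angle2 : trig (fun w => angle w.2).
Proof.
split; [under eq_fun do rewrite cos_turnE (angleP _).2|under eq_fun do rewrite sin_turnE
  (angleP _).2].
  exact: (measurableT_comp (@measurable_Re R) (@measurable_snd _ _ _ _)).
exact: (measurableT_comp (@measurable_Im R) (@measurable_snd _ _ _ _)).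
Qed.

Lemma trigD f g : trig f -> trig g -> trig (fun w => f w + g w).
Proof.
move=> [cf sf] [cg sg]; rewrite /trig /cos_turn /sin_turn; split.
  under eq_fun do rewrite mulrDr cosD.
  by apply: measurable_funB; apply: measurable_funM.
under eq_fun do rewrite mulrDr sinD.
by apply: measurable_funD; apply: measurable_funM.
Qed.

Lemma trigN f : trig f -> trig (fun w => - f w).
Proof.
move=> [cf sf]; rewrite /trig /cos_turn /sin_turn; split.
  by under eq_fun do rewrite mulrN cosN.
by under eq_fun do rewrite mulrN sinN; exact: measurableT_comp.
Qed.

Lemma trigMn n f : trig f -> trig (fun w => n%:R * f w).
Proof.
move=> tf; elim: n => [|n IHn].
  rewrite /trig; split; under eq_fun do rewrite mul0r; exact: measurable_cst.
by under eq_fun do rewrite -natr1 mulrDl mul1r; exact: trigD.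
Qed.

Lemma measurable_J : measurable_fun setT (fun w : torus R => J (angle w.1) (angle w.2)).
Proof.
have t1 := trig_angle1; have t2 := trig_angle2.
apply: measurable_funM; first exact: measurable_cst.
have mcos f : trig f -> measurable_fun setT (fun w => cos_turn (f w)) by case.
do ![apply: measurable_funB]; do ?[apply: measurable_funD];
  by apply: mcos; do ?[exact: t1 | exact: t2 | apply: trigMn | apply: trigN | apply: trigD].
Qed.

Lemma measurable_K : measurable_fun setT (fun w : torus R => K (angle w.1) (angle w.2)).
Proof.
have t1 := trig_angle1; have t2 := trig_angle2.
apply: measurable_funM; first exact: measurable_cst.
have msin f : trig f -> measurable_fun setT (fun w => sin_turn (f w)) by case.
apply: measurable_funX; do ![apply: measurable_funB];
  by apply: msin; do ?[exact: t1 | exact: t2 | apply: trigMn | apply: trigN | apply: trigD].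
Qed.

End Turns.

(** ** Integrals over grids of torsion points *)

Section Grids.
Local Open Scope classical_set_scope.
Variable R : realType.
Implicit Type A : set (torus R).

Lemma root_unity84 k m q : (k * m = 84)%N -> root_unity R q k = root84 R (m * q).
Proof.
move=> km; have k0 : k%:R != 0 :> R by rewrite pnatr_eq0; case: k km.
have m0 : m%:R != 0 :> R by rewrite pnatr_eq0; case: m km; rewrite ?muln0.
by rewrite /root_unity /root84 -km !natrM; congr cexp; field; rewrite k0 m0.
Qed.

Lemma product_unif_roots k m A : (k * m = 84)%N -> measurable A ->
  (unif_roots R k \x unif_roots R k)%E A = uniform_seq R (map (pt R) (grid84 k m)) A.
Proof.
move=> km; suff E B1 B2 : uniform_seq R (map (pt R) (grid84 k m)) (B1 `*` B2) =
    (unif_roots R k B1 * unif_roots R k B2)%E.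
  by apply: product_measure_unique => B1 B2 _ _; exact: E.
rewrite /unif_roots !uniform_seqE -EFinM; congr EFin.
rewrite !size_map size_allpairs !size_iota natrM invfM mulrACA; congr (_ * _).
rewrite big_map big_allpairs_dep /= !big_map mulr_suml.
apply: eq_bigr => a _; rewrite mulr_sumr; apply: eq_bigr => b _.
rewrite !(root_unity84 _ km) -natrM mulnb !indicE; congr (_%:R); congr nat_of_bool.
by apply/idP/andP => [/set_mem[/= h1 h2]|[/set_mem h1 /set_mem h2]]; [split|]; apply/mem_set.
Qed.

Lemma weighted_unif_roots k m (f : R -> R -> R) A : (k * m = 84)%N -> measurable A ->
  measurable_fun setT (fun w : torus R => f (angle w.1) (angle w.2)) ->
  weighted f (unif_roots R k \x unif_roots R k)%E A =
  ((k ^ 2)%:R^-1 * \sum_(q <- grid84 k m) f (q.1%:R / 84) (q.2%:R / 84) * \1_A (pt R q))%:E.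
Proof.
move=> km mA mf; rewrite /weighted.
rewrite (eq_measure_integral (uniform_seq R (map (pt R) (grid84 k m)))); last first.
  by move=> B mB _; apply: product_unif_roots.
rewrite (integral_uniform_seq _ mA mf) size_map size_allpairs !size_iota mulnn big_map.
congr (_ * _)%:E; apply: eq_big_seq => q /grid84P[a [b [ak bk ->]]] /=.
have lt84 c : (c < k)%N -> 0 <= ((m * c)%:R / 84 : R) < 1.
  move=> ck; rewrite divr_ge0 //= ltr_pdivrMr // mul1r (ltr_nat _ _ 84) -km mulnC.
  by rewrite ltn_pmul2r //; case: m km; rewrite ?muln0.
by rewrite /root84 !angle_cexp ?lt84.
Qed.

End Grids.

(** * Comparison of atoms *)

Section PublishedFormula.
Local Open Scope classical_set_scope.
Variables (R : realType) (b : bool) (A : set (torus R)).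
Hypothesis mA : measurable A.
Definition orbit_sum (l : seq (nat * nat)) : R := \sum_(q <- l) \1_A (pt R q).

(** The points of order 3 outside [orbit3]; together with the origin they carry
    d^(1). *)
Definition central3 : seq (nat * nat) := [:: (28, 56); (56, 28)]%N.

Lemma sum_if (l o : seq (nat * nat)) (c : R) : uniq l -> uniq o -> {subset o <= l} ->
  \sum_(q <- l) (if q \in o then c else 0) * \1_A (pt R q) = c * orbit_sum o.
Proof.
move=> ul uo ol; transitivity (c * \sum_(q <- l | q \in o) \1_A (pt R q)).
  rewrite mulr_sumr [RHS]big_mkcond; apply: eq_bigr => q _.
  by case: ifP; rewrite ?mul0r.
rewrite -big_filter; congr (_ * _); apply: perm_big; apply: uniq_perm => //.
  exact: filter_uniq.
move=> q; rewrite mem_filter; case qo: (q \in o) => //=; exact: ol.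
Qed.

Lemma weighted_J : weighted (fun t1 t2 => (672 * pi ^+ 4)^-1 * J t1 t2 ^+ 2)
  (unif_roots R 7 \x unif_roots R 7)%E A = (42^-1 * orbit_sum orbit7)%:E.
Proof.
rewrite (weighted_unif_roots (k := 7) (m := 12) erefl mA); last first.
  by apply: measurable_funM => //; apply: measurable_funX; exact: measurable_J.
rewrite (eq_big_seq (fun q => (if q \in orbit7 then 7 / 6 else 0) * \1_A (pt R q))) => [|q qG].
  rewrite (@sum_if _ orbit7) //; last by apply/allP.
  by congr EFin; rewrite mulrA; congr (_ * _); field.
by rewrite (J_grid7 R qG).
Qed.

(** The part of the 4-torsion on which the density does not vanish. *)
Definition support4 := if b then orbit4 true else orbit1 ++ orbit2 ++ orbit4 false.

Lemma weighted_K : weighted (fun t1 t2 => 24^-1 * (if b then K t1 t2 else 16 - K t1 t2))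
  (unif_roots R 4 \x unif_roots R 4)%E A = (24^-1 * orbit_sum support4)%:E.
Proof.
have mK := @measurable_K R.
rewrite (weighted_unif_roots (k := 4) (m := 21) erefl mA); last first.
  by case: b; apply: measurable_funM => //; apply: measurable_funB.
rewrite (eq_big_seq (fun q => (if q \in support4 then 2 / 3 else 0) * \1_A (pt R q))) => [|q qG].
  rewrite (@sum_if _ support4) /support4 //; do ?[by case: b; vm_compute].
    by congr EFin; rewrite mulrA; congr (_ * _); field.
  by case: b; apply/allP.
congr (_ * _); rewrite (K_grid4 R qG) /support4.
have -> : q \in (if b then orbit4 true else orbit1 ++ orbit2 ++ orbit4 false) =
    (b == (q \in orbit4 true)).
  by apply/eqP; move: q qG; apply/allP; case: b; vm_compute.
by case: b; case: (q \in _) => /=; field.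
Qed.

Lemma product_unif_rootsE k m : (k * m = 84)%N ->
  (unif_roots R k \x unif_roots R k)%E A = ((k ^ 2)%:R^-1 * orbit_sum (grid84 k m))%:E.
Proof.
move=> km; rewrite (product_unif_roots km mA) uniform_seqE size_map size_allpairs.
by rewrite !size_iota mulnn big_map.
Qed.

Lemma unif_diag1 : unif_diag R 1 A = (3^-1 * orbit_sum (orbit1 ++ central3))%:E.
Proof.
rewrite /unif_diag uniform_seqE size_map.
have -> : size [seq q <- [seq (q1, q2) | q1 <- iota 0 (3 * 1), q2 <- iota 0 (3 * 1)]
    | (3 %| q.1 + q.2)%N] = 3%N by [].
rewrite big_map; congr (_ * _)%:E.
have -> : [seq q <- [seq (q1, q2) | q1 <- iota 0 (3 * 1), q2 <- iota 0 (3 * 1)]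
    | (3 %| q.1 + q.2)%N] = [:: (0, 0); (1, 2); (2, 1)]%N by [].
rewrite /orbit_sum /= !big_cons !big_nil.
by rewrite !(@root_unity84 R (3 * 1) 28).
Qed.

Lemma orbit_sum_perm l l' : perm_eq l l' -> orbit_sum l = orbit_sum l'.
Proof. exact: perm_big. Qed.

Lemma orbit_sum_cat l l' : orbit_sum (l ++ l') = orbit_sum l + orbit_sum l'.
Proof. exact: big_cat. Qed.

(** The atoms of order 7 and 4 come from the two densities.  On the 3-torsion the points of
    [central3] get 1/18 from d_3 x d_3 and lose as much from d^(1); for beta = 1 the points of
    order 2 get their mass 1/24 from d_2 x d_2, and otherwise from the density 16 - K.  The
    negative multiple of d_1 x d_1 corrects the mass of the origin. *)
Lemma published_formula (beta : R) : beta = (if b then 1 else 0) ->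
  eps b A = (weighted (fun t1 t2 => (672 * pi ^+ 4)^-1 * J t1 t2 ^+ 2)%R
          (unif_roots R 7 \x unif_roots R 7) A
        + weighted (fun t1 t2 => 24^-1 * (if b then K t1 t2 else 16 - K t1 t2))%R
            (unif_roots R 4 \x unif_roots R 4) A
        + (2^-1)%:E * (unif_roots R 3 \x unif_roots R 3) A
        + (6^-1 * beta)%:E * (unif_roots R 2 \x unif_roots R 2) A
        - (28^-1)%:E * (unif_roots R 1 \x unif_roots R 1) A
        - (6^-1)%:E * unif_diag R 1 A)%E.
Proof.
move=> ->; rewrite weighted_J weighted_K unif_diag1.
rewrite (@product_unif_rootsE 3 28) // (@product_unif_rootsE 2 42) //.
rewrite (@product_unif_rootsE 1 84) //.
rewrite -!EFinM -!EFinN -!EFinD epsE; congr EFin.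
rewrite (@orbit_sum_perm (grid84 3 28) (orbit1 ++ orbit3 ++ central3)) //.
rewrite (@orbit_sum_perm (grid84 2 42) (orbit1 ++ orbit2)) //.
rewrite (@orbit_sum_perm (grid84 1 84) orbit1) // !orbit_sum_cat big_ord5 /orb /mass !inordK //.
rewrite -[nth [::] _ 0]/orbit1 -[nth [::] _ 1]/orbit2 -[nth [::] _ 2]/orbit3.
rewrite -[nth [::] _ 3]/(orbit4 b) -[nth [::] _ 4]/orbit7 -!/(orbit_sum _).
rewrite -[size orbit1]/1%N -[size orbit2]/3%N -[size orbit3]/6%N -[size orbit7]/12%N.
have -> : size (orbit4 b) = 6%N by case: b.
rewrite /support4; case: b; rewrite ?orbit_sum_cat.
  move: (orbit_sum orbit1) (orbit_sum orbit2) (orbit_sum orbit3) (orbit_sum (orbit4 true))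
    (orbit_sum orbit7) (orbit_sum central3).
  by move=> s1 s2 s3 s4 s7 s /=; field.
move: (orbit_sum orbit1) (orbit_sum orbit2) (orbit_sum orbit3) (orbit_sum (orbit4 false))
  (orbit_sum orbit7) (orbit_sum central3).
by move=> s1 s2 s3 s4 s7 s /=; field.
Qed.

End PublishedFormula.

(** * The joint spectral measure *)

Section JointSpectralMeasurePSL27.
Local Open Scope classical_set_scope.
Variables (R : realType) (iota : G2_embedding R PSL27) (b : bool).
Hypothesis type_b :
  varrho1_is_7 iota /\ b = false \/ varrho1_is_1_3_3conj iota /\ b = true.

Lemma mckay_moment_orbits m n : mckay_moment iota m n = (moment R b m n)%:C%C.
Proof.
have H := @mckay_moment_PSL27 R iota (if b then 3 else -1) m n.
rewrite {}H; last by case: type_b => -[h ->]; [left|right].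
congr (_%:C%C); rewrite /moment big_ord5 /mass /val1 /val2 !inordK //.
by rewrite /=; field.
Qed.

Lemma joint_spectral_measure_eps : joint_spectral_measure iota (eps (R := R) b).
Proof.
split.
  split; first exact: eps_D12.
  move=> m n; split; last exact: mckay_class_moment.
  by rewrite Cintegral_moment eps_moment mckay_moment_orbits.
move=> mu [inv mom] A mA; apply: eps_unique => // m n.
have [E _] := mom m n; apply: (@complexI R).
by rewrite -mckay_moment_orbits -E Cintegral_moment.
Qed.

End JointSpectralMeasurePSL27.

Unset Implicit Arguments.
Local Open Scope classical_set_scope.
Local Open Scope ring_scope.

Theorem theorem4p1 (R : realType) (iota : G2_embedding R PSL27)
    (K' : R -> R -> R) (beta : R) :
  varrho1_is_7 iota /\ K' = (fun t1 t2 => 16 - K t1 t2) /\ beta = 0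
  \/ varrho1_is_1_3_3conj iota /\ K' = @K R /\ beta = 1 ->
  exists eps : probability (torus R) R,
    joint_spectral_measure iota eps /\
    forall A : set (torus R), measurable A ->
      (eps A =
        weighted (fun t1 t2 => (672 * pi ^+ 4)^-1 * J t1 t2 ^+ 2)%R
          (unif_roots R 7 \x unif_roots R 7) A
        + weighted (fun t1 t2 => 24^-1 * K' t1 t2)%R
            (unif_roots R 4 \x unif_roots R 4) A
        + (2^-1)%:E * (unif_roots R 3 \x unif_roots R 3) A
        + (6^-1 * beta)%:E * (unif_roots R 2 \x unif_roots R 2) A
        - (28^-1)%:E * (unif_roots R 1 \x unif_roots R 1) A
        - (6^-1)%:E * unif_diag R 1 A)%E.
Proof.
case=> [[h [-> ->]]|[h [-> ->]]].
  exists (eps (R := R) false); split; first by apply: joint_spectral_measure_eps; left.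
  by move=> A mA; apply: (@published_formula R false).
exists (eps (R := R) true); split; first by apply: joint_spectral_measure_eps; right.
by move=> A mA; apply: (@published_formula R true).
Qed.
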